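(* Let $f,g\in R=\mathbb{C}\{x_1,\dots,x_n\}$ be nonzero holomorphic functions such that $f/g$ is not constant. Then: (1) For every $\lambda\in\mathbb{R}_{\ge 0}$ and every $\ell\in\mathbb{N}$, $$\mathcal{J}\Big(\Big(\frac fg\Big)^{\lambda+\ell}\Big)=\left(\frac{f^\ell}{g^\ell}\,\mathcal{J}\Big(\Big(\frac fg\Big)^{\lambda}\Big)\right)\cap R.$$ In particular, if $\lambda+1$ is a jumping number of $f/g$, then $\lambda$ is a jumping number of $f/g$. (2) For every $\lambda\in\mathbb{R}_{>0}$ we have $\mathcal{J}(f^\lambda)\subseteq\mathcal{J}\big((\frac fg)^\lambda\big)$. In addition, $\mathcal{J}\big((\frac fg)^m\big)=(f^m)$ for every $m\in\mathbb{Z}_{>0}$.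
   Context: $R=\mathbb{C}\{x_1,\dots,x_n\}$ is the ring of germs of holomorphic functions at the origin of $\mathbb{C}^n$. The multiplier ideal (at the origin) of $f/g$ at the exponent $\lambda$ is $$\mathcal{J}\Big(\Big(\frac fg\Big)^{\lambda}\Big)=\left\{h\in R:\int_{B_r(0)}\frac{|h|^2|g|^{2\lambda}}{|f|^{2\lambda}}<\infty\text{ for some }r>0\right\},$$ where $B_r(0)$ is the closed ball of radius $r$ around the origin; $\mathcal{J}(f^\lambda)$ is the same with $g=1$. The product and the intersection in (1) are taken in the fraction field of $R$. A number $\lambda\in\mathbb{R}_{\ge 0}$ is a jumping number of $f/g$ if for every $\varepsilon>0$ we have either $\mathcal{J}((f/g)^{\lambda})\ne\mathcal{J}((f/g)^{\lambda-\varepsilon})$ or $\mathcal{J}((f/g)^{\lambda})\neq\mathcal{J}((f/g)^{\lambda+\varepsilon})$.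
   Formalization: The equality J((f/g)^m) = (f^m) is stated for f and g without common factor (false for f = x, g = x^2), and in the definition of jumping number only ε ≤ λ is considered, so 0 is always a jumping number (otherwise f = x, g = 1 refutes the claim at λ = 0). *)

(* Defs.v *)
(* MathComp-Analysis, over an abstract [R : realType]; the complex numbers are
   [R[i]]. *)
From HB Require Import structures.
From mathcomp Require Import all_boot all_order all_algebra.
From mathcomp Require Import generic_quotient ring_quotient complex.
From mathcomp Require Import all_classical all_reals all_analysis.
Set Implicit Arguments.
Unset Strict Implicit.
Unset Printing Implicit Defensive.
Import Order.TTheory GRing.Theory Num.Theory.
Import numFieldNormedType.Exports.
Local Open Scope classical_set_scope.
Local Open Scope ring_scope.

Section tuple_measure.
Local Open Scope ereal_scope.
Context d (T : measurableType d) (R : realType).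
Variable mu : {sigma_finite_measure set T -> \bar R}.

Definition cons_pair n (p : T * n.-tuple T) : n.+1.-tuple T :=
  [tuple of p.1 :: p.2].

Lemma measurable_cons_pair n : measurable_fun setT (@cons_pair n).
Proof. exact: (@measurable_cons _ _ _ _ fst _ snd). Qed.

Section cons_measure.
Context (n : nat) (m : {sigma_finite_measure set (n.-tuple T) -> \bar R}).

Definition cons_measure : set (n.+1.-tuple T) -> \bar R :=
  pushforward (mu \x m) (@cons_pair n).

Let cons_measure_measure : {measure set (n.+1.-tuple T) -> \bar R} :=
  measure_function_pushforward__canonical__measure_function_Measure
    (mu \x m) (@measurable_cons_pair n).

HB.instance Definition _ := isMeasure.Build _ _ _ cons_measure
  (measure0 cons_measure_measure) (measure_ge0 cons_measure_measure)
  (@measure_semi_sigma_additive _ _ _ cons_measure_measure).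

Let cons_measure_sigma_finite : sigma_finite setT cons_measure.
Proof.
have /sigma_finiteP[F [TF ndF Foo]] := sigma_finiteT mu.
have /sigma_finiteP[G [TG ndG Goo]] := sigma_finiteT m.
pose uncons (t : n.+1.-tuple T) : T * n.-tuple T :=
  (thead t, [tuple of behead t]).
exists (fun k => uncons @^-1` (F k `*` G k)).
  apply/seteqP; split => // t _.
  have [k _ Fk] : (\bigcup_i F i) (uncons t).1 by rewrite -TF.
  have [l _ Gl] : (\bigcup_i G i) (uncons t).2 by rewrite -TG.
  exists (maxn k l) => //; split.
    by move: Fk; exact/subsetPset/ndF/leq_maxl.
  by move: Gl; exact/subsetPset/ndG/leq_maxr.
move=> k; have [mF Fk] := Foo k; have [mG Gk] := Goo k; split.
  rewrite -[X in measurable X]setTI.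
  have : measurable_fun setT uncons.
    by apply: measurable_fun_pair;
      [exact: measurable_tnth|exact: measurable_behead].
  by apply => //; exact: measurableX.
rewrite /cons_measure /pushforward [X in (mu \x m) X](_ : _ = F k `*` G k).
  by rewrite product_measure1E// lte_mul_pinfty// ge0_fin_numE.
have consK : uncons \o @cons_pair n = id.
  by apply/funext => -[x t]; congr pair; exact: val_inj.
by rewrite -comp_preimage consK.
Qed.

HB.instance Definition _ := Measure_isSigmaFinite.Build _ _ _ cons_measure
  cons_measure_sigma_finite.

End cons_measure.

(* The [n]-fold product of [mu]. *)
Fixpoint tuple_measure (n : nat) :
    {sigma_finite_measure set (n.-tuple T) -> \bar R} :=
  match n with
  | 0%N => @dirac _ (0.-tuple T) [tuple] R
  | k.+1 => cons_measure (tuple_measure k)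
  end.

End tuple_measure.

Section germ.
Context (R : realType) (n : nat).
Local Notation C := R[i]^o.

Definition holomorphic_at0 : {pred 'rV[C]_n -> C} :=
  fun f => `[< \forall z \near (0 : 'rV[C]_n), differentiable f z >].

Let holomorphic_at0_subring : subring_closed holomorphic_at0.
Proof.
split.
- by apply/asboolP; near=> z; exact: differentiable_cst.
- move=> f g /asboolP hf /asboolP hg; apply/asboolP.
  by near=> z; apply: differentiableB; near: z.
- move=> f g /asboolP hf /asboolP hg; apply/asboolP.
  by near=> z; apply: differentiableM; near: z.
Unshelve. all: by end_near. Qed.

HB.instance Definition _ :=
  GRing.isSubringClosed.Build _ holomorphic_at0 holomorphic_at0_subring.

Record holo := Holo {
  holo_fun :> 'rV[C]_n -> C ;
  _ : holo_fun \in holomorphic_at0 }.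

HB.instance Definition _ := [isSub for holo_fun].
HB.instance Definition _ := [Choice of holo by <:].
HB.instance Definition _ := [SubChoice_isSubComNzRing of holo by <:].

Definition zero_at0 : {pred holo} :=
  fun f => `[< \forall z \near (0 : 'rV[C]_n), f z = 0 >].

Let zero_at0_idealr : idealr_closed zero_at0.
Proof.
split.
- by apply/asboolP; near=> z.
- apply/negP => /asboolP /nbhs_singleton/eqP.
  by rewrite [X in X == 0](_ : _ = 1) ?oner_eq0.
- move=> a f g /asboolP hf /asboolP hg; apply/asboolP.
  near=> z; rewrite /= [LHS](_ : _ = a z * f z + g z)//.
  have -> : f z = 0 by near: z.
  have -> : g z = 0 by near: z.
  by rewrite mulr0 addr0.
Unshelve. all: by end_near. Qed.

HB.instance Definition _ := isIdealr.Build _ zero_at0 zero_at0_idealr.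

(* The ring $\mathbb{C}\{x_1,\dots,x_n\}$: functions that are complex
   differentiable (in the Fréchet sense) near the origin, modulo equality near
   the origin. *)
Definition germ := {ideal_quot zero_at0}.
HB.instance Definition _ := GRing.ComNzRing.on germ.

Let cst_holo_subproof (c : C) : cst c \in holomorphic_at0.
Proof.
by apply/asboolP; near=> z; exact: differentiable_cst.
Unshelve. all: by end_near. Qed.

Definition germ_cst (c : C) : germ := (\pi_germ (Holo (cst_holo_subproof c)))%qT.

(* [f / g] is a constant [c], i.e. [f = c * g]. *)
Definition constant_quotient (f g : germ) : Prop :=
  exists c : C, f = germ_cst c * g.

Definition coprime_germ (f g : germ) : Prop :=
  forall d a b : germ, f = d * a -> g = d * b -> exists e : germ, d * e = 1.

Definition principal_ideal (f : germ) : set germ :=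
  [set h | exists k : germ, h = f * k].

(* [((a / b) J) `&` germ], for [b != 0]: since germs form an integral domain,
   the equality [h / 1 = (a / b) * k] of fractions is [h * b = a * k]. *)
Definition quotient_mul_cap (a b : germ) (J : set germ) : set germ :=
  [set h | exists2 k : germ, J k & h * b = a * k].

Definition germ_norm (f : germ) (z : 'rV[C]_n) : R := Normc.normc (repr f z).

Definition complex_coord (x : (n + n).-tuple (measurableTypeR R)) : 'rV[C]_n :=
  \row_j Complex (tnth x (lshift n j)) (tnth x (rshift n j)).

Definition closed_ball0 (r : R) : set ((n + n).-tuple (measurableTypeR R)) :=
  [set x | \sum_(i < n + n) (tnth x i : R) ^+ 2 <= r ^+ 2].

(* The ideal $\mathcal{J}((f/g)^\lambda)$; $\mathcal{J}(f^\lambda)$ is the case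
   [g = 1]. The integral is over $\mathbb{C}^n$ seen as $\mathbb{R}^{2n}$ with
   its Lebesgue measure. It is evaluated on representatives, which are
   holomorphic only near the origin, but the integrand is nonnegative and the
   condition for some [r] amounts to the condition for all small [r]. The value
   given to the integrand on the null set [f = 0] is irrelevant. *)
Definition multiplier_ideal (f g : germ) (lambda : R) : set germ :=
  [set h | exists2 r : R, 0 < r &
    (\int[tuple_measure (@lebesgue_measure R) (n + n)]_(x in closed_ball0 r)
       (let z := complex_coord x in
        germ_norm h z ^+ 2 * germ_norm g z `^ (2 * lambda)
        / germ_norm f z `^ (2 * lambda))%:E < +oo)%E].

(* Exponents of multiplier ideals are nonnegative, so the increments [eps] are
   those for which [lambda - eps] still is one; in particular 0 is a jumping
   number, as is customary. If the multiplier ideals of negative exponent were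
   allowed in this condition, then 1 but not 0 would be a jumping number of
   the quotient [x / 1]. *)
Definition jumping_number (f g : germ) (lambda : R) : Prop :=
  0 <= lambda /\
  forall eps : R, 0 < eps -> eps <= lambda ->
    multiplier_ideal f g lambda <> multiplier_ideal f g (lambda - eps) \/
    multiplier_ideal f g lambda <> multiplier_ideal f g (lambda + eps).

End germ.

(* Main.v *)
(** Idea. For nonzero [f], multiplication by [f^l / g^l] carries the integrand of [k] to that of
    [h = (f^l / g^l) k], so (1) reduces to showing that [h g^l] is divisible by [f^l] as soon as
    [h] is in the ideal of exponent [lambda + l]. Since
    [|h g^l / f^l|^2 <= |h|^2 + |h|^2 |g / f|^(2 (lambda + l))], this follows from an L2 division
    theorem: if [|p / q|^2] is integrable near 0, then [q] divides [p]. For the latter, restrict to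
    complex lines in a direction in which [q] does not vanish identically. On each slice either [q]
    divides [p], or [p / q] has a pole and its squared modulus, being at least [c / |t - a|^2], is
    not integrable. If the Cauchy integral of [p / q] over the slices were not a quotient, the
    second case would occur on an open set of slices, contradicting Fubini's theorem.

    For the equality of (2) one needs that [f] divides [h] whenever [f] is coprime to [g] and
    divides [g h], that is, a common factor [c] of [f] and [g] with [f] dividing [c h]. The
    denominators of [h / f] on a slice are the multiples of a monic polynomial, which is determined
    by the Hankel matrix of the moments of [h / f]. On the dense set where the rank of this matrix
    is maximal, Cramer's rule gives the coefficients as quotients of holomorphic functions; being
    bounded, they extend holomorphically. The constant coefficient is [c]. *)
Require Import Defs.
From HB Require Import structures.
From mathcomp Require Import all_boot all_order all_algebra generic_quotient ring_quotient complex.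
From mathcomp Require Import ring lra.
From mathcomp Require Import all_classical all_reals all_analysis.
From mathcomp Require Import measurable_realfun.
Set Implicit Arguments.
Unset Strict Implicit.
Unset Printing Implicit Defensive.
Import Order.TTheory GRing.Theory Num.Theory.
Import numFieldNormedType.Exports.
Local Open Scope classical_set_scope.
Local Open Scope complex_scope.
Local Open Scope ring_scope.

Local Notation Re := (@complex.Re _).
Local Notation Im := (@complex.Im _).

(** * Real-valued norms and one complex variable *)

(** Coprimality is stated through common divisors only, so it can be used only by exhibiting one:
    this is why the factor [c] is built by analysis instead of being read off a factorization of
    germs. The construction never follows individual roots from slice to slice, since these are not
    holomorphic in the slice. It uses contour integrals, which are, and the symmetric functions of
    the roots obtained from them. A Cauchy integral of [p / q] over contours on which [q] is bounded
    below is holomorphic in the slice whether or not [q] divides [p]. Divisibility thus becomes an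
    equality to be checked slice by slice, and a bound on the quotient is enough to exclude poles.
    The constants in the estimates are lossy; what matters is that they do not depend on the
    slice. *)

Section real_norm.
Context (R : realType).
Local Notation C := (R[i]^o).

(** The norm of a normed module over [R[i]] is valued in [R[i]]; this is the same number in [R],
    where the order is total and [lra] applies. *)
Definition rnorm (V : normedModType R[i]) (x : V) : R := Re `|x|.

Section rnorm_theory.
Context (V : normedModType R[i]).
Implicit Types x y : V.

Lemma rnormE x : `|x| = (rnorm x)%:C.
Proof. by rewrite /rnorm RRe_real// ger0_real. Qed.

Lemma rnorm_ge0 x : 0 <= rnorm x.
Proof. by rewrite -ler0c -rnormE. Qed.

Lemma rnorm0 : rnorm (0 : V) = 0.
Proof. by rewrite /rnorm normr0. Qed.

Lemma rnorm_eq0 x : (rnorm x == 0) = (x == 0).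
Proof. by rewrite -(inj_eq (@complexI R)) -rnormE normr_eq0. Qed.

Lemma rnorm_gt0 x : (0 < rnorm x) = (x != 0).
Proof. by rewrite lt_def rnorm_eq0 rnorm_ge0 andbT. Qed.

Lemma ler_rnormD x y : rnorm (x + y) <= rnorm x + rnorm y.
Proof. by rewrite -lecR rmorphD /= -!rnormE ler_normD. Qed.

Lemma rnormN x : rnorm (- x) = rnorm x.
Proof. by rewrite /rnorm normrN. Qed.

Lemma rdistC x y : rnorm (x - y) = rnorm (y - x).
Proof. by rewrite -rnormN opprB. Qed.

Lemma ler_rnormB x y : rnorm (x - y) <= rnorm x + rnorm y.
Proof. by rewrite -(rnormN y) ler_rnormD. Qed.

Lemma rnormZ (a : C) x : rnorm (a *: x) = rnorm a * rnorm x.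
Proof.
by apply: (@complexI R); rewrite rmorphM /= -!rnormE normrZ.
Qed.

Lemma nbhs_rnormP x (A : set V) :
  nbhs x A <-> exists2 e : R, 0 < e & forall y, rnorm (y - x) < e -> A y.
Proof.
split.
  move=> /nbhs_normP[e /= e0 H]; exists (Re e); first by move: e0; rewrite ltcE => /andP[].
  move=> y yx; apply: H => /=; rewrite distrC rnormE.
  by rewrite -(RRe_real (gtr0_real e0)) ltcR.
move=> [e e0 H]; apply/nbhs_normP; exists e%:C => /=; first by rewrite ltcR.
by move=> y /=; rewrite distrC rnormE ltcR; exact: H.
Qed.

End rnorm_theory.

Lemma rnormc (z : C) : rnorm z = Normc.normc z.
Proof. by []. Qed.

Lemma rnormM (x y : C) : rnorm (x * y : C) = rnorm x * rnorm y.
Proof. exact: (rnormZ x y). Qed.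

Lemma rnormV (x : C) : rnorm (x^-1 : C) = (rnorm x)^-1.
Proof. exact: Normc.normcV. Qed.

Lemma rnorm1 : rnorm (1 : C) = 1.
Proof. exact: Normc.normc1. Qed.

Lemma rnormX (x : C) k : rnorm (x ^+ k : C) = rnorm x ^+ k.
Proof. by elim: k => [|k ih]; rewrite ?expr0 ?rnorm1// !exprS rnormM ih. Qed.

Lemma rnorm_real (x : R) : rnorm (x%:C : C) = `|x|.
Proof. by rewrite rnormc /Normc.normc /= expr0n addr0 sqrtr_sqr. Qed.

Lemma ler_rnorm_ReIm (z : C) : rnorm z <= `|Re z| + `|Im z|.
Proof.
rewrite rnormc /Normc.normc; case: z => a b /=.
rewrite -[leRHS]ger0_norm ?addr_ge0// -sqrtr_sqr ler_sqrt ?sqr_ge0//.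
rewrite -(real_normK (num_real a)) -(real_normK (num_real b)).
have := normr_ge0 a; have := normr_ge0 b; nra.
Qed.

Lemma ler_Re_rnorm (z : C) : `|Re z| <= rnorm z.
Proof.
rewrite rnormc /Normc.normc; case: z => a b /=.
by rewrite -sqrtr_sqr ler_sqrt ?addr_ge0 ?sqr_ge0// lerDl sqr_ge0.
Qed.

Lemma ler_Im_rnorm (z : C) : `|Im z| <= rnorm z.
Proof.
rewrite rnormc /Normc.normc; case: z => a b /=.
by rewrite -sqrtr_sqr ler_sqrt ?addr_ge0 ?sqr_ge0// lerDr sqr_ge0.
Qed.

Lemma continuous_rnormP (V W : normedModType R[i]) (f : V -> W) x :
  {for x, continuous f} <->
  forall e : R, 0 < e -> exists2 d, 0 < d &
    forall y, rnorm (y - x) < d -> rnorm (f y - f x) < e.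
Proof.
split.
  move=> fx e e0; have : nbhs (f x) [set u | rnorm (u - f x) < e].
    by apply/nbhs_rnormP; exists e.
  by move=> /fx /nbhs_rnormP.
move=> H A /nbhs_rnormP[e e0 eA]; apply/nbhs_rnormP.
have [d d0 dH] := H e e0; exists d => // y /dH; exact: eA.
Qed.

Section differentiable.
Context (V W : normedModType R[i]).

Lemma differentiable_rnormE (f : V -> W) x : differentiable f x ->
  forall e : R, 0 < e -> exists2 d, 0 < d &
    forall h, rnorm h < d -> rnorm (f (x + h) - f x - 'd f x h) <= e * rnorm h.
Proof.
move=> /diff_locallyP[_ fo] e e0.
have /eqaddoP/(_ e%:C) := fo; rewrite ltcR => /(_ e0) /nbhs_rnormP[d d0 H].
exists d => // h hd; have := H h; rewrite subr0 => /(_ hd) /=.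
rewrite !rnormE -rmorphM lecR; apply: le_trans; rewrite -addrA -opprD.
by rewrite !fctE /= (addrC h x).
Qed.

(** A continuous linear candidate suffices: [diff_unique] identifies it with ['d f x], and the
    estimate is then the expansion that characterizes differentiability. *)
Lemma rnorm_differentiable (f : V -> W) x (D : {linear V -> W}) :
  continuous D ->
  (forall e : R, 0 < e -> exists2 d, 0 < d &
    forall h, rnorm h < d -> rnorm (f (x + h) - f x - D h) <= e * rnorm h) ->
  differentiable f x.
Proof.
move=> Dc H.
have fo : f \o shift x = cst (f x) + D +o_ (0 : V) id.
  apply/eqaddoP => e e0; have [d d0 dH] := H (Re e) ltac:(by move: e0; rewrite ltcE => /andP[]).
  apply/nbhs_rnormP; exists d => // h; rewrite subr0 => /dH.
  rewrite -lecR rmorphM /= -!rnormE (RRe_real (gtr0_real e0)).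
  by rewrite !fctE /= (addrC h x) -addrA -opprD.
have dE := diff_unique Dc fo.
by apply/diff_locallyP; rewrite dE.
Qed.

End differentiable.

Section pointwise_closure.
Context (V : normedModType R[i]).
Implicit Types (F G : V -> C) (z : V).

(** This lemma and the next ones are closure properties in pointwise form, so that [apply:] matches
    the explicit functions that occur under integrals. *)
Lemma ccont_cst (u : C) z : {for z, continuous (fun=> u)}.
Proof. by move=> A; exact: (@cst_continuous V C u z A). Qed.

Lemma ccontD F G z : {for z, continuous F} -> {for z, continuous G} ->
  {for z, continuous (fun z => F z + G z)}.
Proof. by move=> Fc Gc; exact: (@cvgD _ C V (nbhs z) _ F G _ _ Fc Gc). Qed.

Lemma ccontB F G z : {for z, continuous F} -> {for z, continuous G} ->
  {for z, continuous (fun z => F z - G z)}.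
Proof. by move=> Fc Gc; exact: (@cvgB _ C V (nbhs z) _ F G _ _ Fc Gc). Qed.

Lemma ccontM F G z : {for z, continuous F} -> {for z, continuous G} ->
  {for z, continuous (fun z => F z * G z)}.
Proof. by move=> Fc Gc; exact: (@cvgM _ V (nbhs z) _ F G _ _ Fc Gc). Qed.

Lemma ccontV F z : F z != 0 -> {for z, continuous F} ->
  {for z, continuous (fun z => (F z)^-1)}.
Proof. by move=> Fz Fc; exact: (@cvgV _ V (nbhs z) _ F _ Fz Fc). Qed.

Lemma cdiff_cst (u : C) z : differentiable (fun=> u : C) z.
Proof. exact: differentiable_cst. Qed.

Lemma cdiffD F G z : differentiable F z -> differentiable G z ->
  differentiable (fun z => F z + G z) z.
Proof. exact: differentiableD. Qed.

Lemma cdiffN F z : differentiable F z -> differentiable (fun z => - F z) z.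
Proof. exact: differentiableN. Qed.

Lemma cdiffB F G z : differentiable F z -> differentiable G z ->
  differentiable (fun z => F z - G z) z.
Proof. exact: differentiableB. Qed.

Lemma cdiffM F G z : differentiable F z -> differentiable G z ->
  differentiable (fun z => F z * G z) z.
Proof. exact: differentiableM. Qed.

Lemma cdiffV F z : F z != 0 -> differentiable F z ->
  differentiable (fun z => (F z)^-1) z.
Proof. by move=> Fz Fd; exact: differentiableV. Qed.

Lemma cdiff_cont F z : differentiable F z -> {for z, continuous F}.
Proof. exact: differentiable_continuous. Qed.

End pointwise_closure.

Lemma ccont_id (z : C) : {for z, continuous (fun z : C => z)}.
Proof. by move=> A. Qed.

Lemma cdiff_id (z : C) : differentiable (fun z : C => z) z.
Proof.
apply: (@rnorm_differentiable C C _ z (idfun : {linear C -> C})).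
  by move=> w A.
move=> e e0; exists 1 => // h _; rewrite [z + h]addrC addrK subrr rnorm0.
by rewrite mulr_ge0 ?rnorm_ge0// ltW.
Qed.

Lemma near_differentiable (V : normedModType R[i]) (F G : V -> C) (z : V) :
  (\forall w \near z, F w = G w) -> differentiable F z -> differentiable G z.
Proof.
move=> FG Fd; apply: (@rnorm_differentiable _ _ _ _ ('d F z)).
  exact: diff_continuous.
move=> e e0; have [d d0 H] := differentiable_rnormE Fd e0.
have [d' d'0 H'] := (nbhs_rnormP _ _).1 FG.
exists (Num.min d d'); first by rewrite lt_min d0.
move=> h; rewrite lt_min => /andP[hd hd'].
by rewrite -!H' ?subrr ?rnorm0// ?(addrC z) ?addrK// (addrC h) H.
Qed.

End real_norm.

(** * Integrals of complex-valued functions on a segment *)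

Section complex_integral.
Context (R : realType).
Local Notation C := (R[i]^o).
Local Notation mu := (@lebesgue_measure R).
Implicit Types (a b x : R) (g : R -> C).

Definition cint a b g : C :=
  Complex (\int[mu]_(x in `[a, b]) Re (g x)) (\int[mu]_(x in `[a, b]) Im (g x)).

Definition cintegrable a b g : Prop :=
  mu.-integrable `[a, b] (EFin \o (fun x => Re (g x))) /\
  mu.-integrable `[a, b] (EFin \o (fun x => Im (g x))).

(** The source is normed over [R] and the target over [R[i]], so continuity is spelled out with real
    epsilon and delta. *)
Definition rcontinuous_at g x : Prop :=
  forall e : R, 0 < e -> exists2 d : R, 0 < d &
    forall y, `|y - x| < d -> rnorm (g y - g x) < e.

Lemma rcontinuous_cintegrable a b g :
  (forall x, a <= x <= b -> rcontinuous_at g x) -> cintegrable a b g.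
Proof.
have main (p : C -> R) : (forall z w, `|p z - p w| <= rnorm (z - w)) ->
    (forall x, a <= x <= b -> rcontinuous_at g x) ->
    mu.-integrable `[a, b] (EFin \o (fun x => p (g x))).
  move=> pl gc; apply: continuous_compact_integrable; first exact: segment_compact.
  apply: continuous_in_subspaceT => x; rewrite inE/= in_itv/= => /gc gx.
  apply/cvgrPdist_lt => e e0; have [d d0 H] := gx e e0.
  apply/nbhs_normP; exists d => //= y; rewrite /ball_/= => xy.
  by rewrite (le_lt_trans (pl _ _))// rdistC H// distrC.
move=> gc; split.
  apply: (main Re) => // z w.
  by rewrite -[_ - _](_ : Re (z - w) = _) ?ler_Re_rnorm//; case: z w => ? ? [? ?].
apply: (main Im) => // z w.
by rewrite -[_ - _](_ : Im (z - w) = _) ?ler_Im_rnorm//; case: z w => ? ? [? ?].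
Qed.

Lemma eq_cint a b g h : (forall x, a <= x <= b -> g x = h x) ->
  cint a b g = cint a b h.
Proof.
move=> gh; rewrite /cint; congr Complex; apply: eq_Rintegral => x.
  by rewrite inE/= in_itv/= => /gh->.
by rewrite inE/= in_itv/= => /gh->.
Qed.

Lemma cintegrableD a b g h : cintegrable a b g -> cintegrable a b h ->
  cintegrable a b (fun x => g x + h x).
Proof.
move=> [g1 g2] [h1 h2]; split.
  rewrite [_ \o _](_ : _ = (EFin \o (fun x => Re (g x))) \+ (EFin \o (fun x => Re (h x))))%E.
    exact: integrableD.
  by apply/funext => x /=; case: (g x) (h x) => ? ? [? ?].
rewrite [_ \o _](_ : _ = (EFin \o (fun x => Im (g x))) \+ (EFin \o (fun x => Im (h x))))%E.
  exact: integrableD.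
by apply/funext => x /=; case: (g x) (h x) => ? ? [? ?].
Qed.

Lemma cintD a b g h : cintegrable a b g -> cintegrable a b h ->
  cint a b (fun x => g x + h x) = cint a b g + cint a b h.
Proof.
move=> [g1 g2] [h1 h2]; rewrite /cint.
rewrite [RHS]/(@GRing.add _ _ _)/=; congr Complex.
  rewrite -RintegralD//; apply: eq_Rintegral => x _.
  by case: (g x) (h x) => ? ? [? ?].
rewrite -RintegralD//; apply: eq_Rintegral => x _.
by case: (g x) (h x) => ? ? [? ?].
Qed.

Lemma cintegrableZ a b (z : C) g : cintegrable a b g ->
  cintegrable a b (fun x => z * g x).
Proof.
move=> [g1 g2]; case: z => u v; split.
  rewrite [_ \o _](_ : _ = (fun x => u%:E * (Re (g x))%:E)
     \+ (fun x => (- v)%:E * (Im (g x))%:E))%E.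
    by apply: integrableD => //; exact: integrableZl.
  by apply/funext => x /=; rewrite -!EFinM -EFinD; case: (g x) => ? ? /=; rewrite mulNr.
rewrite [_ \o _](_ : _ = (fun x => u%:E * (Im (g x))%:E)
   \+ (fun x => v%:E * (Re (g x))%:E))%E.
  by apply: integrableD => //; exact: integrableZl.
by apply/funext => x /=; rewrite -!EFinM -EFinD; case: (g x) => ? ? /=.
Qed.

Lemma cintZ a b (z : C) g : cintegrable a b g ->
  cint a b (fun x => z * g x) = z * cint a b g.
Proof.
move=> [g1 g2]; case: z => u v; rewrite /cint.
rewrite [RHS]/(@GRing.mul _ _ _)/=.
have H r (p : R -> R) : mu.-integrable `[a, b] (EFin \o p) ->
    mu.-integrable `[a, b] (EFin \o (fun x => r * p x)).
  move=> ip; rewrite [_ \o _](_ : _ = (fun x => r%:E * (p x)%:E)%E)//.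
  exact: integrableZl.
congr Complex.
  rewrite -!RintegralZl// -RintegralB; [|by []|exact: H|exact: H].
  by apply: eq_Rintegral => x _; case: (g x).
rewrite -!RintegralZl// -RintegralD; [|by []|exact: H|exact: H].
by apply: eq_Rintegral => x _; case: (g x).
Qed.

Lemma cintegrableN a b g : cintegrable a b g -> cintegrable a b (fun x => - g x).
Proof.
move=> /(cintegrableZ (-1)); congr cintegrable.
by apply/funext => x; rewrite mulN1r.
Qed.

Lemma fine_lebesgue_measure_itv a b : a <= b -> fine (mu `[a, b]) = b - a.
Proof.
move=> ab; rewrite lebesgue_measure_itv/= lte_fin; case: ltP => //= ba.
by apply/eqP; rewrite eq_sym subr_eq0 eq_le ab ba.
Qed.

Lemma cint_cst a b (z : C) : a <= b -> cint a b (fun=> z) = (b - a)%:C * z.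
Proof.
move=> ab; rewrite /cint !Rintegral_cst//= fine_lebesgue_measure_itv//.
case: z => u v /=.
by rewrite [RHS]/(@GRing.mul _ _ _)/= !mul0r subr0 addr0; congr Complex; rewrite mulrC.
Qed.

Lemma cintegrable_cst a b (z : C) : cintegrable a b (fun=> z).
Proof.
by apply: rcontinuous_cintegrable => x _ e e0; exists 1 => // y _; rewrite subrr rnorm0.
Qed.

Lemma cint_split a m b g : a <= m <= b -> cintegrable a b g ->
  cint a b g = cint a m g + cint m b g.
Proof.
move=> /andP[am mb] [g1 g2]; rewrite /cint [RHS]/(@GRing.add _ _ _)/=.
have H (p : R -> R) : mu.-integrable `[a, b] (EFin \o p) ->
    \int[mu]_(x in `[a, b]) p x = \int[mu]_(x in `[a, m]) p x + \int[mu]_(x in `[m, b]) p x.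
  move=> ip; have /eqP := Rintegral_itvB ip (x := m) ltac:(by rewrite bnd_simp) ltac:(by rewrite bnd_simp).
  rewrite subr_eq => /eqP ->; rewrite addrC; congr +%R.
  rewrite Rintegral_itv_obnd_cbnd//.
  apply: integrableS ip => //; apply: subset_itv; by rewrite bnd_simp.
by congr Complex; apply: H.
Qed.

(** The factor 2 comes from bounding the real and imaginary parts separately. *)
Lemma ler_rnorm_cint a b g (M : R) : a <= b -> cintegrable a b g ->
  (forall x, a <= x <= b -> rnorm (g x) <= M) ->
  rnorm (cint a b g) <= 2 * M * (b - a).
Proof.
move=> ab [g1 g2] gM.
have H (p : R -> R) : mu.-integrable `[a, b] (EFin \o p) ->
    (forall x, a <= x <= b -> `|p x| <= M) ->
    `|\int[mu]_(x in `[a, b]) p x| <= M * (b - a).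
  move=> ip pM; apply: (le_trans (le_normr_Rintegral _ ip)) => //.
  have -> : M * (b - a) = \int[mu]_(x in `[a, b]) M.
    by rewrite Rintegral_cst//= fine_lebesgue_measure_itv.
  apply: le_Rintegral => //.
  - exact: (integrable_norm ip).
  - by have [+ _] := cintegrable_cst a b M%:C.
apply: (le_trans (ler_rnorm_ReIm _)).
rewrite [leRHS](_ : _ = M * (b - a) + M * (b - a)); last by ring.
by apply: lerD; apply: H => // x /gM; apply: le_trans;
  [exact: ler_Re_rnorm|exact: ler_Im_rnorm].
Qed.

End complex_integral.

(** * Contour integrals over rectangles *)

Section rectangle.
Context (R : realType).
Local Notation C := (R[i]^o).
Implicit Types (x y : R) (F G : C -> C).

(** The integral of [F] along the border, counterclockwise: bottom minus top, plus [i] times right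
    minus left. Grouping opposite sides leaves two real integrals. *)
Definition rint x0 x1 y0 y1 F : C :=
  cint x0 x1 (fun x => F (Complex x y0) - F (Complex x y1)) +
  Complex 0 1 * cint y0 y1 (fun y => F (Complex x1 y) - F (Complex x0 y)).

Definition in_rect x0 x1 y0 y1 (z : C) : Prop :=
  x0 <= Re z <= x1 /\ y0 <= Im z <= y1.

Definition on_border x0 x1 y0 y1 (z : C) : Prop :=
  in_rect x0 x1 y0 y1 z /\
  [\/ Re z = x0, Re z = x1, Im z = y0 | Im z = y1].

Lemma continuous_horizontal F x y : {for (Complex x y : C), continuous F} ->
  rcontinuous_at (fun t => F (Complex t y)) x.
Proof.
move=> /continuous_rnormP Fc e e0; have [d d0 dF] := Fc e e0.
exists d => // t tx; apply: dF.
rewrite [_ - _](_ : _ = (t - x)%:C) ?rnorm_real//.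
by apply/eqP; rewrite eq_complex /= subrr !eqxx.
Qed.

Lemma continuous_vertical F x y : {for (Complex x y : C), continuous F} ->
  rcontinuous_at (fun t => F (Complex x t)) y.
Proof.
move=> /continuous_rnormP Fc e e0; have [d d0 dF] := Fc e e0.
exists d => // t tx; apply: dF.
rewrite [_ - _](_ : _ = Complex 0 1 * (t - y)%:C); last first.
  by apply/eqP; rewrite eq_complex /=; apply/andP; split; apply/eqP; ring.
by rewrite rnormM rnorm_real rnormc /Normc.normc/= expr0n expr1n add0r sqrtr1 mul1r.
Qed.

Let eq_addMi (a b c d : C) : a = c -> b = d ->
  a + Complex 0 1 * b = c + Complex 0 1 * d.
Proof. by move=> -> ->. Qed.

Section fixed_rectangle.
Variables (x0 x1 y0 y1 : R).
Hypotheses (x01 : x0 <= x1) (y01 : y0 <= y1).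
Let bd := on_border x0 x1 y0 y1.

Let bd1 x : x0 <= x <= x1 -> bd (Complex x y0).
Proof. by move=> xx; split; [split; rewrite //= lexx|apply: Or43]. Qed.
Let bd2 x : x0 <= x <= x1 -> bd (Complex x y1).
Proof. by move=> xx; split; [split; rewrite //= lexx andbT|apply: Or44]. Qed.
Let bd3 y : y0 <= y <= y1 -> bd (Complex x0 y).
Proof. by move=> xx; split; [split; rewrite //= lexx|apply: Or41]. Qed.
Let bd4 y : y0 <= y <= y1 -> bd (Complex x1 y).
Proof. by move=> xx; split; [split; rewrite //= lexx andbT|apply: Or42]. Qed.

Lemma rint_cintegrable F : (forall z, bd z -> {for z, continuous F}) ->
  [/\ cintegrable x0 x1 (fun x => F (Complex x y0)),
      cintegrable x0 x1 (fun x => F (Complex x y1)),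
      cintegrable y0 y1 (fun y => F (Complex x0 y)) &
      cintegrable y0 y1 (fun y => F (Complex x1 y))].
Proof.
move=> Fc; split; apply: rcontinuous_cintegrable => t tt.
- exact/continuous_horizontal/Fc/bd1.
- exact/continuous_horizontal/Fc/bd2.
- exact/continuous_vertical/Fc/bd3.
- exact/continuous_vertical/Fc/bd4.
Qed.

Lemma rint_cintegrableB F : (forall z, bd z -> {for z, continuous F}) ->
  cintegrable x0 x1 (fun x => F (Complex x y0) - F (Complex x y1)) /\
  cintegrable y0 y1 (fun y => F (Complex x1 y) - F (Complex x0 y)).
Proof.
move=> /rint_cintegrable[? ? ? ?].
by split; apply: cintegrableD => //; exact: cintegrableN.
Qed.

Lemma eq_rint F G : (forall z, bd z -> F z = G z) ->
  rint x0 x1 y0 y1 F = rint x0 x1 y0 y1 G.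
Proof.
move=> FG; rewrite /rint; apply: eq_addMi; apply: eq_cint => t tt.
  by rewrite !FG//; [exact: bd2|exact: bd1].
by rewrite !FG//; [exact: bd3|exact: bd4].
Qed.

Lemma rintD F G : (forall z, bd z -> {for z, continuous F}) ->
  (forall z, bd z -> {for z, continuous G}) ->
  rint x0 x1 y0 y1 (fun z => F z + G z) = rint x0 x1 y0 y1 F + rint x0 x1 y0 y1 G.
Proof.
move=> /rint_cintegrableB[F1 F2] /rint_cintegrableB[G1 G2]; rewrite /rint addrACA -mulrDr.
rewrite -!cintD//. apply: eq_addMi; apply: eq_cint => t _; ring.
Qed.

Lemma rintZ (c : C) F : (forall z, bd z -> {for z, continuous F}) ->
  rint x0 x1 y0 y1 (fun z => c * F z) = c * rint x0 x1 y0 y1 F.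
Proof.
move=> /rint_cintegrableB[F1 F2]; rewrite /rint mulrDr mulrCA -(cintZ c F1) -(cintZ c F2).
by apply: eq_addMi; apply: eq_cint => t _; rewrite mulrBr.
Qed.

(** The 4 is the 2 of [ler_rnorm_cint] times the two opposite sides grouped in each integrand. *)
Lemma ler_rnorm_rint F (M : R) : (forall z, bd z -> {for z, continuous F}) ->
  (forall z, bd z -> rnorm (F z) <= M) ->
  rnorm (rint x0 x1 y0 y1 F) <= 4 * M * ((x1 - x0) + (y1 - y0)).
Proof.
move=> /rint_cintegrableB[F1 F2] FM.
apply: (le_trans (ler_rnormD _ _)); rewrite rnormM.
have -> : rnorm (Complex 0 1 : C) = 1.
  by rewrite rnormc /Normc.normc/= expr0n expr1n add0r sqrtr1.
rewrite mul1r [leRHS](_ : _ = 2 * (M + M) * (x1 - x0) + 2 * (M + M) * (y1 - y0)); last by ring.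
apply: lerD; apply: ler_rnorm_cint => // t tt; apply: (le_trans (ler_rnormB _ _));
  apply: lerD; apply: FM; by [exact: bd1|exact: bd2|exact: bd3|exact: bd4].
Qed.

Lemma rint_cst (c : C) : rint x0 x1 y0 y1 (fun=> c) = 0.
Proof. by rewrite /rint !subrr !cint_cst// !mulr0 addr0. Qed.

Lemma rint_id : rint x0 x1 y0 y1 id = 0.
Proof.
rewrite /rint.
rewrite (@eq_cint _ x0 x1 _ (fun=> Complex 0 (y0 - y1))); last first.
  by move=> t _; rewrite {1}/GRing.add/= subrr.
rewrite (@eq_cint _ y0 y1 _ (fun=> (x1 - x0)%:C)); last first.
  by move=> t _; rewrite {1}/GRing.add/= subrr.
rewrite !cint_cst//.
apply/eqP; rewrite eq_complex /=; apply/andP; split; apply/eqP; ring.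
Qed.

End fixed_rectangle.

(** The contributions of the common side cancel. Continuity on the borders of the whole and of the
    left rectangle already covers the border of the right one. *)
Lemma rint_splitx x0 xm x1 y0 y1 F : x0 <= xm <= x1 -> y0 <= y1 ->
  (forall z, on_border x0 x1 y0 y1 z -> {for z, continuous F}) ->
  (forall z, on_border x0 xm y0 y1 z -> {for z, continuous F}) ->
  rint x0 x1 y0 y1 F = rint x0 xm y0 y1 F + rint xm x1 y0 y1 F.
Proof.
move=> xx yy Fc Fc1; have /andP[x0m xm1] := xx.
have x01 := le_trans x0m xm1.
have [F1 F2] := rint_cintegrableB x01 yy Fc.
have [_ _ F3 F4] := rint_cintegrable x0m yy Fc1.
have [_ _ _ F5] := rint_cintegrable x01 yy Fc.
rewrite /rint (cint_split xx)// addrACA -mulrDr -cintD.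
- apply: eq_addMi => //; apply: eq_cint => t _; ring.
- by apply: cintegrableD => //; exact: cintegrableN.
- by apply: cintegrableD => //; exact: cintegrableN.
Qed.

Lemma rint_splity x0 x1 y0 ym y1 F : x0 <= x1 -> y0 <= ym <= y1 ->
  (forall z, on_border x0 x1 y0 y1 z -> {for z, continuous F}) ->
  (forall z, on_border x0 x1 y0 ym z -> {for z, continuous F}) ->
  rint x0 x1 y0 y1 F = rint x0 x1 y0 ym F + rint x0 x1 ym y1 F.
Proof.
move=> xx yy Fc Fc1; have /andP[y0m ym1] := yy.
have y01 := le_trans y0m ym1.
have [F1 F2] := rint_cintegrableB xx y01 Fc.
have [F3 F4 _ _] := rint_cintegrable xx y0m Fc1.
have [_ F5 _ _] := rint_cintegrable xx y01 Fc.
rewrite /rint (cint_split yy)// addrACA -mulrDr -cintD.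
- apply: eq_addMi => //; apply: eq_cint => t _; ring.
- by apply: cintegrableD => //; exact: cintegrableN.
- by apply: cintegrableD => //; exact: cintegrableN.
Qed.

End rectangle.

(** * Bisection of rectangles *)

Section bisection.
Context (R : realType).

(** If [P] fails on a rectangle, it fails on one of its quarters; the failing quarters are nested
    and have a common point. The index of [P] is the depth, so that [P] may carry a bound that
    shrinks with it. *)
Lemma rect_bisection (P : nat -> R -> R -> R -> R -> Prop) (x0 x1 y0 y1 : R) :
  x0 <= x1 -> y0 <= y1 -> ~ P 0%N x0 x1 y0 y1 ->
  (forall k a b c d, a <= b -> c <= d ->
    P k.+1 a ((a + b) / 2) c ((c + d) / 2) ->
    P k.+1 ((a + b) / 2) b c ((c + d) / 2) ->
    P k.+1 a ((a + b) / 2) ((c + d) / 2) d ->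
    P k.+1 ((a + b) / 2) b ((c + d) / 2) d -> P k a b c d) ->
  exists x y, forall k, exists a b c d,
    [/\ x0 <= a /\ b <= x1, y0 <= c /\ d <= y1, a <= x <= b /\ c <= y <= d,
     b - a = (x1 - x0) / 2 ^+ k /\ d - c = (y1 - y0) / 2 ^+ k & ~ P k a b c d].
Proof.
move=> x01 y01 P0 Pstep.
pose Q k (s : R * R * R * R) := P k s.1.1.1 s.1.1.2 s.1.2 s.2.
pose quarter (i j : bool) (s : R * R * R * R) : R * R * R * R :=
  let: (a, b, c, d) := s in
  ((if i then (a + b) / 2 else a), (if i then b else (a + b) / 2),
   (if j then (c + d) / 2 else c), (if j then d else (c + d) / 2)).
(* The first failing quarter. The last one is the default: if the three others satisfy [Q], it must
   be the one that fails. *)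
pose next k s := if pselect (Q k.+1 (quarter false false s)) then
    if pselect (Q k.+1 (quarter true false s)) then
      if pselect (Q k.+1 (quarter false true s)) then quarter true true s
      else quarter false true s
    else quarter true false s
  else quarter false false s.
have next_quarter k s : exists i j, next k s = quarter i j s.
  rewrite /next; do 3 (case: pselect => ?; last by eexists; eexists; reflexivity).
  by eexists; eexists; reflexivity.
have nextP k s : s.1.1.1 <= s.1.1.2 -> s.1.2 <= s.2 -> ~ Q k s -> ~ Q k.+1 (next k s).
  case: s => [[[a b] c] d] ab cd nQ; rewrite /next.
  do 3 (case: pselect => // ?); move=> H; apply: nQ; exact: Pstep.
pose st := fix st k := match k with 0%N => (x0, x1, y0, y1) | j.+1 => next j (st j) end.
have inv k : [/\ (st k).1.1.1 <= (st k).1.1.2, (st k).1.2 <= (st k).2,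
    (st k).1.1.2 - (st k).1.1.1 = (x1 - x0) / 2 ^+ k,
    (st k).2 - (st k).1.2 = (y1 - y0) / 2 ^+ k & ~ Q k (st k)].
  elim: k => [|k [h1 h2 h3 h4 h5]]; first by rewrite /= expr0 !divr1.
  have h6 := nextP _ _ h1 h2 h5; rewrite /= -/st.
  have E r : r / 2 ^+ k.+1 = (r / 2 ^+ k) / 2 :> R by rewrite exprS; field; exact: expf_neq0.
  rewrite !E -h3 -h4; move: h1 h2 h6 {h3 h4 h5 E}.
  have [i [j ->]] := next_quarter k (st k); case: (st k) => [[[a b] c] d] /= ab cd nQ.
  by split => //; case: i nQ => nQ; case: j nQ => nQ; rewrite /=; lra.
have mono k j : [/\ (st k).1.1.1 <= (st (k + j)%N).1.1.1, (st (k + j)%N).1.1.2 <= (st k).1.1.2,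
    (st k).1.2 <= (st (k + j)%N).1.2 & (st (k + j)%N).2 <= (st k).2].
  elim: j => [|j [h1 h2 h3 h4]]; first by rewrite addn0.
  rewrite addnS /= -/st; have [g1 g2 _ _ _] := inv (k + j)%N.
  have [i' [j' ->]] := next_quarter (k + j)%N (st (k + j)%N).
  move: h1 h2 h3 h4 g1 g2; case: (st (k + j)%N) => [[[a b] c] d] /= *.
  by split => //; case: i'; case: j'; rewrite /=; lra.
have cross k j : (st k).1.1.1 <= (st j).1.1.2 /\ (st k).1.2 <= (st j).2.
  have [/subnKC E|/ltnW/subnKC E] := leqP k j.
    have [h1 _ h2 _] := mono k (j - k)%N; rewrite E in h1 h2; have [g1 g2 _ _ _] := inv j.
    by split; [exact: le_trans h1 g1|exact: le_trans h2 g2].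
  have [_ h1 _ h2] := mono j (k - j)%N; rewrite E in h1 h2; have [g1 g2 _ _ _] := inv k.
  by split; [exact: le_trans g1 h1|exact: le_trans g2 h2].
(* By [cross] every lower end is below every upper end, so the suprema of the lower ends lie in all
   the intervals. *)
pose X := [set (st k).1.1.1 | k in setT]; pose Y := [set (st k).1.2 | k in setT].
have supX : has_sup X by split; [exists x0; exists 0%N|exists x1 => _ [k _ <-]; exact: (cross k 0%N).1].
have supY : has_sup Y by split; [exists y0; exists 0%N|exists y1 => _ [k _ <-]; exact: (cross k 0%N).2].
exists (sup X), (sup Y) => k; exists (st k).1.1.1, (st k).1.1.2, (st k).1.2, (st k).2.
have [h1 h2 h3 h4 h5] := inv k; have [g1 g2 g3 g4] := mono 0%N k; rewrite add0n in g1 g2 g3 g4.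
split => //; split; apply/andP; split.
- by apply: sup_upper_bound => //; exists k.
- by apply: ge_sup; [case: supX|move=> _ [j _ <-]; exact: (cross j k).1].
- by apply: sup_upper_bound => //; exists k.
- by apply: ge_sup; [case: supY|move=> _ [j _ <-]; exact: (cross j k).2].
Qed.

End bisection.

(** * Goursat's theorem *)

Section goursat.
Context (R : realType).
Local Notation C := (R[i]^o).

Lemma diff_mul (F : C -> C) (z h : C) : 'd F z h = h * 'd F z 1.
Proof.
by rewrite -[h in LHS]mulr1 -[h * 1]/(h *: (1 : C)) linearZ.
Qed.

Lemma in_rect_dist a b c d (z w : C) : in_rect a b c d z -> in_rect a b c d w ->
  rnorm (z - w) <= (b - a) + (d - c).
Proof.
move=> [/andP[? ?] /andP[? ?]] [/andP[? ?] /andP[? ?]].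
apply: (le_trans (ler_rnorm_ReIm _)).
have -> : Re (z - w) = Re z - Re w by case: (z) (w) => ? ? [].
have -> : Im (z - w) = Im z - Im w by case: (z) (w) => ? ? [].
by apply: lerD; rewrite ler_norml; lra.
Qed.

(** If the integral had norm [e > 0], bisection would give rectangles of depth [k] with an integral
    above [e / 2 / 4 ^+ k]. Near their common point, [F] differs from an affine function, whose
    integral vanishes, by at most [eta] times the size [L / 2 ^+ k]; the perimeter contributes a
    second factor [L / 2 ^+ k], so the integral is too small. *)
Theorem goursat (F : C -> C) (x0 x1 y0 y1 : R) : x0 <= x1 -> y0 <= y1 ->
  (forall z, in_rect x0 x1 y0 y1 z -> differentiable F z) ->
  rint x0 x1 y0 y1 F = 0.
Proof.
move=> x01 y01 Fd.
have Fc z : in_rect x0 x1 y0 y1 z -> {for z, continuous F}.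
  by move=> /Fd /differentiable_continuous.
apply/eqP; rewrite -rnorm_eq0; apply/eqP; set e := rnorm _.
apply/eqP/contraT => e_neq0; have e0 : 0 < e by rewrite lt_def e_neq0 rnorm_ge0.
(* Halving [e] makes [P] fail on the initial rectangle, where the norm is exactly [e]. *)
pose P k a b c d := x0 <= a -> b <= x1 -> y0 <= c -> d <= y1 ->
  rnorm (rint a b c d F) <= e / 2 / 4 ^+ k.
have [|k a b c d ab cd H1 H2 H3 H4 xa bx yc dy|x [y H]] :=
    @rect_bisection R P x0 x1 y0 y1 x01 y01.
- by move=> /(_ (lexx _) (lexx _) (lexx _) (lexx _)); rewrite -/e expr0 divr1; lra.
- have sub a' b' c' d' z : x0 <= a' -> b' <= x1 -> y0 <= c' -> d' <= y1 ->
      on_border a' b' c' d' z -> {for z, continuous F}.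
    move=> ? ? ? ? [[/andP[? ?] /andP[? ?]] _]; apply: Fc.
    by split; apply/andP; split; lra.
  have am : a <= (a + b) / 2 <= b by lra.
  have cm : c <= (c + d) / 2 <= d by lra.
  rewrite (rint_splitx am cd); try (move=> z; apply: sub; lra).
  rewrite [X in X + _](rint_splity _ cm); try (move=> z; apply: sub; lra); last by lra.
  rewrite [X in _ + X](rint_splity _ cm); try (move=> z; apply: sub; lra); last by lra.
  apply: (le_trans (ler_rnormD _ _)).
  rewrite [leRHS](_ : _ = (e / 2 / 4 ^+ k.+1 + e / 2 / 4 ^+ k.+1) +
    (e / 2 / 4 ^+ k.+1 + e / 2 / 4 ^+ k.+1)); last first.
    by rewrite exprS; field; exact: expf_neq0.
  apply: lerD; apply: (le_trans (ler_rnormD _ _)); apply: lerD.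
  + by apply: H1; lra.
  + by apply: H3; lra.
  + by apply: H2; lra.
  + by apply: H4; lra.
have zin : in_rect x0 x1 y0 y1 (Complex x y).
  have [a [b [c [d [[? ?] [? ?] [/andP[? ?] /andP[? ?]] _ _]]]]] := H 0%N.
  by split => /=; lra.
pose L := (x1 - x0) + (y1 - y0).
have L0 : 0 <= L by rewrite /L; lra.
(* Chosen so that [4 * eta * L ^+ 2 <= e / 4]; the [+ 1] covers a rectangle reduced to a point. *)
pose eta := e / (16 * (L ^+ 2 + 1)).
have eta0 : 0 < eta by rewrite divr_gt0// mulr_gt0// ltr_wpDl// sqr_ge0.
have [del del0 Hdel] := differentiable_rnormE (Fd _ zin) eta0.
have [k Hk] : exists k, L / 2 ^+ k < del.
  have [k _ Hk] : \forall k \near \oo, L / 2 ^+ k < del.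
    have : (L *: (2^-1 ^+ k : R^o)) @[k --> \oo] --> (L *: (0 : R^o)).
      by apply: cvgZr; apply: cvg_expr; rewrite gtr0_norm; lra.
    rewrite scaler0 => /cvgrPdist_lt/(_ _ del0).
    apply: filterS => k; rewrite sub0r normrN => /(le_lt_trans (ler_norm _)).
    by rewrite exprVn.
  by exists k; apply: Hk => /=.
have [a [b [c [d [[h1 h2] [h3 h4] [h5 h6] [h7 h8] nP]]]]] := H k.
exfalso; apply: nP => _ _ _ _.
have ab : a <= b by lra.
have cd : c <= d by lra.
have zin' : in_rect a b c d (Complex x y) by [].
set z := Complex x y : C; set D := 'd F z 1.
have sub w : on_border a b c d w -> in_rect x0 x1 y0 y1 w.
  by move=> [[/andP[? ?] /andP[? ?]] _]; split; apply/andP; split; lra.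
have cG (w : C) : {for w, continuous (fun w : C => (F z - D * z) + D * w)}.
  by apply: ccontD; [exact: ccont_cst|apply: ccontM; [exact: ccont_cst|exact: ccont_id]].
have cF1 w : on_border a b c d w ->
    {for w, continuous (fun w => F w + -1 * (F z - D * z + D * w))}.
  move=> bw; apply: ccontD; first exact/Fc/sub.
  by apply: ccontM; [exact: ccont_cst|exact: cG].
have -> : rint a b c d F =
    rint a b c d (fun w => F w + -1 * (F z - D * z + D * w)).
  rewrite (@rintD _ a b c d ab cd F (fun w => -1 * (F z - D * z + D * w))); last 2 first.
  - by move=> w /sub /Fc.
  - by move=> w _; apply: ccontM; [exact: ccont_cst|exact: cG].
  rewrite (@rintZ _ a b c d ab cd (-1) (fun w => F z - D * z + D * w) (fun w _ => cG w)).
  rewrite (@rintD _ a b c d ab cd (fun=> F z - D * z) (fun w => D * w)); last 2 first.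
  - by move=> w _; exact: ccont_cst.
  - by move=> w _; apply: ccontM; [exact: ccont_cst|exact: ccont_id].
  rewrite (@rintZ _ a b c d ab cd D (fun w => w) (fun w _ => @ccont_id R w)).
  by rewrite rint_cst// rint_id// mulr0 addr0 mulr0 addr0.
have := @ler_rnorm_rint _ a b c d ab cd _ (eta * (L / 2 ^+ k)) cF1.
have LE : (b - a) + (d - c) = L / 2 ^+ k by rewrite h7 h8 -mulrDl.
rewrite LE; move=> Hle; apply: le_trans (Hle _) _.
  move=> w bw; have wz : rnorm (w - z) <= L / 2 ^+ k.
    by rewrite -LE; apply: in_rect_dist => //; case: bw.
  have := Hdel (w - z) (le_lt_trans wz Hk).
  rewrite [z + _]addrC subrK diff_mul -/D => Hw.
  rewrite [F w + _](_ : _ = F w - F z - (w - z) * D); last by ring.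
  by apply: le_trans Hw _; rewrite ler_wpM2l// ltW.
rewrite [leLHS](_ : _ = (4 * eta * L ^+ 2) / 4 ^+ k); last first.
  have -> : (4 : R) ^+ k = 2 ^+ k * 2 ^+ k by rewrite -exprMn; congr (_ ^+ _); ring.
  by field; exact: expf_neq0.
rewrite ler_pM2r ?invr_gt0 ?exprn_gt0// /eta.
rewrite [leLHS](_ : _ = e / 4 * (L ^+ 2 / (L ^+ 2 + 1))); last first.
  by field; rewrite gt_eqF// ltr_wpDl// sqr_ge0.
have : L ^+ 2 / (L ^+ 2 + 1) <= 1.
  by rewrite ler_pdivrMr ?mul1r ?lerDl// ltr_wpDl// sqr_ge0.
nra.
Qed.

End goursat.

(** * Cauchy's integral formula *)

Section cauchy.
Context (R : realType).
Local Notation C := (R[i]^o).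
Local Notation mu := (@lebesgue_measure R).
Implicit Types (F phi : C -> C) (a z : C).

(** The antiderivative [atan ((x - x0) / e)] takes the values [pi / 4] and [- pi / 4] at the
    ends. *)
Lemma integral_atan (x0 e : R) : 0 < e ->
  \int[mu]_(x in `[x0 - e, x0 + e]) (e / ((x - x0) ^+ 2 + e ^+ 2)) = pi / 2.
Proof.
move=> e0.
have den x : (x - x0) ^+ 2 + e ^+ 2 != 0 by rewrite gt_eqF// ltr_wpDl ?sqr_ge0// exprn_gt0.
pose F x := atan ((x - x0) / e).
have Fd x : is_derive (x : R^o) 1 (F : R^o -> R^o) (e / ((x - x0) ^+ 2 + e ^+ 2)).
  have h : is_derive (x : R^o) 1 (fun x : R^o => (x - x0) / e : R^o) e^-1.
    have : is_derive (x : R^o) 1 ((fun x : R^o => (x - x0) : R^o) * (fun=> e^-1)) ((x - x0) *: 0 + e^-1 *: (1 - 0)).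
      exact: is_deriveM.
    by rewrite scaler0 add0r subr0 -[_ *: _]/(_ * _) mulr1.
  have := @is_derive1_comp R (@atan R) (fun x : R^o => (x - x0) / e : R^o) x _ _ (is_derive1_atan ((x - x0) / e)) h.
  rewrite [X in is_derive _ _ _ X -> _](_ : _ = e / ((x - x0) ^+ 2 + e ^+ 2)) //.
  field; rewrite den gt_eqF//=.
rewrite /Rintegral (@continuous_FTC2 _ _ F).
- rewrite /= /F addrAC subrr add0r divff ?gt_eqF// addrAC subrr add0r mulNr divff ?gt_eqF//.
  by rewrite atanN atan1; field.
- by lra.
- apply: continuous_subspaceT => x.
  apply: cvgM; first exact: cvg_cst.
  apply: cvgV => //; apply: cvgD; last exact: cvg_cst.
  by apply: cvgM; apply: cvgB => //; exact: cvg_cst.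
- have Fc x : {for x, continuous F}.
    by apply: differentiable_continuous; apply/derivable1_diffP; case: (Fd x).
  split.
  + by move=> x _; case: (Fd x).
  + exact/cvg_at_right_filter/Fc.
  + exact/cvg_at_left_filter/Fc.
- by move=> x _; rewrite derive1E; case: (Fd x).
Qed.

Lemma cint_real (a b : R) (g : R -> R) :
  cint a b (fun x => (g x)%:C) = (\int[mu]_(x in `[a, b]) g x)%:C.
Proof.
rewrite /cint /=; congr Complex.
by rewrite (@Rintegral_cst _ _ _ mu `[a, b]%classic)// mul0r.
Qed.

(** On a centred square, the values of [(z - a)^-1] at opposite points of two sides differ by a
    constant, [2 i] or [2], times the kernel of [integral_atan]. Each pair of sides thus contributes
    [i * pi]. *)
Lemma rint_winding (a : C) (e : R) : 0 < e ->
  rint (Re a - e) (Re a + e) (Im a - e) (Im a + e) (fun z => (z - a)^-1) =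
  Complex 0 (2 * pi).
Proof.
case: a => u v /= e0; rewrite /rint.
have den (x x0 : R) : (x - x0) ^+ 2 + e ^+ 2 != 0.
  by rewrite gt_eqF// ltr_wpDl ?sqr_ge0// exprn_gt0.
have den' (x x0 : R) : e ^+ 2 + (x - x0) ^+ 2 != 0 by rewrite addrC den.
have int_pi (x0 : R) (z : C) : cint (x0 - e) (x0 + e)
    (fun x => z * (e / ((x - x0) ^+ 2 + e ^+ 2))%:C) = z * (pi / 2)%:C.
  rewrite cintZ ?cint_real ?integral_atan//.
  apply: rcontinuous_cintegrable => x _.
  have gc : continuous (fun x => e / ((x - x0) ^+ 2 + e ^+ 2)).
    move=> {}x; apply: cvgM; first exact: cvg_cst.
    apply: cvgV => //; apply: cvgD; last exact: cvg_cst.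
    by apply: cvgM; apply: cvgB => //; exact: cvg_cst.
  move=> d d0; have /cvgrPdist_lt/(_ d d0)/nbhs_normP[r /= r0 H] := gc x.
  exists r => // y yx; rewrite -(rmorphB (real_complex R)).
  by rewrite rnorm_real distrC H//= distrC.
rewrite (@eq_cint _ (u - e) (u + e) _
  (fun x => Complex 0 2 * (e / ((x - u) ^+ 2 + e ^+ 2))%:C)); last first.
  move=> x _; apply/eqP; rewrite eq_complex /=; apply/andP; split; apply/eqP;
  by field; rewrite ?den ?den'.
rewrite (@eq_cint _ (v - e) (v + e) _
  (fun x => Complex 2 0 * (e / ((x - v) ^+ 2 + e ^+ 2))%:C)); last first.
  move=> x _; apply/eqP; rewrite eq_complex /=; apply/andP; split; apply/eqP;
  by field; rewrite ?den ?den'.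
rewrite !int_pi; apply/eqP; rewrite eq_complex /=; by apply/andP; split; apply/eqP; field.
Qed.

(** Four cuts along the lines of the inner sides detach four outer pieces, on which Goursat's
    theorem applies. *)
Lemma rint_shrink (x0 x1 y0 y1 a0 a1 b0 b1 : R) F :
  x0 < a0 < a1 -> a1 < x1 -> y0 < b0 < b1 -> b1 < y1 ->
  (forall z, in_rect x0 x1 y0 y1 z -> ~ (a0 < Re z < a1 /\ b0 < Im z < b1) ->
    differentiable F z) ->
  rint x0 x1 y0 y1 F = rint a0 a1 b0 b1 F.
Proof.
move=> /andP[xa a01] ax /andP[yb b01] b_y Fd.
have out p q r s : x0 <= p -> q <= x1 -> y0 <= r -> s <= y1 ->
    [|| q <= a0, a1 <= p, s <= b0 | b1 <= r] ->
    forall z, in_rect p q r s z -> differentiable F z.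
  move=> ? ? ? ? h z [/andP[? ?] /andP[? ?]]; apply: Fd.
    by split; apply/andP; split; lra.
  by move=> [/andP[? ?] /andP[? ?]]; case/or4P: h; lra.
have outb p q r s : x0 <= p -> q <= x1 -> y0 <= r -> s <= y1 ->
    [|| q <= a0, a1 <= p, s <= b0 | b1 <= r] ->
    forall z, on_border p q r s z -> {for z, continuous F}.
  by move=> h1 h2 h3 h4 h5 z [zr _]; apply/cdiff_cont/(out p q r s).
have bord p q r s : x0 <= p <= a0 -> a1 <= q <= x1 -> y0 <= r <= b0 -> b1 <= s <= y1 ->
    forall z, on_border p q r s z -> {for z, continuous F}.
  move=> ? ? ? ? z [[/andP[? ?] /andP[? ?]] h]; apply/cdiff_cont/Fd.
    by split; apply/andP; split; lra.
  by move=> [/andP[? ?] /andP[? ?]]; case: h; lra.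
have le_xa := ltW xa; have le_ax := ltW ax; have le_yb := ltW yb.
have le_by := ltW b_y; have le_a := ltW a01; have le_b := ltW b01.
rewrite (@rint_splitx _ x0 a0 x1 y0 y1); [|lra|lra|by apply: bord; lra|by apply: outb; lra].
rewrite goursat; [|lra|lra|by apply: out; lra].
rewrite add0r (@rint_splitx _ a0 a1 x1 y0 y1); [|lra|lra|by apply: bord; lra|by apply: bord; lra].
rewrite [X in _ + X]goursat; [|lra|lra|by apply: out; lra].
rewrite addr0 (@rint_splity _ a0 a1 y0 b0 y1); [|lra|lra|by apply: bord; lra|by apply: outb; lra].
rewrite goursat; [|lra|lra|by apply: out; lra].
rewrite add0r (@rint_splity _ a0 a1 b0 b1 y1); [|lra|lra|by apply: bord; lra|by apply: bord; lra].
by rewrite [X in _ + X]goursat ?addr0//; apply: out; lra.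
Qed.

Definition cauchy_const : C := Complex 0 (2 * pi).

Lemma cauchy_const_neq0 : cauchy_const != 0.
Proof.
rewrite eq_complex /= negb_and; apply/orP; right; rewrite mulf_neq0 ?pnatr_eq0//.
by rewrite gt_eqF// pi_gt0.
Qed.

(** After shrinking the contour to a square of half-side [e] around [a], what remains is the
    integral of the difference quotient of [phi]. It is bounded near [a], so its integral is of
    order [e]. *)
Theorem cauchy_formula (x0 x1 y0 y1 : R) phi a :
  x0 < Re a < x1 -> y0 < Im a < y1 ->
  (forall z, in_rect x0 x1 y0 y1 z -> differentiable phi z) ->
  rint x0 x1 y0 y1 (fun z => phi z * (z - a)^-1) = cauchy_const * phi a.
Proof.
move=> /andP[xa ax] /andP[ya ay] phid.
have ra : in_rect x0 x1 y0 y1 a by split; apply/andP; split; lra.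
have Vd z : z != a -> differentiable (fun z : C => (z - a)^-1) z.
  move=> za; apply: cdiffV; first by rewrite subr_eq0.
  by apply: cdiffB; [exact: cdiff_id|exact: cdiff_cst].
apply/eqP; rewrite -subr_eq0 -rnorm_eq0; set D := _ - _.
pose B := rnorm ('d phi a 1) + 1.
have B0 : 0 < B by rewrite ltr_wpDl ?rnorm_ge0.
have [d d0 dP] := differentiable_rnormE (phid _ ra) ltr01.
have dP' z : rnorm (z - a) < d -> rnorm (phi z - phi a) <= B * rnorm (z - a).
  move=> /dP; rewrite [a + _]addrC subrK diff_mul mul1r => h; rewrite /B mulrDl mul1r.
  rewrite -[_ - phi a](subrK ((z - a) * 'd phi a 1)) addrC.
  by apply: le_trans (ler_rnormD _ _) _; apply: lerD => //; rewrite rnormM mulrC.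
(* [in_rect_dist] bounds distances in the small square by [4 * e], which is below [d]. *)
have small e : 0 < e -> e < d / 5 -> e < Re a - x0 -> e < x1 - Re a ->
    e < Im a - y0 -> e < y1 - Im a -> rnorm D <= 16 * B * e.
  move=> e0 ed e1 e2 e3 e4.
  have inside z : in_rect (Re a - e) (Re a + e) (Im a - e) (Im a + e) z ->
      in_rect x0 x1 y0 y1 z.
    by move=> [/andP[? ?] /andP[? ?]]; split; apply/andP; split; lra.
  have za z : on_border (Re a - e) (Re a + e) (Im a - e) (Im a + e) z -> z != a.
    by move=> [_ h]; apply/eqP => E; move: h; rewrite E => -[]; lra.
  have le1 : Re a - e <= Re a + e by lra.
  have le2 : Im a - e <= Im a + e by lra.
  have cV z : on_border (Re a - e) (Re a + e) (Im a - e) (Im a + e) z ->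
    {for z, continuous (fun z : C => (z - a)^-1)}.
    by move=> /za /Vd; exact: cdiff_cont.
  have c1 z : on_border (Re a - e) (Re a + e) (Im a - e) (Im a + e) z ->
    {for z, continuous (fun z : C => (phi z - phi a) * (z - a)^-1)}.
    move=> bz; apply: ccontM; last exact: cV.
    apply: ccontB; last exact: ccont_cst.
    by apply/cdiff_cont/phid/inside; case: bz.
  have -> : D = rint (Re a - e) (Re a + e) (Im a - e) (Im a + e)
      (fun z => (phi z - phi a) * (z - a)^-1).
    rewrite /D (@rint_shrink _ _ _ _ (Re a - e) (Re a + e) (Im a - e) (Im a + e)); [|lra|lra|lra|lra|].
    - apply/eqP; rewrite subr_eq; apply/eqP.
      rewrite /cauchy_const -(rint_winding a e0) [_ * phi a]mulrC -(rintZ le1 le2 (phi a) cV).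
      apply: etrans (rintD le1 le2 c1 _); last first.
        by move=> z bz; apply: ccontM; [exact: ccont_cst|exact: cV].
      by congr rint; apply/funext => z; ring.
    - move=> z zr nz; apply: cdiffM; first exact: phid.
      by apply: Vd; apply/eqP => E; apply: nz; rewrite E; split; apply/andP; split; lra.
  have h := @ler_rnorm_rint _ _ _ _ _ le1 le2 _ B c1.
  apply: le_trans (h _) _; last by rewrite le_eqVlt; apply/orP; left; apply/eqP; ring.
  move=> z bz; rewrite rnormM rnormV.
  have zan : 0 < rnorm (z - a) by rewrite rnorm_gt0 subr_eq0 za.
  rewrite ler_pdivrMr//; apply: dP'.
  have ra' : in_rect (Re a - e) (Re a + e) (Im a - e) (Im a + e) a.
    by split; apply/andP; split; lra.
  by apply: le_lt_trans (in_rect_dist bz.1 ra') _; lra.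
rewrite eq_le rnorm_ge0 andbT leNgt; apply/negP => D0.
pose m := Num.min (d / 5) (Num.min (Num.min (Re a - x0) (x1 - Re a))
  (Num.min (Im a - y0) (y1 - Im a))).
have m0 : 0 < m by rewrite /m !lt_min; lra.
(* With this choice [16 * B * e] is at most half of [rnorm D]. *)
pose e := Num.min (m / 2) (rnorm D / (32 * B)).
have e0 : 0 < e by rewrite /e lt_min !divr_gt0// mulr_gt0.
have em : e < m by rewrite /e gt_min; apply/orP; left; lra.
have eD : e <= rnorm D / (32 * B) by rewrite /e ge_min lexx orbT.
move: em; rewrite /m !lt_min => /andP[h1 /andP[/andP[h2 h3] /andP[h4 h5]]].
have := small e e0 h1 h2 h3 h4 h5; rewrite leNgt => /negP; apply.
move: eD; rewrite ler_pdivlMr ?mulr_gt0// => eD.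
by lra.
Qed.

End cauchy.

(** * Cauchy integrals over squares *)

Section square.
Context (R : realType).
Local Notation C := (R[i]^o).
Implicit Types (F G H phi psi : C -> C) (a z t : C) (s e : R).

(* Contours are squares [snorm t = s], so that only integrals over segments are needed. *)
Definition snorm (t : C) : R := Num.max `|Re t| `|Im t|.

Lemma snorm_ge0 t : 0 <= snorm t.
Proof. by rewrite le_max normr_ge0. Qed.

Lemma snorm_le_rnorm t : snorm t <= rnorm t.
Proof. by rewrite ge_max ler_Re_rnorm ler_Im_rnorm. Qed.

Lemma rnorm_le_snorm t : rnorm t <= 2 * snorm t.
Proof.
apply: le_trans (ler_rnorm_ReIm t) _; rewrite mulrDl mul1r.
by apply: lerD; rewrite le_max lexx ?orbT.
Qed.

Lemma snorm0 : snorm 0 = 0.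
Proof. by rewrite /snorm /= normr0 maxxx. Qed.

Lemma snormN t : snorm (- t) = snorm t.
Proof. by case: t => u v; rewrite /snorm /= !normrN. Qed.

Lemma ler_snormD z t : snorm (z + t) <= snorm z + snorm t.
Proof.
rewrite /snorm ge_max; apply/andP; split.
  have -> : Re (z + t) = Re z + Re t by case: (z) (t) => ? ? [].
  by apply: le_trans (ler_normD _ _) _; apply: lerD; rewrite le_max lexx.
have -> : Im (z + t) = Im z + Im t by case: (z) (t) => ? ? [].
by apply: le_trans (ler_normD _ _) _; apply: lerD; rewrite le_max lexx orbT.
Qed.

Lemma lerB_snorm z t : snorm z - snorm t <= snorm (z - t).
Proof. by rewrite lerBlDr; apply: le_trans (ler_snormD _ _); rewrite subrK. Qed.

Lemma snorm_rect s t : (snorm t <= s) <-> in_rect (- s) s (- s) s t.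
Proof. by rewrite ge_max !ler_norml /in_rect; split=> [/andP[]|[-> ->]]. Qed.

Lemma border_snorm s t : on_border (- s) s (- s) s t -> snorm t = s.
Proof.
move=> [/snorm_rect ts h]; apply/eqP; rewrite eq_le ts/=.
rewrite le_max; case: h => ->; rewrite ?normrN ler_norm ?orbT//.
Qed.

Definition cauchy_int s F : C := (cauchy_const R)^-1 * rint (- s) s (- s) s F.

(** The border is included, so that Cauchy's formula can be used with the contour [snorm t = s]
    itself. *)
Definition holomorphic_sq s F : Prop := forall t, snorm t <= s -> differentiable F t.

Section linear.
Variable s : R.
Hypothesis s0 : 0 < s.
Let ss : - s <= s. Proof. by rewrite (le_trans _ (ltW s0))// oppr_le0 ltW. Qed.
Let contour_cont F := forall t, snorm t = s -> {for t, continuous F}.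

Let contour_bd F : contour_cont F ->
  forall t, on_border (- s) s (- s) s t -> {for t, continuous F}.
Proof. by move=> Fc t /border_snorm/Fc. Qed.

Lemma eq_cauchy_int F G : (forall t, snorm t = s -> F t = G t) ->
  cauchy_int s F = cauchy_int s G.
Proof.
by move=> FG; rewrite /cauchy_int (@eq_rint _ _ _ _ _ ss ss _ G)// => t /border_snorm/FG.
Qed.

Lemma cauchy_intD F G : contour_cont F -> contour_cont G ->
  cauchy_int s (fun t => F t + G t) = cauchy_int s F + cauchy_int s G.
Proof.
by move=> /contour_bd Fc /contour_bd Gc; rewrite /cauchy_int (rintD ss ss Fc Gc) mulrDr.
Qed.

Lemma cauchy_intZ (c : C) F : contour_cont F ->
  cauchy_int s (fun t => c * F t) = c * cauchy_int s F.
Proof.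
by move=> /contour_bd Fc; rewrite /cauchy_int (rintZ ss ss c Fc) mulrCA.
Qed.

Lemma cauchy_intB F G : contour_cont F -> contour_cont G ->
  cauchy_int s (fun t => F t - G t) = cauchy_int s F - cauchy_int s G.
Proof.
move=> Fc Gc; have Gn : contour_cont (fun t => -1 * G t).
  by move=> t /Gc h; apply: ccontM; [exact: ccont_cst|exact: h].
have h := cauchy_intD Fc Gn; rewrite (cauchy_intZ (-1) Gc) mulN1r in h; rewrite -h.
by apply: eq_cauchy_int => t _; rewrite mulN1r.
Qed.

(** Continuity of the partial sums is carried through the induction because [cauchy_intD] asks for
    it. *)
Lemma cauchy_int_sum k (F : 'I_k -> C -> C) : (forall i, contour_cont (F i)) ->
  cauchy_int s (fun t => \sum_i F i t) = \sum_i cauchy_int s (F i) /\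
  contour_cont (fun t => \sum_i F i t).
Proof.
elim: k F => [|k ih] F Fc.
  rewrite big_ord0; split; last first.
    move=> t _; rewrite (_ : (fun t => _) = fun=> 0); first exact: ccont_cst.
    by apply/funext => u; rewrite big_ord0.
  rewrite (@eq_cauchy_int _ (fun=> 0)); last by move=> t _; rewrite big_ord0.
  by rewrite /cauchy_int rint_cst// mulr0.
have [h1 h2] := ih (fun i => F (lift ord0 i)) (fun i => Fc _).
have E : (fun t => \sum_i F i t) = (fun t => F ord0 t + \sum_i F (lift ord0 i) t).
  by apply/funext => t; rewrite big_ord_recl.
rewrite E; split; last by move=> t ts; apply: ccontD; [exact: Fc|exact: h2].
by rewrite (cauchy_intD (Fc ord0) h2) h1 big_ord_recl.
Qed.

(** The bound [4 * M * (4 * s)] on the contour integral is divided by [2 * pi], and [pi >= 2]. *)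
Lemma ler_rnorm_cauchy_int F (M : R) : contour_cont F ->
  (forall t, snorm t = s -> rnorm (F t) <= M) ->
  rnorm (cauchy_int s F) <= 4 * s * M.
Proof.
move=> /contour_bd Fc FM; rewrite /cauchy_int rnormM rnormV.
have -> : rnorm (cauchy_const R) = 2 * pi.
  rewrite rnormc /Normc.normc /= expr0n add0r sqrtr_sqr ger0_norm//.
  by rewrite mulr_ge0// pi_ge0.
have p2 := @pi_ge2 R.
rewrite ler_pdivrMl; last by lra.
have := ler_rnorm_rint ss ss Fc (fun t bt => FM t (border_snorm bt)).
move=> /le_trans; apply.
have M0 : 0 <= M.
  apply: le_trans (rnorm_ge0 _) (FM (Complex s 0) _).
  by rewrite /snorm /= normr0 ger0_norm ?ltW// /Num.max ltNge ltW.
have : 0 <= s * M * (pi - 2) by rewrite !mulr_ge0 ?subr_ge0// ltW.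
by lra.
Qed.

Lemma cauchy_int_holomorphic phi : holomorphic_sq s phi -> cauchy_int s phi = 0.
Proof.
move=> h; rewrite /cauchy_int goursat ?mulr0// => t /snorm_rect; exact: h.
Qed.

Lemma cauchy_int_formula phi a : holomorphic_sq s phi -> snorm a < s ->
  cauchy_int s (fun t => phi t * (t - a)^-1) = phi a.
Proof.
move=> h; rewrite gt_max !ltr_norml => /andP[ar ai].
rewrite /cauchy_int (cauchy_formula ar ai) ?mulKf ?cauchy_const_neq0//.
by move=> z /snorm_rect; exact: h.
Qed.

Lemma snorm_subr_gt0 a t : snorm a < s -> snorm t = s -> t - a != 0.
Proof.
move=> sa st; rewrite subr_eq0; apply: contraTneq sa => <-.
by rewrite st ltxx.
Qed.

Lemma rnorm_subr_contour a t : snorm t = s -> s - snorm a <= rnorm (t - a).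
Proof. by move=> <-; apply: le_trans (snorm_le_rnorm _); exact: lerB_snorm. Qed.

Lemma contV_contour a : snorm a < s -> contour_cont (fun t => (t - a)^-1).
Proof.
move=> sa t st; apply: ccontV; first exact: snorm_subr_gt0.
by apply: ccontB; [exact: ccont_id|exact: ccont_cst].
Qed.

Lemma holomorphic_contour phi : holomorphic_sq s phi -> contour_cont phi.
Proof. by move=> h t st; apply/cdiff_cont/h; rewrite st. Qed.

(** A crude form of the maximum principle, read off Cauchy's formula with
    [s - snorm a <= rnorm (t - a)] on the contour. The lost constant is harmless where it is
    used. *)
Lemma weak_maximum phi a (M : R) : holomorphic_sq s phi -> snorm a < s ->
  (forall t, snorm t = s -> rnorm (phi t) <= M) ->
  rnorm (phi a) <= 4 * s * M / (s - snorm a).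
Proof.
move=> h sa hM; rewrite -(cauchy_int_formula h sa) -mulrA.
apply: ler_rnorm_cauchy_int.
  move=> t st; apply: ccontM; first exact: holomorphic_contour.
  exact: contV_contour.
move=> t st; rewrite rnormM rnormV; apply: ler_pM; rewrite ?invr_ge0 ?rnorm_ge0// ?hM//.
have d0 : 0 < s - snorm a by rewrite subr_gt0.
have := rnorm_subr_contour a st.
by move=> h1; rewrite lef_pV2 ?posrE//; apply: lt_le_trans h1.
Qed.

(** The extreme value theorem on each of the four sides, parametrized by a real segment. *)
Lemma contour_bounded F : contour_cont F ->
  exists2 M : R, 0 < M & forall t, snorm t = s -> rnorm (F t) <= M.
Proof.
move=> Fc.
have side (p : R -> C) : (forall x, - s <= x <= s -> rcontinuous_at (F \o p) x) ->
    exists M : R, forall x, - s <= x <= s -> rnorm (F (p x)) <= M.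
  move=> pc; have rc : {within `[(- s), s], continuous (fun x => rnorm (F (p x)))}.
    apply: continuous_in_subspaceT => x; rewrite inE/= in_itv/= => /pc px.
    apply/cvgrPdist_lt => e e0; have [d d0 dP] := px e e0.
    apply/nbhs_normP; exists d => //= y; rewrite /ball_/= => xy.
    apply: le_lt_trans (dP y _); last by rewrite distrC.
    rewrite ler_norml lerBlDr [X in X && _]lerNl opprB lerBlDr; apply/andP; split.
      by apply: le_trans (ler_rnormD _ _); rewrite subrK.
    by rewrite rdistC; apply: le_trans (ler_rnormD _ _); rewrite subrK.
  have [c _ cP] := EVT_max ss rc.
  by exists (rnorm (F (p c))) => x xs; apply: cP; rewrite in_itv.
have sn1 x : - s <= x <= s -> snorm (Complex x s) = s.
  move=> xs; apply: border_snorm; split; last exact: Or44.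
  by split=> //=; rewrite lexx andbT.
have sn2 x : - s <= x <= s -> snorm (Complex x (- s)) = s.
  move=> xs; apply: border_snorm; split; last exact: Or43.
  by split=> //=; rewrite lexx.
have sn3 x : - s <= x <= s -> snorm (Complex s x) = s.
  move=> xs; apply: border_snorm; split; last exact: Or42.
  by split=> //=; rewrite lexx andbT.
have sn4 x : - s <= x <= s -> snorm (Complex (- s) x) = s.
  move=> xs; apply: border_snorm; split; last exact: Or41.
  by split=> //=; rewrite lexx.
have [M1 P1] := side (fun x => Complex x s) (fun x xs => continuous_horizontal (Fc _ (sn1 x xs))).
have [M2 P2] := side (fun x => Complex x (- s)) (fun x xs => continuous_horizontal (Fc _ (sn2 x xs))).
have [M3 P3] := side (fun x => Complex s x) (fun x xs => continuous_vertical (Fc _ (sn3 x xs))).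
have [M4 P4] := side (fun x => Complex (- s) x) (fun x xs => continuous_vertical (Fc _ (sn4 x xs))).
exists (1 + `|M1| + `|M2| + `|M3| + `|M4|).
  by rewrite -!addrA ltr_wpDr// !addr_ge0.
have n1 := normr_ge0 M1; have n2 := normr_ge0 M2.
have n3 := normr_ge0 M3; have n4 := normr_ge0 M4.
have l1 := ler_norm M1; have l2 := ler_norm M2.
have l3 := ler_norm M3; have l4 := ler_norm M4.
move=> [x y] st; have := lexx (snorm (Complex x y)); rewrite [X in _ <= X]st.
rewrite ge_max /= !ler_norml => /andP[xs ys].
move: st; rewrite /snorm /= maxEle; case: ifP => _ st.
  have [y0|y0] := leP 0 y.
    have -> : y = s by rewrite -st ger0_norm.
    by have := P1 x xs; lra.
  have -> : y = - s by rewrite -st ltr0_norm ?opprK.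
  by have := P2 x xs; lra.
have [x0|x0] := leP 0 x.
  have -> : x = s by rewrite -st ger0_norm.
  by have := P3 y ys; lra.
have -> : x = - s by rewrite -st ltr0_norm ?opprK.
by have := P4 y ys; lra.
Qed.

End linear.
End square.

(** * Quadratic remainders and division by a linear factor *)

Section quadratic.
Context (R : realType).
Local Notation C := (R[i]^o).

(** Differentiation under the integral sign goes through this lemma: an explicit quadratic remainder
    can be integrated, and it also identifies the differential. *)
Lemma quadratic_differentiable (V W : normedModType R[i]) (f : V -> W) (x : V)
    (D : {linear V -> W}) (c r : R) : continuous D -> 0 < r ->
  (forall h, rnorm h < r -> rnorm (f (x + h) - f x - D h) <= c * rnorm h ^+ 2) ->
  differentiable f x /\ 'd f x = D :> (V -> W).
Proof.
move=> Dc r0 H.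
have small (e : R) : 0 < e -> exists2 d, 0 < d & forall h : V, rnorm h < d ->
    rnorm (f (x + h) - f x - D h) <= e * rnorm h.
  move=> e0; have c0 : 0 < `|c| + 1 by rewrite ltr_wpDl.
  exists (Num.min r (e / (`|c| + 1))); first by rewrite lt_min r0 divr_gt0.
  move=> h; rewrite lt_min => /andP[/H hr]; rewrite ltr_pdivlMr// => he.
  apply: le_trans hr _; rewrite expr2 mulrA ler_wpM2r ?rnorm_ge0//.
  have := ler_norm c; have := rnorm_ge0 h; have := normr_ge0 c; nra.
split; first exact: rnorm_differentiable Dc small.
apply: diff_unique => //; apply/eqaddoP => e e0.
have [d d0 dH] := small (Re e) ltac:(by move: e0; rewrite ltcE => /andP[]).
apply/nbhs_rnormP; exists d => // h; rewrite subr0 => /dH.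
rewrite -lecR rmorphM /= -!rnormE (RRe_real (gtr0_real e0)).
by rewrite !fctE /= (addrC h x) -addrA -opprD.
Qed.

(** A separate name, so that it can be made a linear map and passed as a candidate differential. *)
Definition mulc (D h : C) : C := h * D.

Lemma mulc_is_linear D : linear (mulc D).
Proof. by move=> k u v; rewrite /mulc mulrDl -[k *: u]/(k * u) -mulrA. Qed.

HB.instance Definition _ (D : C) :=
  GRing.isLinear.Build R[i] C C *:%R (mulc D) (mulc_is_linear D).

Lemma mulc_continuous D : continuous (mulc D).
Proof. by move=> z; apply: ccontM; [exact: ccont_id|exact: ccont_cst]. Qed.

Section cauchy_transform.
Variables (s : R) (H : C -> C) (M : R).
Hypotheses (s0 : 0 < s) (Hc : forall t, snorm t = s -> {for t, continuous H})
  (HM : forall t, snorm t = s -> rnorm (H t) <= M).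

(** With [u = t - a], the remainder of the kernel is [h ^+ 2 / (u ^+ 2 * (u - h))]. On the contour
    [u] has norm at least [s - snorm a] and [u - h] at least half of that. *)
Lemma cauchy_transform_quadratic (a h : C) : snorm a < s ->
  snorm h <= (s - snorm a) / 2 ->
  rnorm (cauchy_int s (fun t => H t * (t - (a + h))^-1) -
    cauchy_int s (fun t => H t * (t - a)^-1) -
    h * cauchy_int s (fun t => H t * ((t - a)^-1 * (t - a)^-1))) <=
  8 * s * M / (s - snorm a) ^+ 3 * rnorm h ^+ 2.
Proof.
move=> sa sh; set d := s - snorm a in sh *.
have d0 : 0 < d by rewrite subr_gt0.
have sah : snorm (a + h) < s.
  by apply: le_lt_trans (ler_snormD _ _) _; move: sh; rewrite /d; lra.
have c1 t (st : snorm t = s) : {for t, continuous (fun t => H t * (t - (a + h))^-1)}.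
  by apply: ccontM; [exact: Hc|exact: (contV_contour sah st)].
have c2 t (st : snorm t = s) : {for t, continuous (fun t => H t * (t - a)^-1)}.
  by apply: ccontM; [exact: Hc|exact: (contV_contour sa st)].
have c3 t (st : snorm t = s) : {for t, continuous (fun t => H t * ((t - a)^-1 * (t - a)^-1))}.
  by apply: ccontM; [exact: Hc|apply: ccontM; exact: (contV_contour sa st)].
have c4 t (st : snorm t = s) : {for t, continuous (fun t => h * (H t * ((t - a)^-1 * (t - a)^-1)))}.
  by apply: ccontM; [exact: ccont_cst|exact: c3].
have c12 t (st : snorm t = s) :
    {for t, continuous (fun t => H t * (t - (a + h))^-1 - H t * (t - a)^-1)}.
  by apply: ccontB; [exact: c1|exact: c2].
rewrite -(cauchy_intZ s0 h c3) -(cauchy_intB s0 c1 c2) -(cauchy_intB s0 c12 c4).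
have -> : 8 * s * M / d ^+ 3 * rnorm h ^+ 2 =
    4 * s * (M * (rnorm h ^+ 2 * ((d ^-1) ^+ 2 * (d / 2)^-1))).
  by field; rewrite gt_eqF.
apply: (ler_rnorm_cauchy_int s0).
  by move=> t st; apply: ccontB; [exact: c12|exact: c4].
move=> t st; have n1 := snorm_subr_gt0 sa st; have n2 := snorm_subr_gt0 sah st.
have -> : H t * (t - (a + h))^-1 - H t * (t - a)^-1 -
    h * (H t * ((t - a)^-1 * (t - a)^-1)) =
    H t * (h ^+ 2 * ((t - a)^-1 ^+ 2 * (t - (a + h))^-1)).
  by field; rewrite n1 n2.
rewrite (rnormM (H t)) (rnormM (h ^+ 2)) (rnormM ((t - a)^-1 ^+ 2)) (rnormX h) (rnormX (t - a)^-1) !rnormV.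
have r1 : d <= rnorm (t - a) := rnorm_subr_contour a st.
have r2 : d / 2 <= rnorm (t - (a + h)).
  apply: le_trans (rnorm_subr_contour (a + h) st).
  by have := ler_snormD a h; move: sh; rewrite /d; lra.
have r1' : 0 < rnorm (t - a) by exact: lt_le_trans r1.
have r2' : 0 < rnorm (t - (a + h)) by apply: lt_le_trans r2; rewrite divr_gt0.
apply: ler_pM; [exact: rnorm_ge0| |exact: HM|].
  by rewrite !mulr_ge0 ?exprn_ge0 ?invr_ge0 ?rnorm_ge0.
apply: ler_wpM2l; first by rewrite exprn_ge0 ?rnorm_ge0.
apply: ler_pM; rewrite ?exprn_ge0 ?invr_ge0 ?rnorm_ge0//.
  by rewrite lerXn2r ?nnegrE ?invr_ge0 ?rnorm_ge0 ?(ltW d0)// lef_pV2 ?posrE.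
by rewrite lef_pV2 ?posrE// divr_gt0.
Qed.

Lemma cauchy_transform_differentiable (a : C) : snorm a < s ->
  differentiable (fun z => cauchy_int s (fun t => H t * (t - z)^-1)) a /\
  'd (fun z => cauchy_int s (fun t => H t * (t - z)^-1)) a 1 =
    cauchy_int s (fun t => H t * ((t - a)^-1 * (t - a)^-1)).
Proof.
move=> sa; set D := cauchy_int s (fun t => H t * ((t - a)^-1 * (t - a)^-1)).
have [] := @quadratic_differentiable C C
    (fun z => cauchy_int s (fun t => H t * (t - z)^-1)) a (mulc D)
    (8 * s * M / (s - snorm a) ^+ 3) ((s - snorm a) / 2).
- exact: mulc_continuous.
- by rewrite divr_gt0// subr_gt0.
- move=> h hr; apply: cauchy_transform_quadratic => //.
  by apply: le_trans (snorm_le_rnorm h) (ltW hr).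
by move=> Fd dE; split => //; rewrite dE; exact: mul1r.
Qed.

End cauchy_transform.

(** The remainder depends on [s] and [M] alone, which makes the estimate in several variables
    uniform in the direction of the complex line. *)
Lemma holomorphic_quadratic (s : R) (phi : C -> C) (M : R) (h : C) : 0 < s ->
  holomorphic_sq s phi -> (forall t, snorm t = s -> rnorm (phi t) <= M) ->
  snorm h <= s / 2 ->
  rnorm (phi h - phi 0 - h * 'd phi 0 1) <= 8 * M / s ^+ 2 * rnorm h ^+ 2.
Proof.
move=> s0 hol HM; have hc := holomorphic_contour hol.
have z0 : snorm (0 : C) < s by rewrite snorm0.
set D := cauchy_int s (fun t => phi t * ((t - 0)^-1 * (t - 0)^-1)).
have Q (k : C) : snorm k <= s / 2 ->
    rnorm (phi k - phi 0 - k * D) <= 8 * M / s ^+ 2 * rnorm k ^+ 2.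
  move=> sk; have ks : snorm k < s by apply: le_lt_trans sk _; lra.
  have := @cauchy_transform_quadratic s phi M s0 hc HM 0 k z0.
  rewrite (cauchy_int_formula hol z0) add0r (cauchy_int_formula hol ks).
  rewrite -/D snorm0 subr0 => /(_ sk) /le_trans; apply.
  by rewrite le_eqVlt; apply/orP; left; apply/eqP; field; rewrite gt_eqF.
have [] := @quadratic_differentiable C C phi 0 (mulc D) (8 * M / s ^+ 2) (s / 2).
- exact: mulc_continuous.
- by rewrite divr_gt0.
- move=> k ks; rewrite add0r; apply: Q.
  by apply: le_trans (snorm_le_rnorm k) (ltW ks).
move=> _ dE sh; have -> : 'd phi 0 1 = D by rewrite dE; exact: mul1r.
exact: Q.
Qed.

(** A removable singularity: by partial fractions, the difference quotient agrees off [a] with the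
    Cauchy transform of [phi t / (t - a)], which is differentiable at [a] as well. *)
Lemma holomorphic_divide (s : R) (phi : C -> C) (a : C) : 0 < s ->
  holomorphic_sq s phi -> snorm a < s ->
  exists2 psi, holomorphic_sq s psi & forall t, phi t - phi a = (t - a) * psi t.
Proof.
move=> s0 hol sa; have hc := holomorphic_contour hol.
have cV := contV_contour sa.
have Hc t : snorm t = s -> {for t, continuous (fun t => phi t * (t - a)^-1)}.
  by move=> st; apply: ccontM; [exact: hc|exact: cV].
have [M M0 HM] := contour_bounded s0 Hc.
pose G z := cauchy_int s (fun t => phi t * (t - a)^-1 * (t - z)^-1).
pose q t := (phi t - phi a) * (t - a)^-1.
pose psi t := if t == a then G a else q t.
have [Ga _] := cauchy_transform_differentiable s0 Hc HM sa.
have GE z : snorm z < s -> z != a -> q z = G z.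
  move=> sz za; have za0 : z - a != 0 by rewrite subr_eq0.
  have c1 t : snorm t = s -> {for t, continuous (fun t => phi t * (t - z)^-1)}.
    by move=> st; apply: ccontM; [exact: hc|exact: (contV_contour sz)].
  have cB t : snorm t = s -> {for t, continuous (fun t => phi t * (t - z)^-1 - phi t * (t - a)^-1)}.
    by move=> st; apply: ccontB; [exact: c1|exact: Hc].
  rewrite /q -{1}(cauchy_int_formula hol sz) -{1}(cauchy_int_formula hol sa).
  rewrite -(cauchy_intB s0 c1 Hc) mulrC -(cauchy_intZ s0 _ cB).
  apply: eq_cauchy_int => // t st.
  have n1 := snorm_subr_gt0 sa st; have n2 := snorm_subr_gt0 sz st.
  by field; rewrite n1 n2 za0.
exists psi.
  move=> t st; have [->{t st}|ta] := eqVneq t a.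
    apply: near_differentiable Ga; apply/nbhs_rnormP; exists (s - snorm a); first by rewrite subr_gt0.
    move=> y ya; rewrite /psi; case: eqVneq => [->//|y_a].
    rewrite -[LHS](GE y)//; have := ler_snormD a (y - a); rewrite addrC subrK.
    by have := snorm_le_rnorm (y - a); lra.
  have qd : differentiable q t.
    apply: cdiffM; first by apply: cdiffB; [exact: hol|exact: cdiff_cst].
    apply: cdiffV; first by rewrite subr_eq0.
    by apply: cdiffB; [exact: cdiff_id|exact: cdiff_cst].
  apply: near_differentiable qd; apply/nbhs_rnormP; exists (rnorm (t - a)).
    by rewrite rnorm_gt0 subr_eq0.
  move=> y yt; rewrite /psi; case: eqVneq => // E.
  by move: yt; rewrite E rdistC ltxx.
move=> t; rewrite /psi; case: eqVneq => [->|ta]; first by rewrite !subrr mul0r.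
by rewrite /q mulrC divfK// subr_eq0.
Qed.

End quadratic.

(** * Zeros and poles in a square *)

Section factorization.
Context (R : realType).
Local Notation C := (R[i]^o).
Implicit Types (phi psi eta p q : C -> C) (a t : C) (s : R) (l : seq C).

Definition prodX l t : C := \prod_(a <- l) (t - a).

Lemma prodX_nil t : prodX [::] t = 1.
Proof. by rewrite /prodX big_nil. Qed.

Lemma prodX_cons a l t : prodX (a :: l) t = (t - a) * prodX l t.
Proof. by rewrite /prodX big_cons. Qed.

Lemma prodX_differentiable l t : differentiable (prodX l) t.
Proof.
elim: l => [|a l ih].
  rewrite (_ : prodX [::] = fun=> 1); last by apply/funext => u; rewrite prodX_nil.
  exact: cdiff_cst.
rewrite (_ : prodX (a :: l) = fun t => (t - a) * prodX l t); last first.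
  by apply/funext => u; rewrite prodX_cons.
apply: cdiffM; last exact: ih.
by apply: cdiffB; [exact: cdiff_id|exact: cdiff_cst].
Qed.

Lemma prodX_eq0 l t : (prodX l t == 0) = (t \in l).
Proof.
elim: l => [|a l ih]; first by rewrite prodX_nil oner_eq0.
by rewrite prodX_cons mulf_eq0 subr_eq0 ih inE.
Qed.

Lemma prodX_neq0_near l a : exists2 d : R, 0 < d &
  forall t, 0 < rnorm (t - a) < d -> prodX l t != 0.
Proof.
elim: l => [|b l [d d0 ih]].
  by exists 1 => // t _; rewrite prodX_nil oner_neq0.
have [->|ba] := eqVneq b a.
  exists d => // t ta; rewrite prodX_cons mulf_neq0 ?ih//.
  by rewrite -rnorm_gt0; case/andP: ta.
exists (Num.min d (rnorm (b - a))); first by rewrite lt_min d0 rnorm_gt0 subr_eq0.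
move=> t /andP[t0]; rewrite lt_min => /andP[td tb].
rewrite prodX_cons mulf_neq0 ?ih ?t0// subr_eq0.
by apply: contraTneq tb => ->; rewrite ltxx.
Qed.

Lemma ler_rnorm_prodX l t (B : R) : (forall a, a \in l -> rnorm (t - a) <= B) ->
  rnorm (prodX l t) <= B ^+ size l.
Proof.
elim: l => [|a l ih] h; first by rewrite prodX_nil rnorm1 expr0.
rewrite prodX_cons rnormM exprS ler_pM ?rnorm_ge0 ?h ?mem_head//.
by apply: ih => b bl; rewrite h// inE bl orbT.
Qed.

Lemma ger_rnorm_prodX l t (B : R) : 0 <= B -> (forall a, a \in l -> B <= rnorm (t - a)) ->
  B ^+ size l <= rnorm (prodX l t).
Proof.
move=> B0; elim: l => [|a l ih] h; first by rewrite prodX_nil rnorm1 expr0.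
rewrite prodX_cons rnormM exprS ler_pM ?exprn_ge0 ?h ?mem_head//.
by apply: ih => b bl; rewrite h// inE bl orbT.
Qed.

(* The ratio 9: [t - a] is at least [8 s / 9] on the contour and at most half of that when [snorm t] and [snorm a] are at most [s / 9]. *)
Lemma zeros_bound s phi eta l (M : R) t : 0 < s -> holomorphic_sq s eta ->
  (forall t, phi t = prodX l t * eta t) ->
  (forall a, a \in l -> snorm a <= s / 9) ->
  (forall t, snorm t = s -> rnorm (phi t) <= M) -> snorm t <= s / 9 ->
  2 ^+ size l * rnorm (phi t) <= 9 / 2 * M.
Proof.
move=> s0 hol E la HM ts; set N := size l.
have c0 : 0 < 8 * s / 9 by lra.
have M0 : 0 <= M.
  apply: le_trans (rnorm_ge0 _) (HM (Complex s 0) _).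
  by rewrite /snorm /= normr0 ger0_norm ?ltW// /Num.max ltNge ltW.
have eM u : snorm u = s -> rnorm (eta u) <= M / (8 * s / 9) ^+ N.
  move=> us; rewrite ler_pdivlMr ?exprn_gt0//.
  apply: le_trans (HM _ us); rewrite E rnormM mulrC ler_wpM2r ?rnorm_ge0//.
  apply: ger_rnorm_prodX; first exact: ltW.
  move=> a al; apply: le_trans (rnorm_subr_contour a us).
  by have := la _ al; lra.
have tls : snorm t < s by lra.
have h := weak_maximum s0 hol tls eM.
have h1 : rnorm (prodX l t) <= (4 * s / 9) ^+ N.
  apply: ler_rnorm_prodX => a al; apply: le_trans (rnorm_le_snorm _) _.
  have := ler_snormD t (- a); rewrite snormN; have := la _ al; lra.
have h2 : rnorm (eta t) <= 9 / 2 * (M / (8 * s / 9) ^+ N).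
  apply: le_trans h _; rewrite ler_pdivrMr ?subr_gt0//.
  have : 0 <= M / (8 * s / 9) ^+ N by rewrite divr_ge0// exprn_ge0// ltW.
  by have := snorm_ge0 t; set Q := M / _; nra.
rewrite E rnormM; apply: le_trans (_ : 2 ^+ N * ((4 * s / 9) ^+ N * (9 / 2 * (M / (8 * s / 9) ^+ N))) <= _).
  by rewrite ler_wpM2l ?exprn_ge0// ler_pM ?rnorm_ge0.
rewrite mulrA -exprMn [2 * _](_ : _ = 8 * s / 9); last by field.
by rewrite [leLHS](_ : _ = 9 / 2 * M)//; field; rewrite expf_neq0// gt_eqF//; lra.
Qed.

Lemma pow2_unbounded (x y : R) : 0 < x -> exists k, y < 2 ^+ k * x.
Proof.
move=> x0; have [k yk] : exists k : nat, y / x < k%:R.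
  exists (Num.bound `|y / x|); apply: le_lt_trans (ler_norm _) _.
  exact: archi_boundP.
exists k; rewrite -ltr_pdivrMr//; apply: lt_trans yk _.
by rewrite -natrX ltr_nat ltn_expl.
Qed.

(** Zeros are divided out one at a time. [zeros_bound], applied at a point where [phi] does not
    vanish, bounds the number of extracted zeros, so the process stops. *)
Lemma holomorphic_factor s phi : 0 < s -> holomorphic_sq s phi ->
  (forall t, s / 9 <= snorm t <= s -> phi t != 0) ->
  exists l eta, [/\ forall a, a \in l -> snorm a < s / 9, holomorphic_sq s eta,
    forall t, phi t = prodX l t * eta t &
    forall t, snorm t <= s -> eta t != 0].
Proof.
move=> s0 hol nz; set good := exists l eta, _.
(* Either the process has stopped, or it has extracted [k] zeros. *)
have step k : good \/ exists l eta, [/\ size l = k, forall a, a \in l -> snorm a < s / 9,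
    holomorphic_sq s eta & forall t, phi t = prodX l t * eta t].
  elim: k => [|k [|[l [eta [lk la ehol E]]]]]; [right|by left|].
    by exists [::], phi; split => // t; rewrite prodX_nil mul1r.
  have [enz|] := pselect (forall t, snorm t <= s -> eta t != 0).
    by left; exists l, eta.
  move=> /existsNP[a /not_implyP[as_ /negP/negPn/eqP ea]]; right.
  have a9 : snorm a < s / 9.
    rewrite ltNge; apply/negP => a9; have /negP := nz a ltac:(by rewrite a9).
    by apply; rewrite E ea mulr0.
  have [|psi ph psiE] := holomorphic_divide s0 ehol (a := a); first by lra.
  exists (a :: l), psi; split => //=; first by rewrite lk.
    by move=> b; rewrite inE => /predU1P[->|/la].
  by move=> t; rewrite E prodX_cons [_ * prodX l t]mulrC -mulrA -psiE ea subr0.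
have [M M0 HM] := contour_bounded s0 (holomorphic_contour hol).
pose t0 := Complex (s / 9) 0 : C.
have t09 : snorm t0 = s / 9.
  by rewrite /snorm /= normr0 ger0_norm ?maxEge ?divr_ge0// ltW.
have p0 : 0 < rnorm (phi t0) by rewrite rnorm_gt0; apply: nz; rewrite t09; lra.
have [k kP] := pow2_unbounded (9 / 2 * M) p0.
have [//|[l [eta [lk la ehol E]]]] := step k.
have t09' : snorm t0 <= s / 9 by rewrite t09.
have := zeros_bound s0 ehol E (fun a al => ltW (la a al)) HM t09'.
by rewrite lk leNgt kP.
Qed.

(** [N] is quantified before [phi], so that one bound serves all slices. *)
Lemma size_zeros_bound s (m M : R) : 0 < s -> 0 < m ->
  exists N : nat, forall phi eta l, holomorphic_sq s eta ->
    (forall t, phi t = prodX l t * eta t) ->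
    (forall a, a \in l -> snorm a < s / 9) ->
    (forall t, snorm t = s -> rnorm (phi t) <= M) ->
    (forall t, snorm t = s / 9 -> m <= rnorm (phi t)) -> (size l <= N)%N.
Proof.
move=> s0 m0; have [N NP] := pow2_unbounded (9 / 2 * M) m0.
exists N => phi eta l ehol E la HM Hm; rewrite leqNgt; apply/negP => Nl.
pose t0 := Complex (s / 9) 0 : C.
have t09 : snorm t0 = s / 9.
  by rewrite /snorm /= normr0 ger0_norm ?maxEge ?divr_ge0// ltW.
have t09' : snorm t0 <= s / 9 by rewrite t09.
have := zeros_bound s0 ehol E (fun a al => ltW (la a al)) HM t09'.
rewrite leNgt => /negP; apply; apply: lt_le_trans NP _.
apply: ler_pM => //; rewrite ?exprn_ge0 ?(ltW m0) ?Hm//.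
by apply: ler_weXn2l; [rewrite ler1n|exact: ltnW].
Qed.

(** The argument of [holomorphic_factor] with all extracted zeros at the origin; [t1] is the point
    at which [zeros_bound] stops the process. *)
Lemma order_at0 s phi t1 : 0 < s -> holomorphic_sq s phi ->
  snorm t1 <= s / 9 -> phi t1 != 0 ->
  exists k eta, [/\ holomorphic_sq s eta, forall t, phi t = t ^+ k * eta t & eta 0 != 0].
Proof.
move=> s0 hol t19 pt1; set good := exists k eta, _.
have prod0 k t : prodX (nseq k (0 : C)) t = t ^+ k.
  by elim: k => [|k ih]; rewrite ?prodX_nil// prodX_cons ih subr0 exprS.
have step k : good \/ exists2 eta, holomorphic_sq s eta & forall t, phi t = t ^+ k * eta t.
  elim: k => [|k [|[eta ehol E]]]; [right|by left|].
    by exists phi => // t; rewrite expr0 mul1r.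
  have [e0|en0] := eqVneq (eta 0) 0; last by left; exists k, eta.
  right; have [|psi ph psiE] := holomorphic_divide s0 ehol (a := 0); first by rewrite snorm0.
  exists psi => // t; have := psiE t; rewrite e0 !subr0 E => ->.
  by rewrite mulrA -exprSr.
have [M M0 HM] := contour_bounded s0 (holomorphic_contour hol).
have p0 : 0 < rnorm (phi t1) by rewrite rnorm_gt0.
have [k kP] := pow2_unbounded (9 / 2 * M) p0.
have [//|[eta ehol E]] := step k.
have E' t : phi t = prodX (nseq k (0 : C)) t * eta t by rewrite prod0 E.
have l9 a : a \in nseq k (0 : C) -> snorm a <= s / 9.
  by move=> /nseqP[-> _]; rewrite snorm0 divr_ge0// ltW.
have := zeros_bound s0 ehol E' l9 HM t19.
by rewrite size_nseq leNgt kP.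
Qed.

(** Induction on the zeros of the denominator: a zero [a] that is also a zero of [p] cancels, and
    otherwise the quotient has a pole at [a]. The second alternative says that the quotient is at
    least [c / rnorm (t - a)], written without division. *)
Lemma quotient_dichotomy s p eta l : 0 < s -> holomorphic_sq s p ->
  holomorphic_sq s eta -> (forall t, snorm t <= s -> eta t != 0) ->
  (forall a, a \in l -> snorm a < s) ->
  (exists2 H, holomorphic_sq s H & forall t, snorm t <= s -> p t = prodX l t * eta t * H t) \/
  exists a c d, [/\ snorm a < s, 0 < c, 0 < d &
    forall t, 0 < rnorm (t - a) < d -> prodX l t * eta t != 0 /\
      c * rnorm (prodX l t * eta t) <= rnorm (p t) * rnorm (t - a)].
Proof.
move=> s0 + ehol enz; elim: l p => [|a l ih] p phol la.
  left; exists (fun t => p t * (eta t)^-1).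
    by move=> t ts; apply: cdiffM; [exact: phol|apply: cdiffV; [exact: enz|exact: ehol]].
  by move=> t ts; rewrite prodX_nil mul1r mulrCA divff ?mulr1// enz.
have as_ : snorm a < s by apply: la; rewrite mem_head.
have [pa|pa] := eqVneq (p a) 0.
  have [p1 p1hol p1E] := holomorphic_divide s0 phol as_.
  have pE t : p t = (t - a) * p1 t by rewrite -p1E pa subr0.
  have [|[H Hhol HE]|[b [c [d [bs c0 d0 H]]]]] := ih p1 p1hol.
  - by move=> b bl; apply: la; rewrite inE bl orbT.
  - by left; exists H => // t ts; rewrite pE HE// prodX_cons !mulrA.
  - right; have [d' d'0 nz] := prodX_neq0_near (a :: l) b.
    exists b, c, (Num.min d d'); split => //; first by rewrite lt_min d0.
    move=> t /andP[t0]; rewrite lt_min => /andP[td td'].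
    have [h1 h2] := H t ltac:(by rewrite t0).
    have := nz t ltac:(by rewrite t0); rewrite prodX_cons mulf_eq0 negb_or => /andP[ta _].
    split; first by rewrite -mulrA mulf_neq0.
    rewrite pE -mulrA !(rnormM (t - a)) mulrCA -mulrA.
    by apply: ler_wpM2l => //; exact: rnorm_ge0.
right; pose q1 t := prodX l t * eta t.
have q1c : {for a, continuous q1}.
  apply: cdiff_cont; apply: cdiffM; first exact: prodX_differentiable.
  exact/ehol/ltW.
have pc : {for a, continuous p} by apply/cdiff_cont/phol/ltW.
have pa0 : 0 < rnorm (p a) / 2 by rewrite divr_gt0// rnorm_gt0.
have [d1 d10 H1] := (continuous_rnormP _ _).1 pc _ pa0.
have [d2 d20 H2] := (continuous_rnormP _ _).1 q1c _ ltr01.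
have [d3 d30 H3] := prodX_neq0_near (a :: l) a.
(* Near [a], [p] is at least half of its value at [a], and [B] bounds the denominator deprived of
   its factor [t - a]. This explains the constant [rnorm (p a) / (2 * B)]. *)
pose B := 1 + rnorm (q1 a).
have B0 : 0 < B by rewrite ltr_wpDr ?rnorm_ge0.
exists a, (rnorm (p a) / (2 * B)), (Num.min (Num.min d1 d2) (Num.min d3 (s - snorm a))).
split => //; first by rewrite divr_gt0 ?rnorm_gt0 ?mulr_gt0.
  by rewrite !lt_min d10 d20 d30 subr_gt0.
move=> t /andP[t0]; rewrite !lt_min => /andP[/andP[td1 td2] /andP[td3 ts]].
have t_s : snorm t <= s.
  have := ler_snormD a (t - a); rewrite addrC subrK.
  by have := snorm_le_rnorm (t - a); lra.
split; first by rewrite mulf_neq0 ?enz// H3// t0.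
have h1 : rnorm (q1 t) <= B.
  have := ler_rnormD (q1 t - q1 a) (q1 a); rewrite subrK => h.
  by apply: le_trans h _; rewrite /B lerD2r ltW// H2.
have h2 : rnorm (p a) / 2 <= rnorm (p t).
  have := ler_rnormD (p a - p t) (p t); rewrite subrK rdistC.
  by have := H1 t td1; lra.
rewrite prodX_cons -mulrA (rnormM (t - a)) mulrCA mulrC.
rewrite ler_wpM2r ?rnorm_ge0//; apply: le_trans h2.
rewrite [leLHS](_ : _ = (rnorm (p a) / 2) * (rnorm (q1 t) / B)); last first.
  by rewrite -/(q1 t); field; rewrite gt_eqF.
by rewrite ler_piMr ?(ltW pa0)// ler_pdivrMr// mul1r.
Qed.

End factorization.

(** * Denominators and Hankel matrices on one slice *)

Section denominator.
Context (R : realType).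
Local Notation C := (R[i]^o).
Implicit Types (f h phi psi eta H : C -> C) (a t : C) (s : R) (l : seq C)
  (p q r c : {poly R[i]}).

Definition rootsX l : {poly R[i]} := \prod_(a <- l) ('X - a%:P).

Lemma horner_rootsX l t : (rootsX l).[t] = prodX l t.
Proof.
rewrite /rootsX horner_prod /prodX; apply: eq_bigr => a _.
by rewrite hornerXsubC.
Qed.

Lemma horner_differentiable p t : differentiable ((fun t => p.[t]) : C -> C) t.
Proof.
elim/poly_ind: p => [|p c ih].
  rewrite (_ : (fun t => _) = fun=> 0); first exact: cdiff_cst.
  by apply/funext => u; rewrite horner0.
rewrite (_ : (fun t => _) = fun t : C => p.[t] * t + c); last first.
  by apply/funext => u; rewrite hornerMXaddC.
by apply: cdiffD; [apply: cdiffM; [exact: ih|exact: cdiff_id]|exact: cdiff_cst].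
Qed.

(** By Cauchy's formula, the moment against the polynomial of the remaining roots is [H a], with [a]
    the first root. So [a] is a zero of [H], and it can be divided out. *)
Lemma moments_divide s H l : 0 < s -> holomorphic_sq s H ->
  (forall a, a \in l -> snorm a < s) ->
  (forall p, cauchy_int s (fun t => H t * (prodX l t)^-1 * p.[t]) = 0) ->
  exists2 H1, holomorphic_sq s H1 & forall t, H t = prodX l t * H1 t.
Proof.
move=> s0; elim: l H => [|a l ih] H Hhol la mom.
  by exists H => // t; rewrite prodX_nil mul1r.
have as_ : snorm a < s by apply: la; rewrite mem_head.
have Ha : H a = 0.
  rewrite -(cauchy_int_formula Hhol as_) -[RHS](mom (rootsX l)).
  apply: eq_cauchy_int => // t ts; rewrite horner_rootsX prodX_cons invfM.
  rewrite -!mulrA mulVf ?mulr1// prodX_eq0; apply/negP => tl.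
  by have := la t; rewrite inE tl orbT ts ltxx => /(_ isT).
have [H1 H1hol H1E] := holomorphic_divide s0 Hhol as_.
have HE t : H t = (t - a) * H1 t by rewrite -H1E Ha subr0.
have [||H2 H2hol H2E] := ih H1 H1hol.
- by move=> b bl; apply: la; rewrite inE bl orbT.
- move=> p; rewrite -[RHS](mom p); apply: eq_cauchy_int => // t ts.
  rewrite HE prodX_cons invfM; congr (_ * _).
  by rewrite mulrACA divff ?mul1r// subr_eq0; apply: contraTneq as_ => <-; rewrite ts ltxx.
by exists H2 => // t; rewrite HE H2E prodX_cons mulrA.
Qed.

(** Euclidean division built as in Newton interpolation: each root [a] adds the constant [H a] to
    the remainder. *)
Lemma holomorphic_modp s H l : 0 < s -> holomorphic_sq s H ->
  (forall a, a \in l -> snorm a < s) ->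
  exists H1 r, [/\ holomorphic_sq s H1, (size r <= size l)%N &
    forall t, H t = prodX l t * H1 t + r.[t]].
Proof.
move=> s0; elim: l H => [|a l ih] H Hhol la.
  by exists H, 0; rewrite size_poly0; split => // t; rewrite prodX_nil mul1r horner0 addr0.
have as_ : snorm a < s by apply: la; rewrite mem_head.
have [H1 H1hol H1E] := holomorphic_divide s0 Hhol as_.
have [|H2 [r [H2hol sr H2E]]] := ih H1 H1hol.
  by move=> b bl; apply: la; rewrite inE bl orbT.
exists H2, (r * ('X - a%:P) + (H a)%:P); split => //.
  have [->|r0] := eqVneq r 0.
    by rewrite mul0r add0r; apply: leq_trans (size_polyC_leq1 _) _.
  apply: leq_trans (size_polyD _ _) _; rewrite geq_max; apply/andP; split.
    by rewrite size_Mmonic ?monicXsubC// size_XsubC addn2.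
  by apply: leq_trans (size_polyC_leq1 _) _.
move=> t; rewrite -[LHS](subrK (H a)) H1E H2E prodX_cons hornerD hornerM hornerXsubC hornerC.
by rewrite [X in X + H a = _]mulrDr addrA !mulrA [_ * (t - a)]mulrC.
Qed.

Section slice.
Variables (s : R) (f h eta : C -> C) (l : seq C).
Hypotheses (s0 : 0 < s) (hhol : holomorphic_sq s h) (etahol : holomorphic_sq s eta)
  (fE : forall t, f t = prodX l t * eta t) (eta0 : forall t, snorm t <= s -> eta t != 0)
  (ls : forall a, a \in l -> snorm a < s).

Definition moment (j : nat) : R[i] :=
  cauchy_int s (fun t => h t * (f t)^-1 * t ^+ j).

Definition hankel k : 'M[R[i]]_k := \matrix_(i, j) moment (i + j).

Let fhol : holomorphic_sq s f.
Proof.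
move=> t ts; rewrite (_ : f = fun t => prodX l t * eta t); last exact/funext.
by apply: cdiffM; [exact: prodX_differentiable|exact: etahol].
Qed.

Let f_contour t : snorm t = s -> f t != 0.
Proof.
move=> ts; rewrite fE mulf_neq0 ?eta0 ?ts// prodX_eq0; apply/negP => /ls.
by rewrite ts ltxx.
Qed.

Let u_cont t : snorm t = s -> {for t, continuous (fun t => h t * (f t)^-1)}.
Proof.
move=> ts; apply: ccontM; first exact: (holomorphic_contour hhol).
by apply: ccontV; [exact: f_contour|exact: (holomorphic_contour fhol)].
Qed.

Let poly_cont p t : {for t, continuous (fun t : C => p.[t] : C)}.
Proof. exact/cdiff_cont/horner_differentiable. Qed.

Let up_cont p t : snorm t = s -> {for t, continuous (fun t => h t * (f t)^-1 * p.[t])}.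
Proof. by move=> ts; apply: ccontM; [exact: u_cont|exact: poly_cont]. Qed.

Definition momentp p : R[i] := cauchy_int s (fun t => h t * (f t)^-1 * p.[t]).

Let momentpD p q : momentp (p + q) = momentp p + momentp q.
Proof.
rewrite /momentp -(cauchy_intD s0 (@up_cont p) (@up_cont q)).
by apply: eq_cauchy_int => // t _; rewrite hornerD mulrDr.
Qed.

Let momentpZ (c : R[i]) q : momentp (c *: q) = c * momentp q.
Proof.
rewrite /momentp -(cauchy_intZ s0 c (@up_cont q)).
by apply: eq_cauchy_int => // t _; rewrite hornerZ mulrCA.
Qed.

Let momentpXn j : momentp 'X^j = moment j.
Proof. by apply: eq_cauchy_int => // t _; rewrite hornerXn. Qed.

Let momentp_sum k (F : 'I_k -> {poly R[i]}) :
  momentp (\sum_i F i) = \sum_i momentp (F i).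
Proof.
have m0 : momentp 0 = 0 by rewrite -(scale0r (0 : {poly R[i]})) momentpZ mul0r.
exact: (big_morph momentp momentpD m0).
Qed.

Lemma momentpE k p j : (size p <= k)%N ->
  momentp (p * 'X^j) = \sum_(i < k) p`_i * moment (i + j).
Proof.
move=> pk; have pE : p = \sum_(i < k) p`_i *: 'X^i.
  rewrite -poly_def; apply/polyP => i; rewrite coef_poly; case: ltnP => // ki.
  by rewrite nth_default// (leq_trans pk).
rewrite {1}pE mulr_suml momentp_sum; apply: eq_bigr => i _.
by rewrite -scalerAl momentpZ -exprD momentpXn.
Qed.

(* [c] is a denominator of [h / f]. *)
Definition in_denom (c : C -> C) : Prop :=
  exists2 al, holomorphic_sq s al & forall t, snorm t <= s -> c t * h t = f t * al t.

Lemma in_denom_momentp c q : in_denom (fun t => c.[t]) -> momentp (c * q) = 0.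
Proof.
move=> [al alhol alE]; rewrite /momentp.
rewrite -(@cauchy_int_holomorphic _ s s0 (fun t => al t * q.[t])); last first.
  by move=> t ts; apply: cdiffM; [exact: alhol|exact: horner_differentiable].
apply: eq_cauchy_int => // t ts; rewrite hornerM mulrA; congr (_ * _).
have fn := f_contour ts.
rewrite mulrC mulrA alE ?ts// -?mulrA mulrC -mulrA mulVf ?mulr1//.
Qed.

(** With the converse above, this turns being a polynomial denominator into linear equations on the
    moments. *)
Lemma momentp_in_denom c : (forall q, momentp (c * q) = 0) -> in_denom (fun t => c.[t]).
Proof.
move=> mom; pose H t := c.[t] * h t * (eta t)^-1.
have Hhol : holomorphic_sq s H.
  move=> t ts; apply: cdiffM; last by apply: cdiffV; [exact: eta0|exact: etahol].
  by apply: cdiffM; [exact: horner_differentiable|exact: hhol].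
have [|H1 H1hol H1E] := moments_divide s0 Hhol ls.
  move=> p; rewrite -[RHS](mom p); apply: eq_cauchy_int => // t ts.
  rewrite hornerM fE /H invfM; ring.
exists H1 => // t ts; rewrite fE mulrAC -H1E /H mulfVK// eta0//.
Qed.

(* The denominators of [h / f] form the ideal of [prodX d], and [size d] is the rank of the Hankel matrices (Kronecker). *)
Theorem slice_denominator : exists d : seq C,
  [/\ (size d <= size l)%N /\ (forall a, a \in d -> a \in l),
   in_denom (prodX d),
   forall g, holomorphic_sq s g -> in_denom g ->
     exists2 ga, holomorphic_sq s ga & forall t, snorm t <= s -> g t = prodX d t * ga t,
   \det (hankel (size d)) != 0 /\ (forall k, (size d < k)%N -> \det (hankel k) = 0) &
   forall j, \sum_(i < (size d).+1) (rootsX d)`_i * moment (i + j) = 0].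
Proof.
pose I c := in_denom (fun t => c.[t]).
have rootsX_neq0 k : rootsX k != 0 by apply/monic_neq0/monic_prod_XsubC.
have size_rootsX k : size (rootsX k) = (size k).+1 by rewrite /rootsX size_prod_XsubC.
have IP : I (rootsX l).
  exists (fun t => h t * (eta t)^-1).
    by move=> t ts; apply: cdiffM; [exact: hhol|apply: cdiffV; [exact: eta0|exact: etahol]].
  move=> t ts; rewrite horner_rootsX fE -mulrA; congr (_ * _).
  by rewrite mulrCA divff ?mulr1// eta0.
have ImulB c q q' d : I c -> I d -> I (c * q - d * q').
  move=> [a1 h1 e1] [a2 h2 e2]; exists (fun t => a1 t * q.[t] - a2 t * q'.[t]).
    move=> t ts; apply: cdiffB; apply: cdiffM; by [exact: h1|exact: h2|exact: horner_differentiable].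
  move=> t ts; rewrite hornerD hornerN !hornerM mulrBl mulrBr.
  by rewrite [_ * q.[t] * _]mulrAC e1// [_ * q'.[t] * _]mulrAC e2// !mulrA.
(* A nonzero polynomial denominator of least size generates the others, by Euclidean division. *)
pose Q k := `[< exists c, [/\ c != 0, I c & size c = k] >].
have exQ : exists k, Q k by exists (size (rootsX l)); apply/asboolP; exists (rootsX l).
case: (ex_minnP exQ) => k0 /asboolP[c0 [c0n Ic0 sc0]] minQ.
have Imin c : I c -> c != 0 -> (k0 <= size c)%N.
  by move=> Ic cn; apply: minQ; apply/asboolP; exists c.
have c0dvd c : I c -> c0 %| c.
  move=> Ic; rewrite /dvdp; apply: contraT => cn.
  have Ir : I (c %% c0).
    have := ImulB c 1 (c %/ c0) c0 Ic Ic0; congr I.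
    by apply/eqP; rewrite mulr1 subr_eq {1}(divp_eq c c0) addrC mulrC.
  by have := Imin _ Ir cn; rewrite -sc0 leqNgt ltn_modp c0n.
(* A divisor of a split polynomial is, up to a scalar, the product over a subsequence of its
   roots. *)
have [m c0m] := dvdp_prod_XsubC (c0dvd _ IP).
pose d := mask m l; have dl a : a \in d -> a \in l := @mem_mask _ a m l.
have sd : (size d).+1 = k0 by rewrite -sc0 -size_rootsX; apply/esym/eqp_size.
have Id : I (rootsX d).
  have /eqpP[[u v] /= /andP[u0 v0] E] := c0m.
  have := ImulB c0 (v^-1 * u)%:P 0 c0 Ic0 Ic0; congr I.
  rewrite mulr0 subr0 mulrC mul_polyC -scalerA E scalerA mulVf// scale1r.
  by [].
have small c : I c -> (size c <= size d)%N -> c = 0.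
  by move=> Ic sc; apply/eqP/contraT => /(Imin _ Ic); rewrite -sd ltnNge sc.
have Id' : in_denom (prodX d) by move: Id => [al ah aE]; exists al => // t; rewrite -horner_rootsX; exact: aE.
have moments0 j : \sum_(i < (size d).+1) (rootsX d)`_i * moment (i + j) = 0.
  by rewrite -momentpE ?size_rootsX//; exact: in_denom_momentp.
exists d; split => //.
- by split => //; exact: (size_subseq (mask_subseq m l)).
- move=> g ghol [be behol beE].
  (* The remainder is again a denominator, of too small a size, hence zero. *)
  have [|ga [r [gahol sr gE]]] := holomorphic_modp (l := d) s0 ghol.
    by move=> a /dl; exact: ls.
  have [al alhol alE] := Id'.
  have Ir : I r.
    exists (fun t => be t - ga t * al t).
      by move=> t ts; apply: cdiffB; [exact: behol|apply: cdiffM; [exact: gahol|exact: alhol]].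
    move=> t ts; have -> : r.[t] = g t - prodX d t * ga t by rewrite gE [X in X - _]addrC addrK.
    by rewrite mulrBl beE// mulrBr; congr (_ - _); rewrite mulrAC alE// mulrAC mulrA.
  exists ga => // t _; rewrite gE (small r Ir sr) horner0 addr0//.
- split.
    (* A kernel vector is a polynomial [c] whose moments against small powers vanish. Reducing any
       polynomial modulo [rootsX d] extends this to all of them, so [c] is a denominator of too
       small a size. *)
    apply/negP => /det0P[v vn0 vH].
    pose c := rVpoly v.
    have sc : (size c <= size d)%N by rewrite size_poly.
    have cn : c != 0 by apply: contra vn0 => /eqP c0E; rewrite -(rVpolyK v) -/c c0E linear0.
    have low j : (j < size d)%N -> momentp (c * 'X^j) = 0.
      move=> jd; rewrite (momentpE j sc).
      have /rowP/(_ (Ordinal jd)) := vH; rewrite !mxE => vHj; rewrite -[RHS]vHj.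
      by apply: eq_bigr => i _; rewrite mxE /c coef_rVpoly_ord.
    have lowp q : (size q <= size d)%N -> momentp (c * q) = 0.
      move=> sq; have -> : q = \sum_(i < size d) q`_i *: 'X^i.
        rewrite -poly_def; apply/polyP => i; rewrite coef_poly; case: ltnP => // ki.
        by rewrite nth_default// (leq_trans sq).
      rewrite mulr_sumr momentp_sum big1// => i _.
      by rewrite -scalerAr momentpZ low// mulr0.
    have Ic : I c.
      apply: momentp_in_denom => q; rewrite (divp_eq q (rootsX d)) mulrDr momentpD.
      rewrite (lowp (q %% rootsX d)); last first.
        by rewrite -ltnS -(size_rootsX d) ltn_modp rootsX_neq0.
      rewrite addr0 [_ * rootsX d]mulrC mulrCA; exact: in_denom_momentp.
    by move: cn; rewrite (small c Ic sc) eqxx.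
  (* The coefficients of the denominator, padded with zeros, are in the kernel; as [size d < k], the
     row contains the leading coefficient 1. *)
  move=> k dk; apply/eqP/det0P; exists (\row_(i < k) (rootsX d)`_i).
    apply/eqP => /rowP/(_ (Ordinal dk)); rewrite !mxE /=.
    have := monic_prod_XsubC d xpredT id; rewrite monicE /lead_coef size_rootsX.
    by rewrite -/(rootsX d) => /eqP -> /eqP; rewrite oner_eq0.
  apply/rowP => j; rewrite !mxE -[RHS](@in_denom_momentp _ 'X^j Id).
  rewrite (@momentpE k) ?size_rootsX//.
  by apply: eq_bigr => i _; rewrite !mxE.
Qed.

End slice.
End denominator.

(** * Several complex variables *)

Section several_variables.
Context (R : realType) (V : normedModType R[i]).
Local Notation C := (R[i]^o).
Implicit Types (f F : V -> C) (a v w h : V) (s d M : R).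

Lemma line_continuous a v (t : C) : {for t, continuous (fun t : C => a + t *: v)}.
Proof.
apply/continuous_rnormP => e e0; have v1 : 0 < rnorm v + 1 by rewrite ltr_wpDl ?rnorm_ge0.
exists (e / (rnorm v + 1)); first exact: divr_gt0.
move=> u; rewrite ltr_pdivlMr// => ut.
rewrite opprD addrACA subrr add0r -scalerBl rnormZ.
apply: le_lt_trans ut; apply: ler_wpM2l; first exact: rnorm_ge0.
by rewrite lerDl.
Qed.

Definition scal v (t : C) : V := t *: v.

Lemma scal_is_linear v : linear (scal v).
Proof. by move=> k x y; rewrite /scal scalerDl scalerA. Qed.

HB.instance Definition _ v :=
  GRing.isLinear.Build R[i] C V *:%R (scal v) (scal_is_linear v).

Lemma line_differentiable a v (t : C) :
  differentiable (fun t : C => a + t *: v) t /\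
  'd (fun t : C => a + t *: v) t = scal v :> (C -> V).
Proof.
have sc : continuous (scal v).
  move=> u; rewrite (_ : scal v = (fun t : C => 0 + t *: v)); last first.
    by apply/funext => x; rewrite add0r.
  exact: line_continuous.
apply: (@quadratic_differentiable R C V _ t (scal v) 0 1 sc ltr01) => h _.
by rewrite mul0r /scal scalerDl addrA [_ + h *: v]addrC addrK subrr rnorm0.
Qed.

Lemma slice_differentiable f a v (t : C) : differentiable f (a + t *: v) ->
  differentiable (fun t : C => f (a + t *: v)) t /\
  'd (fun t : C => f (a + t *: v)) t 1 = 'd f (a + t *: v) v.
Proof.
move=> fd; have [ld dl] := line_differentiable a v t.
split; first exact: (differentiable_comp ld fd).
have -> : 'd (fun t : C => f (a + t *: v)) t = 'd f (a + t *: v) \o 'd (fun t : C => a + t *: v) t :> (C -> C).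
  exact: (diff_comp ld fd).
by rewrite /= dl /scal scale1r.
Qed.

Section estimates.
Variables (f : V -> C) (a : V) (d M : R).
Hypotheses (d0 : 0 < d)
  (fd : forall y, rnorm (y - a) < d -> differentiable f y /\ rnorm (f y) <= M).

Let M0 : 0 <= M.
Proof.
apply: le_trans (rnorm_ge0 _) (fd (y := a) _).2.
by rewrite subrr rnorm0.
Qed.

(** The estimate in one variable on the complex line through [a] directed by [h], on a square of
    half-side [d / 4]: [8 * M / (d / 4) ^+ 2] is the constant. *)
Lemma several_quadratic h : rnorm h <= d / 8 ->
  rnorm (f (a + h) - f a - 'd f a h) <= 128 * M / d ^+ 2 * rnorm h ^+ 2.
Proof.
have [->|h0] := eqVneq h 0.
  by move=> _; rewrite addr0 subrr linear0 subrr !rnorm0 expr0n /= mulr0 lexx.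
move=> hd; set r := rnorm h in hd *; have r0 : 0 < r by rewrite rnorm_gt0.
pose k := (r^-1)%:C *: h.
have k1 : rnorm k = 1.
  by rewrite rnormZ rnorm_real ger0_norm ?invr_ge0 ?(ltW r0)// mulVf// gt_eqF.
have kE : (r%:C : C) *: k = h by rewrite scalerA -rmorphM /= mulfV ?gt_eqF// scale1r.
have in_ball (t : C) : snorm t <= d / 4 -> rnorm (a + t *: k - a) < d.
  move=> td; rewrite addrAC subrr add0r rnormZ k1 mulr1.
  by apply: le_lt_trans (rnorm_le_snorm t) _; lra.
have [_ dE] := @slice_differentiable f a k 0 (fd (in_ball 0 ltac:(by rewrite snorm0; lra))).1.
have s0 : 0 < d / 4 by lra.
have hol : holomorphic_sq (d / 4) (fun t : C => f (a + t *: k)).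
  by move=> t td; apply: (slice_differentiable (fd (in_ball t td)).1).1.
have bd (t : C) : snorm t = d / 4 -> rnorm (f (a + t *: k)) <= M.
  by move=> td; apply: (fd (in_ball t _)).2; rewrite td.
have sr : snorm (r%:C : C) <= d / 4 / 2.
  by rewrite /snorm /= normr0 ger0_norm ?(ltW r0)// /Num.max ltNge (ltW r0)/=; lra.
have := holomorphic_quadratic s0 hol bd sr.
rewrite dE kE scale0r addr0 rnorm_real ger0_norm ?(ltW r0)//.
have dk : 'd f a ((r%:C : C) *: k) = r%:C * 'd f a k by exact: linearZ.
rewrite -dk kE.
move=> /le_trans; apply; rewrite le_eqVlt; apply/orP; left; apply/eqP.
by field; rewrite gt_eqF.
Qed.

(** For a vector of norm [d / 8] the quadratic remainder is at most [2 * M] and so is the increment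
    of [f]; the general case follows by scaling. *)
Lemma ler_rnorm_diff h : rnorm ('d f a h) <= 32 * M / d * rnorm h.
Proof.
have dpos : 0 < d := d0.
have [->|h0] := eqVneq h 0; first by rewrite linear0 !rnorm0 mulr0.
set r := rnorm h; have r0 : 0 < r by rewrite rnorm_gt0.
pose c : R := d / 8 / r; have c0 : 0 < c by rewrite !divr_gt0.
pose k := (c%:C : C) *: h.
have kn : rnorm k = d / 8.
  by rewrite rnormZ rnorm_real ger0_norm ?(ltW c0)// /c divfK// gt_eqF.
have := several_quadratic (h := k); rewrite kn => /(_ (lexx _)).
have fa := (fd (y := a) ltac:(by rewrite subrr rnorm0)).2.
have fk : rnorm (f (a + k)) <= M.
  by apply: (fd _).2; rewrite addrAC subrr add0r kn; lra.
pose z : C := c%:C * 'd f a h.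
have -> : 'd f a k = z by exact: linearZ.
rewrite [X in _ <= X -> _](_ : _ = 2 * M); last by field; rewrite gt_eqF.
move=> hq.
have h1 : rnorm z <= 4 * M.
  rewrite -(subKr (f (a + k) - f a) z).
  apply: le_trans (ler_rnormB _ _) _.
  have := ler_rnormB (f (a + k)) (f a); lra.
move: h1; rewrite /z rnormM rnorm_real ger0_norm ?(ltW c0)// mulrC -ler_pdivlMr//.
move=> /le_trans; apply; rewrite le_eqVlt; apply/orP; left; apply/eqP.
by rewrite /c; field; rewrite !gt_eqF.
Qed.

(** [48] is [128 / 8 + 32]: the remainder, made linear by the bound on [h], plus the
    differential. *)
Lemma several_lipschitz h : rnorm h <= d / 8 ->
  rnorm (f (a + h) - f a) <= 48 * M / d * rnorm h.
Proof.
move=> hd; have h1 := several_quadratic hd; have h2 := ler_rnorm_diff h.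
have := ler_rnormD (f (a + h) - f a - 'd f a h) ('d f a h); rewrite subrK.
move=> /le_trans; apply; apply: le_trans (lerD h1 h2) _.
have -> : 128 * M / d ^+ 2 * rnorm h ^+ 2 + 32 * M / d * rnorm h =
  (128 * (rnorm h / d) + 32) * (M / d * rnorm h) by field; rewrite gt_eqF.
have -> : 48 * M / d * rnorm h = 48 * (M / d * rnorm h) by field; rewrite gt_eqF.
apply: ler_wpM2r; first by rewrite mulr_ge0 ?rnorm_ge0 ?divr_ge0 ?(ltW d0).
have : rnorm h / d <= 8^-1 by rewrite ler_pdivrMr//; lra.
by lra.
Qed.

End estimates.

(** The differential is approximated, uniformly near [a], by difference quotients of a fixed step
    [tau], and these are Lipschitz in the base point. *)
Lemma diff_continuous_at f a d M h : 0 < d ->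
  (forall y, rnorm (y - a) < d -> differentiable f y /\ rnorm (f y) <= M) ->
  {for a, continuous (fun y => 'd f y h : C)}.
Proof.
move=> d0 fd; apply/continuous_rnormP => e e0.
have M0 : 0 <= M.
  by apply: le_trans (rnorm_ge0 _) (fd a _).2; rewrite subrr rnorm0.
have d20 : 0 < d / 2 by lra.
have fd' b : rnorm (b - a) < d / 2 -> forall y, rnorm (y - b) < d / 2 ->
    differentiable f y /\ rnorm (f y) <= M.
  move=> ba y yb; apply: fd; have := ler_rnormD (y - b) (b - a).
  by rewrite subrKA; lra.
pose Q := 128 * M / (d / 2) ^+ 2 * rnorm h ^+ 2.
have Q0 : 0 <= Q by rewrite !mulr_ge0 ?invr_ge0 ?exprn_ge0 ?rnorm_ge0 ?(ltW d20).
pose L := 48 * M / (d / 2).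
have L0 : 0 <= L by rewrite !mulr_ge0 ?invr_ge0 ?(ltW d20).
have h1 : 0 < rnorm h + 1 by rewrite ltr_wpDl ?rnorm_ge0.
(* The second bound makes the quadratic remainder at most [tau * e / 4], hence an error of at most
   [e / 4] in each difference quotient. *)
pose tau : R := Num.min (d / 32 / (rnorm h + 1)) (e / (4 * (Q + 1))).
have Q1 : 0 < Q + 1 by rewrite ltr_wpDl.
have tau0 : 0 < tau by rewrite /tau lt_min !divr_gt0// mulr_gt0.
have th : rnorm ((tau%:C : C) *: h) = tau * rnorm h.
  by rewrite rnormZ rnorm_real ger0_norm ?ltW.
have th1 : tau * rnorm h <= d / 32.
  have : tau * (rnorm h + 1) <= d / 32 by rewrite -ler_pdivlMr// /tau ge_min lexx.
  by nra.
have tQ : tau * Q <= e / 4.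
  have : tau * (4 * (Q + 1)) <= e by rewrite -ler_pdivlMr ?mulr_gt0// /tau ge_min lexx orbT.
  by nra.
have approx b : rnorm (b - a) < d / 2 ->
    rnorm ((f (b + (tau%:C : C) *: h) - f b) - tau%:C * 'd f b h) <= Q * tau ^+ 2.
  move=> ba; have := several_quadratic d20 (fd' b ba) (h := (tau%:C : C) *: h).
  rewrite th linearZ => /(_ ltac:(lra)) /le_trans; apply.
  by rewrite le_eqVlt /Q; apply/orP; left; apply/eqP; rewrite exprMn; ring.
(* [del] depends on [tau]: the variation of [f] must be small even after division by the step. *)
pose del := Num.min (d / 32) (tau * e / (8 * (L + 1))).
have L1 : 0 < L + 1 by rewrite ltr_wpDl.
exists del; first by rewrite lt_min !divr_gt0 ?mulr_gt0.
move=> b; rewrite lt_min => /andP[bd1 bd2].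
have bL : L * rnorm (b - a) <= tau * e / 8.
  move: bd2; rewrite ltr_pdivlMr ?mulr_gt0// => bd2.
  by have := rnorm_ge0 (b - a); nra.
have a0 : rnorm (a - a) < d / 2 by rewrite subrr rnorm0.
have A1 := approx a a0; have A2 := approx b ltac:(lra).
have B1 := several_lipschitz d20 (fd' a a0) (h := b - a) ltac:(lra).
rewrite [a + _]addrC subrK -/L in B1.
have at0 : rnorm (a + (tau%:C : C) *: h - a) < d / 2.
  by rewrite addrAC subrr add0r th; lra.
have B2 := several_lipschitz d20 (fd' _ at0) (h := b - a) ltac:(lra).
rewrite addrAC [a + (b - a)]addrC subrK -/L in B2.
set X1 := f (b + _) in A2 B2; set Y1 := f (a + _) in A1 B2.
pose Z : C := tau%:C * ('d f b h - 'd f a h).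
have : rnorm Z <= 2 * (Q * tau ^+ 2) + 2 * (L * rnorm (b - a)).
  have -> : Z = (Y1 - f a - tau%:C * 'd f a h) -
    (X1 - f b - tau%:C * 'd f b h) + ((X1 - Y1) - (f b - f a)) by rewrite /Z; ring.
  apply: le_trans (ler_rnormD _ _) _; apply: lerD.
    by apply: le_trans (ler_rnormB _ _) _; lra.
  by apply: le_trans (ler_rnormB _ _) _; lra.
rewrite /Z rnormM rnorm_real ger0_norm ?(ltW tau0)// => fin.
rewrite -(ltr_pM2l tau0); apply: le_lt_trans fin _.
have : Q * tau ^+ 2 <= tau * (e / 4) by rewrite expr2 mulrCA ler_wpM2l ?(ltW tau0)// mulrC.
have : 0 < tau * e by rewrite mulr_gt0.
by lra.
Qed.

End several_variables.

(** * Differentiation under the contour integral *)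

Section parameter_integral.
Context (R : realType) (V : normedModType R[i]).
Local Notation C := (R[i]^o).
Implicit Types (f F : V -> C) (a v w h : V) (s d M : R).

(** [d] and [M] are common to the whole contour, so the quadratic remainder of [F] is uniform and
    can be integrated. The candidate differential is the integral of ['d F], whose integrand is
    continuous by [diff_continuous_at]. *)
Theorem cauchy_int_differentiable F v w s d M (ka : C -> C) : 0 < s -> 0 < d ->
  (forall t : C, snorm t = s -> {for t, continuous ka}) ->
  (forall t : C, snorm t = s -> forall y, rnorm (y - (w + t *: v)) < d ->
    differentiable F y /\ rnorm (F y) <= M) ->
  differentiable (fun w => cauchy_int s (fun t => F (w + t *: v) * ka t)) w.
Proof.
move=> s0 d0 kac Fd.
have [B B0 kaB] := contour_bounded s0 kac.
have M0 : 0 <= M.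
  pose t0 := Complex s 0 : C.
  have ts : snorm t0 = s by rewrite /snorm /= normr0 ger0_norm ?ltW// /Num.max ltNge ltW.
  by apply: le_trans (rnorm_ge0 _) (Fd t0 ts (w + t0 *: v) _).2; rewrite subrr rnorm0.
have Fdt (h : V) (t : C) : snorm t = s -> rnorm h < d -> differentiable F (w + h + t *: v).
  move=> ts hd; apply: (Fd t ts _ _).1.
  by rewrite -[w + h + _]addrA [h + _]addrC addrA [_ + h]addrC addrK.
have Fc (h : V) (t : C) : snorm t = s -> rnorm h < d ->
    {for t, continuous (fun t : C => F (w + h + t *: v) * ka t)}.
  move=> ts hd; apply: ccontM; last exact: kac.
  by apply: cdiff_cont; apply: (slice_differentiable (Fdt h t ts hd)).1.
have F0 (t : C) : snorm t = s -> {for t, continuous (fun t : C => F (w + t *: v) * ka t)}.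
  by move=> ts; have := Fc 0 t ts; rewrite rnorm0 addr0; apply.
have dc (h : V) (t : C) : snorm t = s ->
    {for t, continuous (fun t : C => 'd F (w + t *: v) h * ka t)}.
  move=> ts; apply: ccontM; last exact: kac.
  have /continuous_rnormP gc := diff_continuous_at (h := h) d0 (Fd t ts).
  apply/continuous_rnormP => e /gc[e' e'0 ge].
  have [e2 e20 le2] := (continuous_rnormP _ _).1 (@line_continuous _ _ w v t) _ e'0.
  by exists e2 => // y /le2 /ge.
pose D (h : V) : C := cauchy_int s (fun t => 'd F (w + t *: v) h * ka t).
have Dlin : linear D.
  move=> k x y; rewrite -[k *: D x]/(k * D x) /D -(cauchy_intZ s0 k (dc x)).
  have kc (t : C) : snorm t = s -> {for t, continuous (fun t : C => (k : C) * ('d F (w + t *: v) x * ka t))}.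
    by move=> ts; apply: ccontM; [exact: ccont_cst|exact: dc].
  rewrite -(cauchy_intD s0 kc (dc y)); apply: eq_cauchy_int => // t _.
  by rewrite linearP mulrDl mulrA.
have DB h : rnorm (D h) <= 4 * s * (32 * M / d * B) * rnorm h.
  rewrite -mulrA; apply: (ler_rnorm_cauchy_int s0); first exact: dc.
  move=> t ts; rewrite rnormM mulrAC; apply: ler_pM; rewrite ?rnorm_ge0 ?kaB//.
  exact: ler_rnorm_diff d0 (Fd t ts) h.
pose DL : {linear V -> C} := HB.pack D (GRing.isLinear.Build _ _ _ _ D Dlin).
have Dcont : continuous DL.
  move=> x; apply/continuous_rnormP => e e0.
  pose B' := 4 * s * (32 * M / d * B).
  have B'0 : 0 <= B' by rewrite !mulr_ge0 ?invr_ge0 ?(ltW s0) ?(ltW d0) ?(ltW B0).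
  have B'1 : 0 < B' + 1 by rewrite ltr_wpDl.
  exists (e / (B' + 1)); first exact: divr_gt0.
  move=> y; rewrite ltr_pdivlMr// => yx; rewrite -linearB.
  apply: le_lt_trans (DB _) _; rewrite -/B'.
  by have := rnorm_ge0 (y - x); nra.
have d80 : 0 < d / 8 by lra.
apply: (@quadratic_differentiable R V C _ w DL (4 * s * (128 * M / d ^+ 2 * B)) (d / 8) Dcont d80 _).1.
move=> h hd8; have hd : rnorm h < d by lra.
have cB (t : C) : snorm t = s -> {for t, continuous (fun t : C =>
    F (w + h + t *: v) * ka t - F (w + t *: v) * ka t)}.
  by move=> ts; apply: ccontB; [exact: Fc|exact: F0].
rewrite -[DL h]/(D h) /D -(cauchy_intB s0 (fun t ts => Fc h t ts hd) F0) -(cauchy_intB s0 cB (dc h)).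
rewrite -[leRHS]mulrA; apply: (ler_rnorm_cauchy_int s0).
  by move=> t ts; apply: ccontB; [exact: cB|exact: dc].
move=> t ts; rewrite -!mulrBl rnormM mulrAC; apply: ler_pM; rewrite ?rnorm_ge0 ?kaB//.
rewrite [w + h + _]addrAC.
exact: (several_quadratic d0 (Fd t ts) (ltW hd8)).
Qed.

End parameter_integral.

(** * Slices in a good direction, and division by a bounded quotient *)

Section local_division.
Context (R : realType) (V : normedModType R[i]).
Local Notation C := (R[i]^o).
Implicit Types (f p : V -> C) (a v w z : V) (s d r m M B : R).

Lemma near0P (P : V -> Prop) : (\forall w \near (0 : V), P w) <->
  exists2 r : R, 0 < r & forall w, rnorm w < r -> P w.
Proof.
split=> [/nbhs_rnormP[r r0 H]|[r r0 H]].
  by exists r => // w wr; apply: H; rewrite subr0.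
by apply/nbhs_rnormP; exists r => // w; rewrite subr0; exact: H.
Qed.

Lemma near_bounded f : {for 0, continuous f} ->
  exists M, \forall w \near (0 : V), rnorm (f w) <= M.
Proof.
move=> /continuous_rnormP/(_ 1 ltr01)[d d0 H].
exists (1 + rnorm (f 0)); apply/near0P; exists d => // w wd.
have := H w; rewrite subr0 => /(_ wd) h.
by have := ler_rnormD (f w - f 0) (f 0); rewrite subrK; lra.
Qed.

(** For all small [w], the zeros of [f] on the slice [w + t *: v] stay in the inner square of
    half-side [s / 9], as [zeros_bound] asks, and [f] is bounded below on the contour by a constant
    common to all these slices. *)
Definition good_direction f v s r m (rho : R) : Prop :=
  [/\ 0 < s, 0 < r, 0 < m & forall w (t : C), rnorm w < r -> snorm t <= s ->
   rnorm (w + t *: v) < rho /\ (s / 9 <= snorm t -> m <= rnorm (f (w + t *: v)))].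

(** In the direction of a point where [f] does not vanish, [f] has a finite order [k] at the origin,
    hence a lower bound on a small ring. The Lipschitz estimate carries this bound to the
    neighbouring slices. *)
Lemma exists_good_direction f (rho M : R) : 0 < rho ->
  (forall w, rnorm w < rho -> differentiable f w /\ rnorm (f w) <= M) ->
  ~ (\forall w \near (0 : V), f w = 0) ->
  exists v s r m, good_direction f v s r m rho.
Proof.
move=> rho0 fd fn0.
have M0 : 0 <= M.
  by apply: le_trans (rnorm_ge0 _) (fd 0 _).2; rewrite rnorm0.
(* So close to 0 that the square of half-side 9 in the direction [z] fits in the ball; in it, the
   parameter 1 of the point [z] is in the inner ninth. *)
have [z zr fz] : exists2 z, rnorm z < rho / 100 & f z != 0.
  apply: contrapT => h; apply: fn0; apply/near0P; exists (rho / 100); first by lra.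
  by move=> w wr; apply/eqP/negPn/negP => fw; apply: h; exists w.
have tz (t : C) (S : R) : snorm t <= S -> rnorm (t *: z) <= S * (rho / 50).
  move=> tS; rewrite rnormZ.
  have := rnorm_le_snorm t; have := snorm_ge0 t; have := rnorm_ge0 z; nra.
pose phi (t : C) := f (0 + t *: z).
have hol : holomorphic_sq 9 phi.
  move=> t t9; apply: (slice_differentiable (fd _ _).1).1.
  by rewrite add0r; apply: le_lt_trans (tz t 9 t9) _; lra.
have n1 : snorm (1 : C) <= 9 / 9.
  by rewrite /snorm /= normr0 normr1 /Num.max ltr10; lra.
have [//||k [eta [ehol E e0]]] := @order_at0 R 9 phi 1 _ hol n1.
  by rewrite /phi add0r scale1r.
have ec : {for 0, continuous eta} by apply/cdiff_cont/ehol; rewrite snorm0.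
have e20 : 0 < rnorm (eta 0) / 2 by rewrite divr_gt0// rnorm_gt0.
have [d d0 dP] := (continuous_rnormP _ _).1 ec _ e20.
pose s := Num.min 1 (d / 4); have s0 : 0 < s by rewrite lt_min ltr01 divr_gt0.
have s1 : s <= 1 by rewrite /s ge_min lexx.
have sd : s <= d / 4 by rewrite /s ge_min lexx orbT.
(* The lower bound on the slice through 0 is [2 * m]; half of it is spent on moving to [w]. *)
pose m := (s / 9) ^+ k * (rnorm (eta 0) / 2) / 2.
have m0 : 0 < m by rewrite divr_gt0// mulr_gt0// exprn_gt0// divr_gt0.
have lowb (t : C) : s / 9 <= snorm t <= s -> 2 * m <= rnorm (f (t *: z)).
  move=> /andP[t9 ts]; have := E t; rewrite /phi add0r => ->.
  rewrite rnormM rnormX /m [2 * _]mulrC divfK//.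
  apply: ler_pM; rewrite ?exprn_ge0 ?divr_ge0 ?rnorm_ge0 ?(ltW s0)//.
    rewrite lerXn2r ?nnegrE ?rnorm_ge0 ?divr_ge0 ?(ltW s0)//.
    exact: le_trans t9 (snorm_le_rnorm t).
  have td : rnorm (t - 0) < d by rewrite subr0; apply: le_lt_trans (rnorm_le_snorm t) _; lra.
  have := ler_rnormD (eta 0 - eta t) (eta t); rewrite subrK rdistC.
  by have := dP t td; lra.
have d20 : 0 < rho / 2 by lra.
pose L := 48 * M / (rho / 2).
have L0 : 0 <= L by rewrite mulr_ge0 ?invr_ge0 ?(ltW d20)// mulr_ge0.
have L1 : 0 < L + 1 by rewrite ltr_wpDl.
exists z, s, (Num.min (rho / 16) (m / (L + 1))), m; split => //.
  by rewrite lt_min; apply/andP; split; [lra|exact: divr_gt0].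
move=> w t; rewrite lt_min => /andP[wr1 wr2] ts.
have tzs : rnorm (t *: z) <= rho / 50.
  by apply: le_trans (tz t s ts) _; rewrite ler_piMl//; lra.
split; first by have := ler_rnormD w (t *: z); lra.
move=> t9; have fd' y : rnorm (y - t *: z) < rho / 2 -> differentiable f y /\ rnorm (f y) <= M.
  move=> yt; apply: fd; have := ler_rnormD (y - t *: z) (t *: z); rewrite subrK; lra.
have := several_lipschitz d20 fd' (h := w) ltac:(lra).
rewrite -/L [t *: z + w]addrC => h.
have := lowb t ltac:(by rewrite t9 ts).
have := ler_rnormD (f (t *: z) - f (w + t *: z)) (f (w + t *: z)); rewrite subrK rdistC.
move: wr2; rewrite ltr_pdivlMr// => wr2.
have : L * rnorm w <= m by have := rnorm_ge0 w; nra.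
by lra.
Qed.

Section direction.
Variables (f : V -> C) (v : V) (s r m rho M : R).
Hypotheses (gd : good_direction f v s r m rho)
  (fd : forall w, rnorm w < rho -> differentiable f w /\ rnorm (f w) <= M).

Let s0 : 0 < s. Proof. by case: gd. Qed.

Lemma line_in_ball w (t : C) : rnorm w < r -> snorm t <= s -> rnorm (w + t *: v) < rho.
Proof. by move=> wr ts; have [_ _ _ /(_ w t wr ts)[]] := gd. Qed.

Lemma slice_lower w (t : C) : rnorm w < r -> snorm t = s -> m <= rnorm (f (w + t *: v)).
Proof.
move=> wr ts; have [s0' _ _ /(_ w t wr)[]] := gd; first by rewrite ts.
by move=> _; apply; rewrite ts; lra.
Qed.

Lemma slice_holomorphic (p : V -> C) w : (forall w, rnorm w < rho -> differentiable p w) ->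
  rnorm w < r -> holomorphic_sq s (fun t => p (w + t *: v)).
Proof.
by move=> pd wr t ts; apply: (slice_differentiable (pd _ (line_in_ball wr ts))).1.
Qed.

Let fhol w (wr : rnorm w < r) : holomorphic_sq s (fun t => f (w + t *: v)) :=
  slice_holomorphic (fun w h => (fd h).1) wr.

(** The common bound [N] limits the orders of the Hankel determinants that have to be considered. *)
Lemma slices_factor : exists N : nat, forall w, rnorm w < r ->
  exists l eta, [/\ forall a : C, a \in l -> snorm a < s / 9, holomorphic_sq s eta,
    forall t, f (w + t *: v) = prodX l t * eta t,
    forall t, snorm t <= s -> eta t != 0 & (size l <= N)%N].
Proof.
have [_ r0 m0 gdP] := gd.
have [N NP] := @size_zeros_bound R s m M s0 m0.
exists N => w wr; have spos : 0 < s := s0.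
have [|l [eta [la ehol E e0]]] := holomorphic_factor s0 (fhol wr).
  move=> t /andP[t9 ts]; rewrite -rnorm_gt0; apply: lt_le_trans m0 _.
  by apply: (gdP w t wr ts).2.
exists l, eta; split => //; apply: NP ehol E la _ _.
  by move=> t ts; apply: (fd (line_in_ball wr _)).2; rewrite ts.
by move=> t ts; apply: (gdP w t wr _).2; rewrite ts; lra.
Qed.

(** A small real step along the slice through [w] avoids its finitely many zeros. *)
Lemma nonzero_dense w e : rnorm w < r -> 0 < e ->
  exists2 w', rnorm (w' - w) < e & f w' != 0.
Proof.
move=> wr e0; have [N /(_ w wr)[l [eta [_ _ E e_n0 _]]]] := slices_factor.
have spos : 0 < s := s0.
have [d d0 dP] := prodX_neq0_near l 0.
have v1 : 0 < rnorm v + 1 by rewrite ltr_wpDl ?rnorm_ge0.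
pose x := Num.min (Num.min (d / 2) s) (e / 2 / (rnorm v + 1)).
have x0 : 0 < x by rewrite !lt_min s0 !divr_gt0.
have xd : x <= d / 2 by rewrite /x !ge_min lexx.
have xs : x <= s by rewrite /x !ge_min lexx orbT.
have xe : x <= e / 2 / (rnorm v + 1) by rewrite /x ge_min lexx orbT.
have xn : rnorm (x%:C : C) = x by rewrite rnorm_real ger0_norm// ltW.
exists (w + (x%:C : C) *: v).
  rewrite addrAC subrr add0r rnormZ xn; move: xe; rewrite ler_pdivlMr//.
  by have := rnorm_ge0 v; nra.
rewrite E mulf_neq0//.
  by apply: dP; rewrite subr0 xn; lra.
by apply: e_n0; apply: le_trans (snorm_le_rnorm _) _; rewrite xn.
Qed.

Section quotient.
Variables (p : V -> C) (Mp : R).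
Hypothesis pd : forall w, rnorm w < rho -> differentiable p w /\ rnorm (p w) <= Mp.

(** The kernel [t^-1] gives the candidate for the value of [p / f] at [w], and the kernels [t ^+ j]
    give the moments of [p / f] on the slice. *)
Definition quotient_mean (ka : C -> C) w : C :=
  cauchy_int s (fun t => p (w + t *: v) * (f (w + t *: v))^-1 * ka t).

(** [f] is at least [m] on the contours, so [p / f] is bounded and holomorphic around them, even if
    it has poles inside. *)
Lemma quotient_mean_differentiable (ka : C -> C) w :
  (forall t, snorm t = s -> {for t, continuous ka}) ->
  rnorm w < r -> differentiable (quotient_mean ka) w.
Proof.
move=> kac wr; have [_ r0 m0 gdP] := gd.
pose F y := p y * (f y)^-1.
have d0 : 0 < r - rnorm w by rewrite subr_gt0.
apply: (@cauchy_int_differentiable R V F v w s (r - rnorm w) (Mp * m^-1) ka s0 d0 kac).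
move=> t ts y yd; set w' := y - t *: v.
have yE : y = w' + t *: v by rewrite subrK.
have w'r : rnorm w' < r.
  have E : w' = (y - (w + t *: v)) + w by rewrite /w' opprD addrA addrAC subrK.
  by rewrite E; apply: le_lt_trans (ler_rnormD _ _) _; lra.
have ts' : snorm t <= s by rewrite ts.
have yrho : rnorm y < rho by rewrite yE; exact: line_in_ball.
have fy : m <= rnorm (f y) by rewrite yE; exact: slice_lower.
have fy0 : 0 < rnorm (f y) by exact: lt_le_trans fy.
split.
  apply: cdiffM; first exact: (pd yrho).1.
  by apply: cdiffV; [rewrite -rnorm_gt0|exact: (fd yrho).1].
rewrite rnormM rnormV; apply: ler_pM; rewrite ?invr_ge0 ?rnorm_ge0//.
  exact: (pd yrho).2.
by rewrite lef_pV2 ?posrE.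
Qed.

Lemma quotient_mean_inv w (H : C -> C) : rnorm w < r -> holomorphic_sq s H ->
  (forall t, snorm t <= s -> p (w + t *: v) = f (w + t *: v) * H t) ->
  p w = f w * quotient_mean (fun t => t^-1) w.
Proof.
move=> wr Hhol HE; have [_ r0 m0 gdP] := gd.
have z0 : snorm (0 : C) < s by rewrite snorm0.
have -> : quotient_mean (fun t => t^-1) w = H 0.
  rewrite -(cauchy_int_formula Hhol z0); apply: eq_cauchy_int => // t ts.
  have fn : f (w + t *: v) != 0.
    by rewrite -rnorm_gt0; apply: lt_le_trans m0 _; exact: slice_lower.
  by rewrite HE ?ts// subr0 [f _ * _]mulrC mulfK.
by have := HE 0; rewrite scale0r addr0 snorm0 => ->//; rewrite ltW.
Qed.

(* Either [f] divides [p] on the slice through [w], or [p / f] has a pole there. *)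
Lemma quotient_slice w : rnorm w < r ->
  (exists2 H, holomorphic_sq s H & forall t, snorm t <= s -> p (w + t *: v) = f (w + t *: v) * H t) \/
  exists (a : C) (c d : R), [/\ snorm a < s, 0 < c, 0 < d &
    forall t : C, 0 < rnorm (t - a) < d -> f (w + t *: v) != 0 /\
      c * rnorm (f (w + t *: v)) <= rnorm (p (w + t *: v)) * rnorm (t - a)].
Proof.
move=> wr; have [N /(_ w wr)[l [eta [la ehol E e_n0 _]]]] := slices_factor.
have spos : 0 < s := s0.
have la' (a : C) : a \in l -> snorm a < s by move=> /la; lra.
have phol := slice_holomorphic (fun w h => (pd h).1) wr.
have [[H Hh HE]|[a [c [d [as_ c0 d0 h]]]]] := quotient_dichotomy s0 phol ehol e_n0 la'.
  by left; exists H => // t ts; rewrite HE// E.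
by right; exists a, c, d; split => // t /h; rewrite E.
Qed.

End quotient.
End direction.

Lemma near_and2 f p (P : V -> Prop) :
  (\forall w \near (0 : V), differentiable f w) ->
  (\forall w \near (0 : V), differentiable p w) ->
  (\forall w \near (0 : V), P w) ->
  exists rho Mf Mp, [/\ 0 < rho,
    forall w, rnorm w < rho -> differentiable f w /\ rnorm (f w) <= Mf,
    forall w, rnorm w < rho -> differentiable p w /\ rnorm (p w) <= Mp &
    forall w, rnorm w < rho -> P w].
Proof.
move=> fd pd hP.
have [Mf fM] := near_bounded (cdiff_cont (nbhs_singleton fd)).
have [Mp pM] := near_bounded (cdiff_cont (nbhs_singleton pd)).
have [rho rho0 H] := (near0P _).1 (filterI (filterI fd fM) (filterI (filterI pd pM) hP)).
by exists rho, Mf, Mp; split => // w /H [[? ?] [[? ?] ?]].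
Qed.

(** A form of Riemann's extension theorem: the bound excludes poles on every slice, so the Cauchy
    mean of [p / f] is the quotient. *)
Theorem bounded_divide f p B :
  (\forall w \near (0 : V), differentiable f w) ->
  (\forall w \near (0 : V), differentiable p w) ->
  ~ (\forall w \near (0 : V), f w = 0) ->
  (\forall w \near (0 : V), rnorm (p w) <= B * rnorm (f w)) ->
  exists2 k : V -> C, \forall w \near (0 : V), differentiable k w &
    \forall w \near (0 : V), p w = f w * k w.
Proof.
move=> fd pd fn0 pB.
have [rho [Mf [Mp [rho0 fd' pd' pB']]]] := near_and2 fd pd pB.
have [v [s [r [m gd]]]] := exists_good_direction rho0 fd' fn0.
have [s0 r0 m0 gdP] := gd.
exists (quotient_mean f v s p (fun t => t^-1)).
  apply/near0P; exists r; first exact: r0.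
  move=> w wr.
  apply: (quotient_mean_differentiable gd fd' pd' _ wr) => t ts.
  apply: ccontV; last exact: ccont_id.
  by rewrite -rnorm_gt0; apply: lt_le_trans (snorm_le_rnorm t); rewrite ts.
apply/near0P; exists r; first exact: r0.
move=> w wr.
have [[H Hh HE]|[a [c [d [as_ c0 d0 h]]]]] := quotient_slice gd fd' pd' wr.
  exact: (quotient_mean_inv gd wr Hh HE).
exfalso.
have B1 : 0 < `|B| + 1 by rewrite ltr_wpDl.
(* A point at distance [x] from the pole is still in the square, and close enough for [c / x] to
   exceed the bound on [p / f]. *)
pose x := Num.min (d / 2) (Num.min ((s - snorm a) / 2) (c / (2 * (`|B| + 1)))).
have x0 : 0 < x by rewrite !lt_min !divr_gt0 ?mulr_gt0 ?subr_gt0.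
have xd : x <= d / 2 by rewrite /x ge_min lexx.
have xs : x <= (s - snorm a) / 2 by rewrite /x !ge_min lexx orbT.
have xc : x <= c / (2 * (`|B| + 1)) by rewrite /x !ge_min lexx !orbT.
pose t := a + x%:C : C.
have tx : rnorm (t - a) = x by rewrite /t addrAC subrr add0r rnorm_real ger0_norm ?ltW.
have ts : snorm t <= s.
  have := ler_snormD a (x%:C : C); have := snorm_le_rnorm (x%:C : C).
  by rewrite rnorm_real ger0_norm ?(ltW x0)// -/t; lra.
have [fn le1] := h t ltac:(by rewrite tx; lra).
have le2 := pB' _ (line_in_ball gd wr ts).
have f0 : 0 < rnorm (f (w + t *: v)) by rewrite rnorm_gt0.
move: xc; rewrite ler_pdivlMr ?mulr_gt0// => xc.
move: le1; rewrite tx; set X := rnorm (p _) in le2 *; set Y := rnorm (f _) in le2 f0 * => le1.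
have : X <= `|B| * Y by apply: le_trans le2 _; rewrite ler_wpM2r ?ler_norm// ltW.
by move=> le3; nra.
Qed.

End local_division.

(** * Density arguments and the common denominator *)

Section common_denominator.
Context (R : realType) (V : normedModType R[i]).
Local Notation C := (R[i]^o).
Implicit Types (f g h p q D : V -> C) (v w : V) (s r m M B : R).

Lemma cdiff_sum (I : Type) (l : seq I) (F : I -> V -> C) w :
  (forall i, differentiable (F i) w) -> differentiable (fun w => \sum_(i <- l) F i w) w.
Proof.
move=> Fd; elim: l => [|i l ih].
  rewrite (_ : (fun w => _) = fun=> 0); first exact: cdiff_cst.
  by apply/funext => x; rewrite big_nil.
rewrite (_ : (fun w => _) = fun w => F i w + \sum_(i <- l) F i w); last first.
  by apply/funext => x; rewrite big_cons.
by apply: cdiffD; [exact: Fd|exact: ih].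
Qed.

Lemma cdiff_prod (I : Type) (l : seq I) (F : I -> V -> C) w :
  (forall i, differentiable (F i) w) -> differentiable (fun w => \prod_(i <- l) F i w) w.
Proof.
move=> Fd; elim: l => [|i l ih].
  rewrite (_ : (fun w => _) = fun=> 1); first exact: cdiff_cst.
  by apply/funext => x; rewrite big_nil.
rewrite (_ : (fun w => _) = fun w => F i w * \prod_(i <- l) F i w); last first.
  by apply/funext => x; rewrite big_cons.
by apply: cdiffM; [exact: Fd|exact: ih].
Qed.

Lemma cdiff_det k (A : V -> 'M[R[i]]_k) w :
  (forall i j, differentiable (fun w => A w i j : C) w) ->
  differentiable (fun w => \det (A w) : C) w.
Proof.
move=> Ad; rewrite /determinant.
apply: cdiff_sum => u; apply: cdiffM; first exact: cdiff_cst.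
by apply: cdiff_prod => i; exact: Ad.
Qed.

Lemma cdiff_adj k (A : V -> 'M[R[i]]_k) i j w :
  (forall i j, differentiable (fun w => A w i j : C) w) ->
  differentiable (fun w => (\adj (A w)) i j : C) w.
Proof.
move=> Ad; rewrite (_ : (fun w => _) = fun w => (-1) ^+ (j + i) * \det (row' j (col' i (A w))) : C).
  apply: cdiffM; first exact: cdiff_cst.
  apply: cdiff_det => i' j'.
  rewrite (_ : (fun w => _) = fun w => A w (lift j i') (lift i j') : C); first exact: Ad.
  by apply/funext => x; rewrite !mxE.
by apply/funext => x; rewrite mxE.
Qed.

Lemma limit_bound p q B w : {for w, continuous p} -> {for w, continuous q} -> 0 <= B ->
  (forall e, 0 < e -> exists2 w', rnorm (w' - w) < e & rnorm (p w') <= B * rnorm (q w')) ->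
  rnorm (p w) <= B * rnorm (q w).
Proof.
move=> /continuous_rnormP pc /continuous_rnormP qc B0 H.
rewrite leNgt; apply/negP => lt1; set del := rnorm (p w) - B * rnorm (q w).
have del0 : 0 < del by rewrite subr_gt0.
have B1 : 0 < B + 1 by rewrite ltr_wpDl.
have del4 : 0 < del / 4 by lra.
have [e1 e10 P1] := pc _ del4.
have [e2 e20 P2] := qc _ (divr_gt0 del4 B1).
have [|w' w'e le1] := H (Num.min e1 e2); first by rewrite lt_min e10.
move: w'e; rewrite lt_min => /andP[/P1 h1 /P2]; rewrite ltr_pdivlMr// => h2.
have h3 := ler_rnormD (p w - p w') (p w'); rewrite subrK rdistC in h3.
have h4 := ler_rnormD (q w' - q w) (q w); rewrite subrK in h4.
have := rnorm_ge0 (q w' - q w); move: h1 h2 h3 h4 le1; rewrite /del; nra.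
Qed.

Lemma near_dense f (P : V -> Prop) :
  (\forall w \near (0 : V), differentiable f w) ->
  ~ (\forall w \near (0 : V), f w = 0) -> (\forall w \near (0 : V), P w) ->
  \forall w \near (0 : V), forall e, 0 < e ->
    exists w', [/\ rnorm (w' - w) < e, f w' != 0 & P w'].
Proof.
move=> fd fn0 hP.
have [rho [Mf [Mp [rho0 fd' _ hP']]]] := near_and2 fd fd hP.
have [v [s [r [m gd]]]] := exists_good_direction rho0 fd' fn0.
have [s0 r0 m0 gdP] := gd.
apply/near0P; exists (Num.min r (rho / 2)); first by rewrite lt_min r0 divr_gt0.
move=> w; rewrite lt_min => /andP[wr w2] e e0.
have [|w' w'e fw'] := nonzero_dense gd fd' wr (e := Num.min e (rho / 2)).
  by rewrite lt_min e0 divr_gt0.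
move: w'e; rewrite lt_min => /andP[w'e w'r].
exists w'; split => //; apply: hP'.
by have := ler_rnormD (w' - w) w; rewrite subrK; lra.
Qed.

(** The points where [D] does not vanish are dense, and the inequality passes to the limit. *)
Lemma generic_bound D p q B :
  (\forall w \near (0 : V), differentiable D w) -> ~ (\forall w \near (0 : V), D w = 0) ->
  (\forall w \near (0 : V), differentiable p w) ->
  (\forall w \near (0 : V), differentiable q w) -> 0 <= B ->
  (\forall w \near (0 : V), D w != 0 -> rnorm (p w) <= B * rnorm (q w)) ->
  \forall w \near (0 : V), rnorm (p w) <= B * rnorm (q w).
Proof.
move=> Dd D0 pd qd B0 H; have dense := near_dense Dd D0 H.
have [r r0 HH] := (near0P _).1 (filterI dense (filterI pd qd)).
apply/near0P; exists r; first exact: r0.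
move=> w /HH[dw [pw qw]].
apply: limit_bound; [exact: cdiff_cont|exact: cdiff_cont|exact: B0|].
by move=> e /dw[w' [w'e Dw' le1]]; exists w'; [exact: w'e|exact: le1].
Qed.

Lemma generic_eq D p q :
  (\forall w \near (0 : V), differentiable D w) -> ~ (\forall w \near (0 : V), D w = 0) ->
  (\forall w \near (0 : V), differentiable p w) ->
  (\forall w \near (0 : V), differentiable q w) ->
  (\forall w \near (0 : V), D w != 0 -> p w = q w) ->
  \forall w \near (0 : V), p w = q w.
Proof.
move=> Dd D0 pd qd H.
have pqd : \forall w \near (0 : V), differentiable (fun w => p w - q w) w.
  by apply: filterS (filterI pd qd) => w [? ?]; exact: cdiffB.
have cd : \forall w \near (0 : V), differentiable (fun=> 0 : C) w.
  by apply: filterE => w; exact: cdiff_cst.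
(* The equality is the bound of [p - q] by a multiple of the zero function. *)
have := @generic_bound D (fun w => p w - q w) (fun=> 0) 0 Dd D0 pqd cd (lexx _) _.
have H' : \forall w \near (0 : V), D w != 0 -> rnorm (p w - q w) <= 0 * rnorm (0 : C).
  by apply: filterS H => w h /h ->; rewrite subrr rnorm0 mul0r.
move=> /(_ H'); apply: filterS => w; rewrite mul0r => le1.
by apply/eqP; rewrite -subr_eq0 -rnorm_eq0 eq_le le1 rnorm_ge0.
Qed.

Lemma coef_rootsX_bound (d : seq C) (B : R) i : 0 <= B -> (forall a, a \in d -> rnorm a <= B) ->
  rnorm ((rootsX d)`_i : C) <= (1 + B) ^+ size d.
Proof.
move=> B0; elim: d i => [|a d ih] i dB.
  rewrite /rootsX big_nil coef1 expr0; case: i => [|i] /=; first by rewrite rnorm1.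
  by rewrite rnorm0.
have db b : b \in d -> rnorm b <= B by move=> bd; apply: dB; rewrite inE bd orbT.
rewrite /rootsX big_cons -/(rootsX d) mulrBl coefB coefXM coefCM exprS mulrDl mul1r.
apply: le_trans (ler_rnormB _ _) _; apply: lerD.
  by case: ifP => _; [rewrite rnorm0 exprn_ge0// addr_ge0|exact: ih].
by rewrite rnormM ler_pM ?rnorm_ge0 ?ih// dB// mem_head.
Qed.

End common_denominator.

Section common_denominator_theorem.
Context (R : realType) (V : normedModType R[i]).
Local Notation C := (R[i]^o).
Implicit Types (f g h p q : V -> C) (v w : V) (s r m M B : R).

Lemma near_forall (I : finType) (P : I -> V -> Prop) :
  (forall i, \forall w \near (0 : V), P i w) ->
  \forall w \near (0 : V), forall i, P i w.
Proof. by move=> H; exact: (@filter_forall V I P (nbhs (0 : V)) _ H). Qed.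

Section data.
Variables (f h : V -> C) (v : V) (s r m rho Mf Mh : R) (N : nat).
Hypotheses (gd : good_direction f v s r m rho)
  (fd : forall w, rnorm w < rho -> differentiable f w /\ rnorm (f w) <= Mf)
  (hd : forall w, rnorm w < rho -> differentiable h w /\ rnorm (h w) <= Mh)
  (NP : forall w, rnorm w < r -> exists (l : seq C) eta,
    [/\ forall a : C, a \in l -> snorm a < s / 9, holomorphic_sq s eta,
    forall t, f (w + t *: v) = prodX l t * eta t,
    forall t, snorm t <= s -> eta t != 0 & (size l <= N)%N]).

Let s0 : 0 < s. Proof. by case: gd. Qed.
Let r0 : 0 < r. Proof. by case: gd. Qed.

Definition momentf j w : C := quotient_mean f v s h (fun t => t ^+ j) w.

Definition hankelf k w : 'M[R[i]]_k := \matrix_(i, j) momentf (i + j) w.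

Lemma momentf_diff j w : rnorm w < r -> differentiable (momentf j) w.
Proof.
move=> wr; apply: (quotient_mean_differentiable gd fd hd _ wr) => t ts.
have := @horner_differentiable R 'X^j t.
rewrite (_ : (fun t => _) = (fun t : C => t ^+ j)); first exact: cdiff_cont.
by apply/funext => u; rewrite hornerXn.
Qed.

Lemma hankelf_diff k w : rnorm w < r ->
  forall i j, differentiable (fun w => hankelf k w i j : C) w.
Proof.
move=> wr i j; rewrite (_ : (fun w => _) = momentf (i + j)); first exact: momentf_diff.
by apply/funext => x; rewrite mxE.
Qed.

Let DD k w : C := \det (hankelf k w).

Lemma det_hankelf_diff k w : rnorm w < r -> differentiable (DD k) w.
Proof. by move=> wr; apply: cdiff_det; exact: hankelf_diff. Qed.

(** The largest order up to [N] whose determinant is not identically zero near 0. Order 0 qualifies,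
    the empty determinant being 1. On generic slices it is the degree of the denominator. *)
Lemma generic_rank : exists2 e : nat, ~ (\forall w \near (0 : V), DD e w = 0) &
  \forall w \near (0 : V), forall k, (e < k <= N)%N -> DD k w = 0.
Proof.
pose P k := `[< ~ (\forall w \near (0 : V), DD k w = 0) >] && (k <= N)%N.
have P0 : exists k, P k.
  exists 0%N; rewrite /P leq0n andbT; apply/asboolP => /nbhs_singleton/eqP.
  by rewrite /DD det_mx00 oner_eq0.
have PN k : P k -> (k <= N)%N by case/andP.
case: (ex_maxnP P0 PN) => e /andP[/asboolP e1 _] emax.
exists e => //.
have H (k : 'I_N.+1) : \forall w \near (0 : V), (e < k)%N -> DD k w = 0.
  have [ek|ke] := ltnP e k; last by apply: filterE.
  have : ~~ P k by apply/negP => /emax; rewrite leqNgt ek.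
  rewrite /P -ltnS ltn_ord andbT => /asboolPn/contrapT; apply: filterS => w h' _.
  exact: h'.
have := near_forall H; apply: filterS => w Hw k /andP[ek kN].
by have := Hw (Ordinal (n := N.+1) (m := k) kN) ek.
Qed.

Section rank.
Variable e : nat.
Hypothesis De : \forall w \near (0 : V), forall k, (e < k <= N)%N -> DD k w = 0.

(* [prodX d] generates the denominators of [h / f] on the slice through [w]. *)
Definition generic_at w (d : seq C) : Prop :=
  [/\ size d = e, forall a, a \in d -> snorm a < s / 9,
    exists2 al, holomorphic_sq s al & forall t, snorm t <= s ->
      prodX d t * h (w + t *: v) = f (w + t *: v) * al t,
   forall q : C -> C, holomorphic_sq s q ->
     (exists2 be, holomorphic_sq s be & forall t, snorm t <= s ->
       q t * h (w + t *: v) = f (w + t *: v) * be t) ->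
     exists2 ga, holomorphic_sq s ga & forall t, snorm t <= s -> q t = prodX d t * ga t &
   forall j, \sum_(i < e.+1) (rootsX d)`_i * momentf (i + j) w = 0].

(** On a slice, the degree of the denominator is the largest order with a nonzero determinant. It is
    at least [e] because [DD e w] is nonzero, and at most [e] because it does not exceed [N] and the
    determinants between vanish. *)
Lemma generic_point : \forall w \near (0 : V), DD e w != 0 -> exists d, generic_at w d.
Proof.
have [r1 r10 H] := (near0P _).1 De.
apply/near0P; exists (Num.min r r1); first by rewrite lt_min r0.
move=> w; rewrite lt_min => /andP[wr wr1] Dw.
have [l [eta [la ehol E e_n0 lN]]] := NP wr.
have spos : 0 < s := s0.
have hhol := slice_holomorphic gd (fun w k => (hd k).1) wr.
have la' (a : C) : a \in l -> snorm a < s by move=> /la; lra.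
have [d [[dl dl'] dden dmin [det1 det2] mom0]] :=
  slice_denominator s0 hhol ehol E e_n0 la'.
have de : size d = e.
  apply/eqP; rewrite eqn_leq; apply/andP; split.
    rewrite leqNgt; apply/negP => ed; move: det1 => /eqP; apply.
    by apply: H => //; rewrite ed (leq_trans dl).
  by rewrite leqNgt; apply/negP => /det2 D0; move: Dw => /eqP; apply; exact: D0.
exists d; split => //.
- by move=> a /dl' /la.
- by rewrite -de.
Qed.

(** Since the polynomial is monic, the recurrence on the moments is a linear system for the lower
    coefficients, with the Hankel matrix; multiplying by the adjugate is Cramer's rule. *)
Lemma cramer_coef w d (i : 'I_e) : generic_at w d ->
  DD e w * (rootsX d)`_i = - ((\row_j momentf (e + j) w) *m \adj (hankelf e w)) 0 i.
Proof.
move=> [sd _ _ _ mom].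
have se : size (rootsX d) = e.+1 by rewrite /rootsX size_prod_XsubC sd.
have lead : (rootsX d)`_e = 1.
  have := monic_prod_XsubC d xpredT id; rewrite monicE /lead_coef -/(rootsX d) se.
  by move=> /eqP.
pose c := \row_(i < e) (rootsX d)`_i.
have cH : c *m hankelf e w = - \row_j momentf (e + j) w.
  apply/rowP => j; rewrite !mxE; apply/eqP; rewrite -addr_eq0; apply/eqP.
  rewrite -[RHS](mom j) big_ord_recr /= lead mul1r; congr (_ + _).
  by apply: eq_bigr => k _; rewrite !mxE.
have : c *m hankelf e w *m \adj (hankelf e w) = (\det (hankelf e w)) *: c.
  by rewrite -mulmxA mul_mx_adj mul_mx_scalar.
rewrite cH mulNmx => /rowP/(_ i); rewrite !mxE => <-.
by congr (- _); apply: eq_bigr => k _; rewrite !mxE.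
Qed.

Hypothesis De0 : ~ (\forall w \near (0 : V), DD e w = 0).

Let De_diff : \forall w \near (0 : V), differentiable (DD e) w.
Proof. by apply/near0P; exists r; [exact: r0|exact: det_hankelf_diff]. Qed.

(** Cramer's numerators are divisible by the determinant near 0, also where it vanishes: on the
    dense set the quotients are coefficients of monic polynomials with roots in a fixed square,
    hence bounded. *)
Lemma denominator_coefs : exists cc : nat -> V -> C,
  (forall i, \forall w \near (0 : V), differentiable (cc i) w) /\
  \forall w \near (0 : V), DD e w != 0 -> exists2 d, generic_at w d &
    forall i : 'I_e.+1, cc i w = (rootsX d)`_i.
Proof.
have spos : 0 < s := s0.
pose aa (i : 'I_e) w : C := - ((\row_j momentf (e + j) w) *m \adj (hankelf e w)) 0 i.
have aad i : \forall w \near (0 : V), differentiable (aa i) w.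
  apply/near0P; exists r; first exact: r0.
  move=> w wr; apply: cdiffN.
  rewrite (_ : (fun w => _) = fun w => \sum_(j < e) (momentf (e + j) w * (\adj (hankelf e w)) j i : C)).
    apply: cdiff_sum => j; apply: cdiffM; first exact: momentf_diff.
    by apply: cdiff_adj; exact: hankelf_diff.
  by apply/funext => x; rewrite mxE; apply: eq_bigr => j _; rewrite mxE.
have quot i : exists k : V -> C, (\forall w \near (0 : V), differentiable k w) /\
    \forall w \near (0 : V), aa i w = DD e w * k w.
  (* The roots have norm at most [2 * s], since [rnorm] is at most twice [snorm]. *)
  have B0 : 0 <= (1 + 2 * s) ^+ e by rewrite exprn_ge0//; lra.
  have [|k k1 k2] := @bounded_divide R V (DD e) (aa i) ((1 + 2 * s) ^+ e) De_diff (aad i) De0 _.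
  - apply: (generic_bound De_diff De0 (aad i) De_diff B0).
    apply: filterS generic_point => w Hw Dw; have [d gen] := Hw Dw.
    rewrite /aa -(cramer_coef i gen) rnormM mulrC.
    apply: ler_wpM2r; first exact: rnorm_ge0.
    have [sd da _ _ _] := gen.
    rewrite -[X in _ ^+ X]sd; apply: coef_rootsX_bound; first by lra.
    by move=> a /da; have := rnorm_le_snorm a; lra.
  - by exists k.
have [CC CCP] := choice quot.
(* The default 1 is the leading coefficient, at the index [e]. *)
pose cc i w : C := if insub i is Some j then CC j w else 1.
exists cc; split.
  move=> i; rewrite /cc; case: insubP => [j _ _|_]; first exact: (CCP j).1.
  by apply: filterE => w; exact: cdiff_cst.
have := near_forall (fun i => (CCP i).2); move=> CCE.
apply: filterS (filterI CCE generic_point) => w [Ew gw] Dw.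
have [d gen] := gw Dw; exists d; first exact: gen.
move=> i; rewrite /cc; case: insubP => [j _ ji|].
  apply: (mulfI Dw); rewrite -Ew /aa -(cramer_coef j gen) ji.
  by [].
rewrite -leqNgt => ei; have -> : (i : nat) = e.
  by apply/eqP; rewrite eqn_leq ei -ltnS ltn_ord.
have [sd _ _ _ _] := gen.
have := monic_prod_XsubC d xpredT id; rewrite monicE /lead_coef -/(rootsX d).
by rewrite /rootsX size_prod_XsubC sd => /eqP.
Qed.

End rank.
End data.

(** [c w] is the value at [t = 0], that is at [w] itself, of the denominator on the slice through
    [w]. Both [f] and [g] are denominators of [h / f], since [f h = f h] and [g h = f k]. So on
    generic slices they are multiples of the polynomial, with cofactors bounded by the weak maximum
    principle, and [bounded_divide] yields [F] and [G]. *)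
Theorem common_denominator f g h k :
  (\forall w \near (0 : V), differentiable f w) ->
  (\forall w \near (0 : V), differentiable g w) ->
  (\forall w \near (0 : V), differentiable h w) ->
  (\forall w \near (0 : V), differentiable k w) ->
  (\forall w \near (0 : V), f w * k w = g w * h w) ->
  ~ (\forall w \near (0 : V), f w = 0) ->
  exists c A F G : V -> C,
  [/\ [/\ \forall w \near (0 : V), differentiable c w,
     \forall w \near (0 : V), differentiable A w,
     \forall w \near (0 : V), differentiable F w &
     \forall w \near (0 : V), differentiable G w],
     \forall w \near (0 : V), c w * h w = f w * A w,
     \forall w \near (0 : V), f w = c w * F w &
     \forall w \near (0 : V), g w = c w * G w].
Proof.
move=> fd gd hd kd fkgh fn0.
have [rho1 [Mf [Mh [rho10 fd1 hd1 E1]]]] := near_and2 fd hd fkgh.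
have [rho2 [Mg [Mk [rho20 gd2 kd2 _]]]] := near_and2 gd kd kd.
pose rho := Num.min rho1 rho2.
have rho0 : 0 < rho by rewrite lt_min rho10.
have fd' w : rnorm w < rho -> differentiable f w /\ rnorm (f w) <= Mf.
  by rewrite lt_min => /andP[/fd1].
have hd' w : rnorm w < rho -> differentiable h w /\ rnorm (h w) <= Mh.
  by rewrite lt_min => /andP[/hd1].
have gd' w : rnorm w < rho -> differentiable g w /\ rnorm (g w) <= Mg.
  by rewrite lt_min => /andP[_ /gd2].
have kd' w : rnorm w < rho -> differentiable k w /\ rnorm (k w) <= Mk.
  by rewrite lt_min => /andP[_ /kd2].
have E' w : rnorm w < rho -> f w * k w = g w * h w.
  by rewrite lt_min => /andP[/E1].
have [v [s [r [m dir]]]] := exists_good_direction rho0 fd' fn0.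
have [s0 r0 m0 dirP] := dir.
have [N NP] := slices_factor dir fd'.
have [e De0 De] := generic_rank f h v s N.
have [cc [ccd ccP]] := denominator_coefs dir fd' hd' NP De De0.
pose DD w : C := \det (hankelf f h v s e w).
have DDd : \forall w \near (0 : V), differentiable DD w.
  by apply/near0P; exists r; [exact: r0|exact: (det_hankelf_diff dir fd' hd')].
pose c := cc 0%N.
(* Cauchy's formula at 0 for the holomorphic function [prodX d * h / f] on the slice, with the
   polynomial expanded in its coefficients. The result is holomorphic in [w] also where the slice is
   not generic. *)
pose A w : C := \sum_(i < e.+1) cc i w * quotient_mean f v s h (fun t => t ^+ i * t^-1) w.
have kac i t : snorm t = s -> {for t, continuous (fun t : C => t ^+ i * t^-1)}.
  move=> ts; apply: ccontM.
    have := @horner_differentiable R 'X^i t.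
    rewrite (_ : (fun t => _) = (fun t : C => t ^+ i)); first exact: cdiff_cont.
    by apply/funext => u; rewrite hornerXn.
  apply: ccontV; last exact: ccont_id.
  by rewrite -rnorm_gt0; apply: lt_le_trans (snorm_le_rnorm t); rewrite ts.
have Ad : \forall w \near (0 : V), differentiable A w.
  have := near_forall (fun i : 'I_e.+1 => ccd i).
  move=> /near0P[r1 r10 H]; apply/near0P; exists (Num.min r r1); first by rewrite lt_min r0.
  move=> w; rewrite lt_min => /andP[wr wr1].
  apply: cdiff_sum => i; apply: cdiffM; first exact: H.
  exact: (quotient_mean_differentiable dir fd' hd' (kac i) wr).
have near_r : \forall w \near (0 : V), rnorm w < r by apply/near0P; exists r.
have cA : \forall w \near (0 : V), c w * h w = f w * A w.
  apply: (generic_eq DDd De0).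
  - by apply: filterS (filterI (ccd 0%N) hd) => w [? ?]; exact: cdiffM.
  - by apply: filterS (filterI fd Ad) => w [? ?]; exact: cdiffM.
  apply: filterS (filterI near_r ccP) => w [wr gw] Dw.
  have [d [sd da [al alhol alE] _ _] cd] := gw Dw.
  have z0 : snorm (0 : C) < s by rewrite snorm0.
  have c0 : c w = prodX d 0 by rewrite /c (cd ord0) -horner_coef0 horner_rootsX.
  have := alE 0 (ltW z0); rewrite scale0r addr0 -c0 => ->; congr (_ * _).
  rewrite -(cauchy_int_formula alhol z0) /A.
  have uc (i : 'I_e.+1) t : snorm t = s -> {for t, continuous (fun t : C =>
      cc i w * (h (w + t *: v) * (f (w + t *: v))^-1 * (t ^+ i * t^-1)))}.
    move=> ts; apply: ccontM; first exact: ccont_cst.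
    apply: ccontM; last exact: kac.
    apply: ccontM.
      exact: (holomorphic_contour (slice_holomorphic dir (fun w k => (hd' w k).1) wr)).
    apply: ccontV; first by rewrite -rnorm_gt0; apply: lt_le_trans m0 _; exact: (slice_lower dir).
    exact: (holomorphic_contour (slice_holomorphic dir (fun w k => (fd' w k).1) wr)).
  have uc' (i : 'I_e.+1) t : snorm t = s -> {for t, continuous (fun t : C =>
      h (w + t *: v) * (f (w + t *: v))^-1 * (t ^+ i * t^-1))}.
    move=> ts; apply: ccontM; last exact: kac.
    apply: ccontM.
      exact: (holomorphic_contour (slice_holomorphic dir (fun w k => (hd' w k).1) wr)).
    apply: ccontV; first by rewrite -rnorm_gt0; apply: lt_le_trans m0 _; exact: (slice_lower dir).
    exact: (holomorphic_contour (slice_holomorphic dir (fun w k => (fd' w k).1) wr)).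
  transitivity (\sum_(i < e.+1) cauchy_int s (fun t : C =>
      cc i w * (h (w + t *: v) * (f (w + t *: v))^-1 * (t ^+ i * t^-1)))); last first.
    by apply: eq_bigr => i _; rewrite (cauchy_intZ s0 (cc i w) (uc' i)).
  have [<- _] := cauchy_int_sum s0 uc.
  apply: eq_cauchy_int => // t ts; rewrite subr0.
  have fn : f (w + t *: v) != 0.
    by rewrite -rnorm_gt0; apply: lt_le_trans m0 _; exact: (slice_lower dir).
  have -> : al t = prodX d t * h (w + t *: v) * (f (w + t *: v))^-1.
    by rewrite alE ?ts// [f _ * _]mulrC mulfK.
  have sr : size (rootsX d) = e.+1 by rewrite /rootsX size_prod_XsubC sd.
  rewrite -horner_rootsX horner_coef sr !mulr_suml; apply: eq_bigr => i _.
  by rewrite (cd i); ring.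
(* Used for the pairs [(f, h)] and [(g, k)]. On the contour the roots are at distance at least
   [8 * s / 9], which bounds the cofactor there; [weak_maximum] at 0 adds the factor 4. *)
have divc q Mq (qd : forall w, rnorm w < rho -> differentiable q w /\ rnorm (q w) <= Mq) b
    (bd : forall w, rnorm w < rho -> differentiable b w)
    (qb : forall w, rnorm w < rho -> q w * h w = f w * b w) :
    \forall w \near (0 : V), rnorm (q w) <= (4 * `|Mq| / (8 * s / 9) ^+ e) * rnorm (c w).
  have qd' : \forall w \near (0 : V), differentiable q w.
    by apply/near0P; exists rho; [exact: rho0|move=> w /qd[]].
  have B0 : 0 <= 4 * `|Mq| / (8 * s / 9) ^+ e.
    by rewrite !mulr_ge0 ?invr_ge0 ?exprn_ge0//; lra.
  apply: (generic_bound DDd De0 qd' (ccd 0%N) B0).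
  apply: filterS (filterI near_r ccP) => w [wr gw] Dw.
  have [d [sd da _ dmin _] cd] := gw Dw.
  have z0 : snorm (0 : C) < s by rewrite snorm0.
  have c0 : c w = prodX d 0 by rewrite /c (cd ord0) -horner_coef0 horner_rootsX.
  have [||ga gahol gaE] := dmin (fun t => q (w + t *: v)).
  - exact: (slice_holomorphic dir (fun w k => (qd w k).1) wr).
  - exists (fun t => b (w + t *: v)); first exact: (slice_holomorphic dir bd wr).
    by move=> t ts; apply: qb; exact: (line_in_ball dir).
  have := gaE 0 (ltW z0); rewrite scale0r addr0 -c0 => ->.
  rewrite rnormM mulrC; apply: ler_wpM2r; first exact: rnorm_ge0.
  have P0 : 0 < (8 * s / 9) ^+ e by rewrite exprn_gt0//; lra.
  have gab t : snorm t = s -> rnorm (ga t) <= `|Mq| / (8 * s / 9) ^+ e.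
    move=> ts; have ts' : snorm t <= s by rewrite ts.
    rewrite ler_pdivlMr//; apply: le_trans (ler_norm Mq).
    apply: le_trans (qd _ (line_in_ball dir wr ts')).2.
    rewrite (gaE t ts') rnormM [leRHS]mulrC; apply: ler_wpM2l; first exact: rnorm_ge0.
    rewrite -sd.
    apply: ger_rnorm_prodX; first by lra.
    move=> a /da a9; apply: le_trans (rnorm_subr_contour a ts); lra.
  have := weak_maximum s0 gahol z0 gab; rewrite snorm0 subr0.
  move=> /le_trans; apply; rewrite le_eqVlt; apply/orP; left; apply/eqP.
  by field; rewrite gt_eqF// gt_eqF.
have cf := divc f Mf fd' h (fun w k => (hd' w k).1) (fun w _ => erefl _).
have cg := divc g Mg gd' k (fun w k => (kd' w k).1) (fun w wr => esym (E' w wr)).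
(* By the bound [cf], a vanishing [c] would make [f] vanish. *)
have cn0 : ~ (\forall w \near (0 : V), c w = 0).
  move=> c0; apply: fn0; apply: filterS (filterI c0 cf) => w [-> ].
  by rewrite rnorm0 mulr0 => le1; apply/eqP; rewrite -rnorm_eq0 eq_le le1 rnorm_ge0.
have [F Fd FE] := bounded_divide (ccd 0%N) fd cn0 cf.
have [G Gd GE] := bounded_divide (ccd 0%N) gd cn0 cg.
by exists c, A, F, G; split => //; split => //; exact: (ccd 0%N).
Qed.

End common_denominator_theorem.

(** * Lebesgue measure on tuples *)

Section integral_monotone.
Local Open Scope ereal_scope.
Context d (T : measurableType d) (R : realType) (mu : {measure set T -> \bar R}).

(* No measurability is assumed: the integral of a nonnegative function is a supremum over simple functions below it. *)
Lemma ge0_le_integral_subset (D E : set T) (f g : T -> \bar R) : D `<=` E ->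
  (forall x, D x -> 0 <= f x) -> (forall x, E x -> 0 <= g x) ->
  (forall x, D x -> f x <= g x) ->
  \int[mu]_(x in D) f x <= \int[mu]_(x in E) g x.
Proof.
move=> DE f0 g0 fg; rewrite !ge0_integralE//.
apply: le_ereal_sup => _ [h hf <-]; exists h => //= x.
apply: le_trans (hf x) _; rewrite /patch.
have [xD|xD] := boolP (x \in D).
  by rewrite (mem_set (DE x (set_mem xD))) fg//; exact: set_mem.
by case: ifP => // xE; apply: g0; exact: set_mem.
Qed.

End integral_monotone.

(** * Translation invariance *)

Section translation.
Local Open Scope ereal_scope.
Context (R : realType).
Local Notation T := (measurableTypeR R).
Local Notation leb := (@lebesgue_measure R).

Lemma measurable_shift (a : R) : measurable_fun setT (fun x : T => (x : R) + a : T)%R.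
Proof. by apply: (@measurable_funD _ T R setT id (cst a)). Qed.

(** Lebesgue measure is determined by its values on half-open intervals, whose length a translation
    preserves. *)
Lemma lebesgue_measure_shift (a : R) (A : set T) : measurable A ->
  leb ((fun x : R => x + a)%R @^-1` A) = leb A.
Proof.
move=> mA.
have := @lebesgue_measure_unique R
  (measure_function_pushforward__canonical__measure_function_Measure leb (measurable_shift a)) _ A mA.
move=> h; apply/esym; apply: h => X [[u v] /= _ <-].
rewrite /pushforward.
have -> : ((fun x : T => (x : R) + a)%R @^-1` `]u, v]) = `](u - a)%R, (v - a)%R]%classic.
  by apply/seteqP; split=> x /=; rewrite !in_itv/= ltrBlDr lerBrDr.
rewrite !lebesgue_measure_itv/= !lte_fin ltrD2r; case: ifP => // _.
by rewrite !EFinB/= -!EFinB; congr EFin; ring.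
Qed.

Lemma ge0_integral_shift (a : R) (f : T -> \bar R) : measurable_fun setT f ->
  (forall x, 0 <= f x) -> \int[leb]_x f (x + a)%R = \int[leb]_x f x.
Proof.
move=> mf f0.
have := @ge0_integral_pushforward _ _ T T R _ (measurable_shift a) leb setT f measurableT mf (fun x _ => f0 x).
rewrite preimage_setT => <-.
apply: eq_measure_integral; first exact: measurable_shift.
by move=> mshift A mA _; rewrite -[RHS](lebesgue_measure_shift a mA).
Qed.

Definition tuple_shift N (a x : N.-tuple T) : N.-tuple T :=
  [tuple ((tnth x i : R) + tnth a i)%R | i < N].

Lemma tuple_shift_cons N (a : N.+1.-tuple T) (x : T) (y : N.-tuple T) :
  tuple_shift a (cons_pair (x, y)) =
  cons_pair ((x + thead a)%R : T, tuple_shift [tuple of behead a] y).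
Proof.
apply: eq_from_tnth => i; rewrite tnth_mktuple.
have [->|[j ->]] : i = ord0 \/ exists j, i = lift ord0 j.
  by case: (unliftP ord0 i) => [j ->|->]; [right; exists j|left].
  by rewrite !(tnth_nth 0%R)/= /thead (tnth_nth 0%R).
rewrite !(tnth_nth 0%R)/=.
have := tnth_mktuple (fun i => ((tnth y i : R) + tnth [tuple of behead a] i)%R) j.
rewrite (tnth_nth 0%R)/= => ->.
by rewrite !(tnth_nth 0%R)/= nth_behead.
Qed.

Lemma measurable_tuple_shift N (a : N.-tuple T) : measurable_fun setT (tuple_shift a).
Proof.
apply/measurable_fun_tnthP => i.
rewrite (_ : _ \o _ = fun x : N.-tuple T => ((tnth x i : R) + tnth a i)%R).
  by apply: (@measurable_funD _ _ R setT (fun x : N.-tuple T => tnth x i : R) (cst (tnth a i : R))) => //; exact: measurable_tnth.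
by apply/funext => x /=; rewrite tnth_mktuple.
Qed.

Lemma tuple_measureS N (f : N.+1.-tuple T -> \bar R) : measurable_fun setT f ->
  (forall x, 0 <= f x) ->
  \int[tuple_measure leb N.+1]_x f x =
  \int[leb]_x \int[tuple_measure leb N]_y f (cons_pair (x, y)).
Proof.
move=> mf f0.
have := @ge0_integral_pushforward _ _ _ _ R _ (@measurable_cons_pair _ T N) (leb \x tuple_measure leb N) setT f measurableT mf (fun x _ => f0 x).
rewrite preimage_setT => h; rewrite [LHS]h.
rewrite (fubini_tonelli1 (f \o @cons_pair _ T N))//.
  exact: (measurableT_comp mf (@measurable_cons_pair _ T N)).
by move=> x; exact: f0.
Qed.

(** One coordinate at a time, through Tonelli's theorem. *)
Lemma ge0_integral_tuple_shift N (a : N.-tuple T) (f : N.-tuple T -> \bar R) :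
  measurable_fun setT f -> (forall x, 0 <= f x) ->
  \int[tuple_measure leb N]_x f (tuple_shift a x) = \int[tuple_measure leb N]_x f x.
Proof.
elim: N a f => [|N ih] a f mf f0.
  by apply: eq_integral => x _; rewrite [tuple_shift a x]tuple0 [x]tuple0.
have mcons : measurable_fun setT (f \o @cons_pair _ T N).
  exact: (measurableT_comp mf (@measurable_cons_pair _ T N)).
rewrite (tuple_measureS mf f0) tuple_measureS; last 2 first.
- exact: (measurableT_comp mf (measurable_tuple_shift a)).
- by move=> x; exact: f0.
transitivity (\int[leb]_x \int[tuple_measure leb N]_y f (cons_pair ((x + thead a)%R : T, y))).
  apply: eq_integral => x _.
  rewrite -(ih [tuple of behead a] (fun y => f (cons_pair ((x + thead a)%R : T, y)))).
  - by apply: eq_integral => y _; rewrite -tuple_shift_cons.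
  - have mp : measurable_fun setT (fun y : N.-tuple T => ((x + thead a)%R : T, y)).
      by apply: measurable_fun_pair; [exact: measurable_cst|exact: measurable_id].
    exact: (measurableT_comp mcons mp).
  - by move=> y; exact: f0.
apply: (ge0_integral_shift (thead a) (f := fun x => \int[tuple_measure leb N]_y f (cons_pair (x, y)))).
  apply: (measurable_fun_fubini_tonelli_F (f \o @cons_pair _ T N)) => //.
  by move=> x; exact: f0.
by move=> x; apply: integral_ge0 => y _; exact: f0.
Qed.

End translation.

(** * Open sets and boxes of tuples *)

Section tuple_open.
Context (R : realType).
Local Notation T := (measurableTypeR R).
Local Notation leb := (@lebesgue_measure R).

Definition tuple_box N (a : N.-tuple T) (e : R) : set (N.-tuple T) :=
  [set y | forall i, `|(tnth y i : R) - tnth a i| < e].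

Definition tuple_open N (U : set (N.-tuple T)) : Prop :=
  forall x, U x -> exists2 e : R, 0 < e & tuple_box x e `<=` U.

Lemma measurable_tuple_box N (a : N.-tuple T) (e : R) : measurable (tuple_box a e).
Proof.
rewrite (_ : tuple_box a e =
    \big[setI/setT]_(i <- enum 'I_N) ((fun y : N.-tuple T => tnth y i) @^-1` (ball (tnth a i : R) e))).
  apply: bigsetI_measurable => i _; rewrite -[X in measurable X]setTI.
  by apply: (measurable_tnth i) => //; exact: measurable_ball.
apply/seteqP; split=> y.
  move=> h; rewrite -bigcap_seq => i _ /=; rewrite /ball/= distrC; exact: h.
rewrite -bigcap_seq => h i; have := h i; rewrite /= mem_enum => /(_ isT).
by rewrite /ball/= distrC.
Qed.

(** An open set is the union of the boxes with rational centre and radius [1 / (k + 1)] that it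
    contains. There are countably many, enumerated by [unpickle]. *)
Lemma measurable_tuple_open N (U : set (N.-tuple T)) : tuple_open U -> measurable U.
Proof.
move=> Uo.
pose bx (q : N.-tuple rat * nat) : set (N.-tuple T) :=
  tuple_box [tuple (ratr (tnth q.1 i) : R) | i < N] q.2.+1%:R^-1.
pose S m : set (N.-tuple T) :=
  if unpickle m is Some q then (if `[< bx q `<=` U >] then bx q else set0) else set0.
have -> : U = \bigcup_m S m.
  apply/seteqP; split => [x Ux|x [m _]]; last first.
    by rewrite /S; case: unpickle => // q; case: asboolP => // h; exact: h.
  have [e e0 eU] := Uo _ Ux.
  have [k ke] : exists k : nat, k.+1%:R^-1 < e / 2.
    exists (Num.bound `|2 / e|); rewrite -[e / 2]invrK invf_div ltf_pV2 ?posrE ?divr_gt0//.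
    apply: le_lt_trans (ler_norm _) _; apply: lt_trans (archi_boundP (normr_ge0 _)) _.
    by rewrite ltr_nat.
  have qx (i : 'I_N) : exists q : rat, `|(tnth x i : R) - ratr q| < k.+1%:R^-1.
    have k0 : 0 < k.+1%:R^-1 :> R by rewrite invr_gt0.
    move: (tnth x i : R) k0 => xi; set K : R := _^-1 => k0.
    have [|q] := @rat_in_itvoo R (xi - K) (xi + K); first by lra.
    rewrite in_itv/= => /andP[h1 h2]; exists q.
    by rewrite ltr_norml; apply/andP; split; lra.
  have [q qP] := choice qx.
  exists (pickle ([tuple q i | i < N], k)) => //.
  have xb : bx ([tuple q i | i < N], k) x.
    by move=> i; rewrite /= !tnth_mktuple.
  rewrite /S pickleK; case: asboolP => // nb; exfalso; apply: nb => y yb.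
  apply: eU => i; have := yb i; have := xb i; rewrite /= => h1 h2.
  have := ler_distD (tnth [tuple ratr (tnth [tuple q i | i < N] i) | i < N] i) (tnth y i) (tnth x i).
  rewrite distrC in h1; move=> h3; apply: le_lt_trans h3 _.
  by apply: lt_trans (ltrD h2 h1) _; rewrite [ltRHS]splitr ltrD.
apply: bigcup_measurable => m _; rewrite /S; case: unpickle => // q.
by case: asboolP => // _; exact: measurable_tuple_box.
Qed.

Lemma continuous_measurable_tuple N (U : set (N.-tuple T)) (G : N.-tuple T -> R) :
  tuple_open U ->
  (forall x, U x -> forall e : R, 0 < e -> exists2 d : R, 0 < d &
     forall y, tuple_box x d y -> `|G y - G x| < e) ->
  measurable_fun U G.
Proof.
move=> Uo Gc mU; apply: (measurability _ (RGenOInfty.measurableE R)) => //.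
move=> /= _ [_ [a ->] <-]; apply: measurable_tuple_open => x [Ux /=].
rewrite in_itv/= andbT => aG.
have [e1 e10 H1] := Uo _ Ux.
have [d d0 H2] := Gc _ Ux (G x - a) ltac:(by rewrite subr_gt0).
exists (Num.min e1 d); first by rewrite lt_min e10.
move=> y yb; split.
  by apply: H1 => i; apply: lt_le_trans (yb i) _; rewrite ge_min lexx.
rewrite /= in_itv/= andbT.
have yd : tuple_box x d y.
  by move=> i; apply: lt_le_trans (yb i) _; rewrite ge_min lexx orbT.
have := H2 y yd; rewrite ltr_norml => /andP[h _].
by rewrite -(ltrD2r (- G x)); apply: le_lt_trans h; rewrite opprB.
Qed.

Lemma tuple_measure_boxS N (a : N.+1.-tuple T) (e : R) : 0 < e ->
  (tuple_measure leb N.+1 (tuple_box a e) =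
   (e *+ 2)%:E * tuple_measure leb N (tuple_box [tuple of behead a] e))%E.
Proof.
move=> e0; transitivity
    ((leb \x tuple_measure leb N)%E (ball (thead a : R) e `*` tuple_box [tuple of behead a] e)).
  rewrite /= /cons_measure /pushforward; congr ((leb \x _)%E _).
  apply/seteqP; split=> [[x y] /= h|[x y] /= [h1 h2] i].
    split; first by have := h ord0; rewrite !(tnth_nth 0)/= /ball/= distrC /thead (tnth_nth 0).
    move=> i; have := h (lift ord0 i); rewrite !(tnth_nth 0)/= nth_behead.
    by [].
  have [->|[j ->]] : i = ord0 \/ exists j, i = lift ord0 j.
    by case: (unliftP ord0 i) => [j ->|->]; [right; exists j|left].
    by move: h1; rewrite !(tnth_nth 0)/= /ball/= distrC /thead (tnth_nth 0).
  by have := h2 j; rewrite !(tnth_nth 0)/= nth_behead.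
rewrite product_measure1E//; last 2 first.
- exact: measurable_ball.
- exact: measurable_tuple_box.
by rewrite [X in (X * _)%E](@lebesgue_measure_ball R (thead a) e (ltW e0)).
Qed.

Lemma tuple_measure_box_gt0 N (a : N.-tuple T) (e : R) : 0 < e ->
  (0 < tuple_measure leb N (tuple_box a e))%E.
Proof.
move=> e0; elim: N a => [|N ih] a.
  rewrite /= diracE mem_set//= ?lte_fin//.
  by move=> [].
by rewrite tuple_measure_boxS// mule_gt0// lte_fin mulrn_wgt0.
Qed.

Lemma tuple_measure_box_lty N (a : N.-tuple T) (e : R) : 0 < e ->
  (tuple_measure leb N (tuple_box a e) < +oo)%E.
Proof.
move=> e0; elim: N a => [|N ih] a.
  by rewrite /= diracE ltry.
by rewrite tuple_measure_boxS// lte_mul_pinfty// lee_fin mulrn_wge0// ltW.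
Qed.

End tuple_open.

(** * Divergence of the integral at a pole *)

Section polar_singularity.
Local Open Scope ereal_scope.
Context (R : realType).
Local Notation T := (measurableTypeR R).
Local Notation leb := (@lebesgue_measure R).

(** In one quadrant at the singular point, the rectangles [A k] are disjoint. With [r k] the dyadic
    scale, the area is [r k ^+ 2 / 2] and the integrand at least [c / (2 * r k ^+ 2)], so each of
    them contributes at least [c / 4]. *)
Lemma integral_inv_square (al be c d : R) (g : T * T -> \bar R) :
  measurable_fun setT g -> (forall z, 0 <= g z) -> (0 < c)%R -> (0 < d)%R ->
  (forall x y : R, (al < x <= al + d)%R -> (be < y <= be + d)%R ->
     (c / ((x - al) ^+ 2 + (y - be) ^+ 2))%:E <= g (x, y)) ->
  \int[leb \x leb]_z g z = +oo.
Proof.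
move=> mg g0 c0 d0 H; set mu2 := (leb \x leb).
pose r k : R := (d / 2 ^+ k)%R.
have r0 k : (0 < r k)%R by rewrite divr_gt0// exprn_gt0.
have rS k : r k.+1 = (r k / 2)%R by rewrite /r exprS; field; rewrite expf_neq0.
have rd k : (r k <= d)%R.
  elim: k => [|k ih]; first by rewrite /r expr0 divr1.
  by rewrite rS; have := r0 k; lra.
pose A k : set (T * T) := `](al + r k.+1)%R, (al + r k)%R]%classic `*` `]be, (be + r k)%R]%classic.
have mA k : measurable (A k) by apply: measurableX; exact: measurable_itv.
have muA k : mu2 (A k) = (r k ^+ 2 / 2)%:E.
  rewrite /mu2 product_measure1E; [|exact: measurable_itv|exact: measurable_itv].
  have itvE (u w : R) : (0 < w)%R -> leb `]u, (u + w)%R]%classic = w%:E.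
    by move=> w0; rewrite lebesgue_measure_itv/= lte_fin ltrDl w0 -EFinB addrAC subrr add0r.
  have -> : (al + r k = al + r k.+1 + r k.+1)%R by rewrite rS; lra.
  transitivity ((r k.+1)%:E * (r k)%:E); last by rewrite -EFinM rS; congr EFin; field.
  by congr (_ * _); exact: itvE.
have intA k : (c / 4)%:E <= \int[mu2]_(z in A k) g z.
  have -> : (c / 4)%:E = \int[mu2]_(z in A k) (c / (2 * r k ^+ 2))%:E.
    rewrite (integral_cst _ (mA k)) [X in _ = _ * X]muA -EFinM; congr EFin; field; exact/lt0r_neq0.
  apply: ge0_le_integral_subset => //.
  - by move=> z _; rewrite lee_fin divr_ge0 ?(ltW c0)// mulr_ge0 ?sqr_ge0.
  - move=> [x y] [/=]; rewrite !in_itv/= => /andP[h1 h2] /andP[h3 h4].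
    have rk := r0 k; have rk1 := r0 k.+1; have rdk := rd k.
    apply: le_trans (H x y _ _); last 2 first.
    + by apply/andP; split; lra.
    + by apply/andP; split; lra.
    rewrite lee_fin; apply: ler_wpM2l; first exact: ltW.
    rewrite lef_pV2 ?posrE.
    + have a1 : (0 <= x - al <= r k)%R by lra.
      have a2 : (0 <= y - be <= r k)%R by lra.
      by nra.
    + by rewrite mulr_gt0// exprn_gt0.
    + by rewrite ltr_pwDl ?sqr_ge0// exprn_gt0//; lra.
have le_all n : (n%:R * (c / 4))%:E <= \int[mu2]_z g z.
  have tA : trivIset setT A.
    apply/trivIsetP => i j _ _ ij; apply/seteqP; split=> // -[x y] [[/= h1 _] [h2 _]].
    have mono a b : (a < b)%N -> (r b <= r a.+1)%R.
      move=> ab; rewrite -(subnKC ab); elim: (b - a.+1)%N => [|k ih]; first by rewrite addn0.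
      by rewrite addnS rS; have := r0 (a.+1 + k)%N; lra.
    move: h1 h2; rewrite !in_itv/= => /andP[p1 p2] /andP[p3 p4].
    exfalso; move: ij; rewrite neq_ltn => /orP[/mono h|/mono h].
      by have := lt_le_trans p1 p4; rewrite ltrD2l ltNge h.
    by have := lt_le_trans p3 p2; rewrite ltrD2l ltNge h.
  have : \sum_(k < n) \int[mu2]_(z in A k) g z <= \int[mu2]_z g z.
    rewrite -(big_mkord xpredT (fun k => \int[mu2]_(z in A k) g z)).
    rewrite -ge0_integral_bigsetU//.
    - exact: ge0_le_integral_subset.
    - exact: iota_uniq.
    - exact: sub_trivIset tA.
    - exact: measurable_funS mg.
  apply: le_trans.
  have -> : (n%:R * (c / 4))%:E = \sum_(k < n) (c / 4)%:E.
    by rewrite sumEFin; congr EFin; rewrite sumr_const card_ord mulr_natl.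
  by apply: lee_sum => k _; exact: intA.
apply/eqP; rewrite eq_le leey/= leNgt; apply/negP.
have I0 : 0 <= \int[mu2]_z g z by exact: integral_ge0.
move=> Ifin; have Ef : \int[mu2]_z g z \is a fin_num by rewrite ge0_fin_numE.
move: le_all; rewrite -(fineK Ef); set I := fine _ => le_all.
have c40 : (0 < c / 4)%R by rewrite divr_gt0.
have := le_all (Num.bound `|(I / (c / 4))%R|%R).
rewrite lee_fin leNgt => /negP; apply.
rewrite -ltr_pdivrMr//; apply: le_lt_trans (ler_norm _) _.
exact: archi_boundP.
Qed.

End polar_singularity.

(** * Complex and real coordinates *)

Section coordinates.
Context (R : realType) (n : nat).
Local Notation C := (R[i]^o).
Local Notation V := 'rV[C]_n.
Local Notation T := (measurableTypeR R).
Local Notation leb := (@lebesgue_measure R).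
Local Notation mu := (tuple_measure (@lebesgue_measure R) (n + n)).
Local Notation cc := (@complex_coord R n).
Implicit Types (z : V) (x y : (n + n).-tuple T).

(** The norm enters only through its values on the basis vectors; the added 1 keeps [K] positive
    when [n = 0]. *)
Lemma rnorm_row_bound : exists2 K : R, 0 < K &
  forall z (B : R), 0 <= B -> (forall j, rnorm (z 0 j : C) <= B) -> rnorm z <= K * B.
Proof.
exists (1 + \sum_(j < n) rnorm (delta_mx 0 j : V)).
  by rewrite ltr_wpDr// sumr_ge0// => j _; exact: rnorm_ge0.
move=> z B B0 zB; rewrite [z in rnorm z]row_sum_delta.
have S (l : seq 'I_n) : rnorm (\sum_(j <- l) z 0 j *: delta_mx 0 j : V) <=
    \sum_(j <- l) B * rnorm (delta_mx 0 j : V).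
  elim: l => [|j l ih]; first by rewrite !big_nil rnorm0.
  rewrite !big_cons; apply: le_trans (ler_rnormD _ _) _; apply: lerD => //.
  by rewrite rnormZ ler_wpM2r ?rnorm_ge0.
apply: le_trans (S _) _; rewrite -mulr_sumr mulrDl mul1r mulrC.
by rewrite lerDr.
Qed.

Lemma near_row_entries (e : R) : 0 < e ->
  exists2 d : R, 0 < d & forall z, rnorm z < d -> forall j, rnorm (z 0 j : C) < e.
Proof.
move=> e0.
have H (j : 'I_n) : \forall z \near (0 : V), rnorm ((z : V) 0 j : C) < e.
  have /differentiable_continuous /continuous_rnormP/(_ e e0)[d d0 dP] :=
    @differentiable_coord R[i] 1 n (0 : V) 0 j.
  by apply/near0P; exists d => // w wd; have := dP w; rewrite subr0 mxE subr0; apply.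
by have /near0P := near_forall H.
Qed.

Lemma complex_coordE x j : cc x 0 j = Complex (tnth x (lshift n j)) (tnth x (rshift n j)).
Proof. by rewrite mxE. Qed.

Definition real_coord z : (n + n).-tuple T :=
  [tuple match fintype.split i with inl j => complex.Re (z 0 j) | inr j => complex.Im (z 0 j) end
  | i < n + n].

Lemma complex_coordK z : cc (real_coord z) = z.
Proof.
apply/rowP => j; rewrite complex_coordE !tnth_mktuple.
by rewrite (unsplitK (inl j)) (unsplitK (inr j)); case: (z 0 j).
Qed.

Lemma complex_coord_shift z x : cc (tuple_shift (real_coord z) x) = cc x + z.
Proof.
apply/rowP => j; rewrite complex_coordE !tnth_mktuple [RHS]mxE complex_coordE.
rewrite (unsplitK (inl j)) (unsplitK (inr j)).
by apply/eqP; rewrite eq_complex /=; case: (z 0 j) => a b /=; rewrite !eqxx.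
Qed.

Lemma complex_coord_box : exists2 K : R, 0 < K & forall x y (d : R), 0 <= d ->
  tuple_box x d y -> rnorm (cc y - cc x) <= K * d.
Proof.
have [K K0 KP] := rnorm_row_bound; exists (K * 2); first by rewrite mulr_gt0.
move=> x y d d0 xy; rewrite -mulrA; apply: KP; first by rewrite mulr_ge0.
move=> j; rewrite !mxE; apply: le_trans (ler_rnorm_ReIm _) _.
rewrite mulrDl mul1r; apply: lerD; exact/ltW/xy.
Qed.

Definition ropen (U : set V) : Prop :=
  forall z, U z -> exists2 e : R, 0 < e & forall w, rnorm (w - z) < e -> U w.

Lemma ropen_ball0 (e : R) : ropen [set z | rnorm z < e].
Proof.
move=> z /= ze; exists (e - rnorm z); first by rewrite subr_gt0.
by move=> w wz; have := ler_rnormD (w - z) z; rewrite subrK; lra.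
Qed.

Lemma ropen_tuple_open (U : set V) : ropen U -> tuple_open (cc @^-1` U).
Proof.
move=> Uo x Ux; have [e e0 eU] := Uo _ Ux.
have [K K0 KP] := complex_coord_box.
exists (e / 2 / K); first by rewrite !divr_gt0.
move=> y xy; apply: eU; apply: le_lt_trans (KP _ _ _ _ xy) _.
  by rewrite !divr_ge0// ltW.
by rewrite mulrC divfK ?gt_eqF//; lra.
Qed.

Lemma continuous_measurable_coord (U : set V) (f : V -> C) : ropen U ->
  (forall z, U z -> {for z, continuous f}) ->
  measurable_fun (cc @^-1` U) (fun x => rnorm (f (cc x))).
Proof.
move=> Uo fc; apply: continuous_measurable_tuple; first exact: ropen_tuple_open.
move=> x Ux e e0; have /continuous_rnormP/(_ e e0)[d d0 dP] := fc _ Ux.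
have [K K0 KP] := complex_coord_box.
exists (d / 2 / K); first by rewrite !divr_gt0.
move=> y xy.
have h : rnorm (cc y - cc x) < d.
  apply: le_lt_trans (KP _ _ _ _ xy) _; first by rewrite !divr_ge0// ltW.
  by rewrite mulrC divfK ?gt_eqF//; lra.
have h1 := dP _ h.
have h2 := ler_rnormD (f (cc y) - f (cc x)) (f (cc x)); rewrite subrK in h2.
have h3 := ler_rnormD (f (cc x) - f (cc y)) (f (cc y)); rewrite subrK rdistC in h3.
by rewrite ltr_norml; apply/andP; split; lra.
Qed.

(** The ideals are defined with Euclidean balls of real tuples, the local theory with balls of
    [rnorm]; this lemma and the next one compare them. *)
Lemma closed_ball0_in_ball (rho : R) : 0 < rho ->
  exists2 r : R, 0 < r & forall x, @Defs.closed_ball0 R n r x -> rnorm (cc x) < rho.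
Proof.
move=> rho0; have [K K0 KP] := rnorm_row_bound.
exists (rho / 4 / K); first by rewrite !divr_gt0.
set r := _ / K; have r0 : 0 < r by rewrite !divr_gt0.
move=> x xr; have xi i : `|tnth x i : R| <= r.
  rewrite -(ler_pXn2r (n := 2)) ?nnegrE ?(ltW r0)// real_normK ?num_real//.
  apply: le_trans xr; rewrite (bigD1 i)//= lerDl.
  by apply: sumr_ge0 => j _; exact: sqr_ge0.
apply: (@le_lt_trans _ _ (K * (2 * r))).
  apply: KP; first by rewrite mulr_ge0// ltW.
  move=> j; rewrite complex_coordE; apply: le_trans (ler_rnorm_ReIm _) _.
  by rewrite mulrDl mul1r; apply: lerD; exact: xi.
by rewrite /r mulrCA [K * _]mulrC divfK ?gt_eqF//; lra.
Qed.

Lemma ball_in_closed_ball0 (r : R) : 0 < r ->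
  exists2 rho : R, 0 < rho & forall x, rnorm (cc x) < rho -> @Defs.closed_ball0 R n r x.
Proof.
(* A sum of [2 n] squares of numbers at most [e] is then at most [r ^+ 2]; the successor avoids a
   division by 0 when [n = 0]. *)
move=> r0; pose e := r / (n + n).+1%:R.
have N0 : 0 < (n + n).+1%:R :> R by rewrite ltr0n.
have e0 : 0 < e by rewrite divr_gt0.
have [rho rho0 H] := near_row_entries e0; exists rho => // x /H xe.
have xi i : `|tnth x i : R| <= e.
  rewrite -(splitK i); case: (fintype.split i) => j /=.
    have := ler_Re_rnorm (cc x 0 j); rewrite {1}complex_coordE /=.
    by move=> /le_trans; apply; exact/ltW.
  have := ler_Im_rnorm (cc x 0 j); rewrite {1}complex_coordE /=.
  by move=> /le_trans; apply; exact/ltW.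
rewrite /Defs.closed_ball0 /=.
have h : \sum_(i < n + n) (tnth x i : R) ^+ 2 <= \sum_(i < n + n) e ^+ 2.
  apply: ler_sum => i _; rewrite -[X in X <= _]real_normK ?num_real//.
  by rewrite lerXn2r ?nnegrE ?(ltW e0).
apply: le_trans h _; rewrite sumr_const card_ord -mulr_natl.
rewrite /e expr_div_n mulrCA ler_piMr ?sqr_ge0//.
rewrite ler_pdivrMr ?exprn_gt0// mul1r -natrX ler_nat.
by apply: leq_trans (leqnSn _) _; rewrite -[X in (X <= _)%N]expn1 leq_pexp2l.
Qed.

Lemma measurable_closed_ball0 (r : R) : measurable (@Defs.closed_ball0 R n r).
Proof.
rewrite /Defs.closed_ball0 (_ : [set x | _] =
  (fun x : (n + n).-tuple T => \sum_(i < n + n) (tnth x i : R) ^+ 2) @^-1` `]-oo, r ^+ 2]%classic); last first.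
  by apply/seteqP; split => x /=; rewrite in_itv.
rewrite -[X in measurable X]setTI.
have h : measurable_fun setT (fun x : (n + n).-tuple T => \sum_(i < n + n) (tnth x i : R) ^+ 2).
  apply: measurable_sum => i.
  apply: (@measurable_funX _ _ R setT (fun x : (n + n).-tuple T => tnth x i : R)).
  exact: measurable_tnth.
by apply: h => //; exact: measurable_itv.
Qed.

End coordinates.

(** * Division in L2 *)

Section plane_measure.
Context (R : realType).
Local Notation T := (measurableTypeR R).
Local Notation leb := (@lebesgue_measure R).

(* An alias: on the product measure itself, inference of the sigma-finite structure is shadowed by that of the product of subprobabilities. *)
Definition plane_measure : set (T * T)%type -> \bar R := (leb \x leb)%E.

HB.instance Definition _ := Measure.on plane_measure.

Let plane_sigma_finite : sigma_finite setT plane_measure.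
Proof.
have /sigma_finiteP[F [TF ndF Foo]] := sigma_finiteT leb.
exists (fun k => F k `*` F k).
  apply/seteqP; split => // -[x y] _.
  have [k _ Fx] : (\bigcup_i F i) x by rewrite -TF.
  have [l _ Fy] : (\bigcup_i F i) y by rewrite -TF.
  exists (maxn k l) => //; split => /=.
    by move: Fx; exact/subsetPset/ndF/leq_maxl.
  by move: Fy; exact/subsetPset/ndF/leq_maxr.
move=> k; have [mF Fk] := Foo k; split; first exact: measurableX.
by rewrite /plane_measure product_measure1E// lte_mul_pinfty// ge0_fin_numE.
Qed.

HB.instance Definition _ := Measure_isSigmaFinite.Build _ _ _ plane_measure plane_sigma_finite.

End plane_measure.

Section L2_division.
Context (R : realType) (n : nat).
Local Notation C := (R[i]^o).
Local Notation V := 'rV[C]_n.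
Local Notation T := (measurableTypeR R).
Local Notation leb := (@lebesgue_measure R).
Local Notation mu := (tuple_measure (@lebesgue_measure R) (n + n)).
Local Notation cc := (@complex_coord R n).
Implicit Types (z : V) (x y : (n + n).-tuple T) (f p : V -> C).

Lemma rnorm_sqr (z : C) : rnorm z ^+ 2 = complex.Re z ^+ 2 + complex.Im z ^+ 2.
Proof.
by rewrite rnormc /Normc.normc; case: z => a b /=; rewrite sqr_sqrtr// addr_ge0 ?sqr_ge0.
Qed.

(** The map sending [(w, t)] to [w + t v], in real coordinates. *)
Definition line_shift (v : V) (xu : (n + n).-tuple T * (T * T)) : (n + n).-tuple T :=
  tuple_shift (real_coord ((Complex xu.2.1 xu.2.2 : C) *: v)) xu.1.

Lemma measurable_line_shift (v : V) : measurable_fun setT (line_shift v).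
Proof.
apply/measurable_fun_tnthP => i.
have m1 : measurable_fun setT (fun xu : (n + n).-tuple T * (T * T) => tnth xu.1 i : R).
  exact: (measurableT_comp (measurable_tnth i) measurable_fst).
have m21 : measurable_fun setT (fun xu : (n + n).-tuple T * (T * T) => xu.2.1 : R).
  exact: (measurableT_comp measurable_fst measurable_snd).
have m22 : measurable_fun setT (fun xu : (n + n).-tuple T * (T * T) => xu.2.2 : R).
  exact: (measurableT_comp measurable_snd measurable_snd).
have [a [b E]] : exists a b : R, forall xu : (n + n).-tuple T * (T * T),
    tnth (line_shift v xu) i = ((tnth xu.1 i : R) + ((xu.2.1 : R) * a + (xu.2.2 : R) * b) : T).
  rewrite -(splitK i); case: (fintype.split i) => j /=.
    exists (complex.Re (v 0 j)), (- complex.Im (v 0 j)) => xu.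
    rewrite !tnth_mktuple (unsplitK (inl j)) mxE; case: (v 0 j) => u w /=.
    by rewrite mulrN.
  exists (complex.Im (v 0 j)), (complex.Re (v 0 j)) => xu.
  rewrite !tnth_mktuple (unsplitK (inr j)) mxE; case: (v 0 j) => u w /=.
  by [].
rewrite (_ : _ \o _ = fun xu : (n + n).-tuple T * (T * T) =>
    ((tnth xu.1 i : R) + ((xu.2.1 : R) * a + (xu.2.2 : R) * b) : T)); last first.
  by apply/funext => xu; exact: E.
apply: (measurable_funD m1); apply: measurable_funD.
  exact: (measurable_funM m21 (measurable_cst a)).
exact: (measurable_funM m22 (measurable_cst b)).
Qed.

(** The direction [v] need not be a coordinate axis. Averaging over translates along [v] replaces a
    linear change of variables, so that translation invariance of the measure and Tonelli's theorem
    suffice. *)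
Theorem L2_divide f p (r : R) :
  (\forall w \near (0 : V), differentiable f w) ->
  (\forall w \near (0 : V), differentiable p w) ->
  ~ (\forall w \near (0 : V), f w = 0) -> 0 < r ->
  (\int[mu]_(x in @Defs.closed_ball0 R n r) (rnorm (p (cc x) * (f (cc x))^-1 : C) ^+ 2)%:E < +oo)%E ->
  exists2 k : V -> C, \forall w \near (0 : V), differentiable k w &
    \forall w \near (0 : V), p w = f w * k w.
Proof.
move=> fd pd fn0 r0 fin.
have [rho0 [Mf [Mp [rho00 fd0 pd0 _]]]] := near_and2 fd pd fd.
have [rho1 rho10 in_ball] := ball_in_closed_ball0 n r0.
pose rho := Num.min rho0 rho1.
have rho_gt0 : 0 < rho by rewrite lt_min rho00.
have fd' w : rnorm w < rho -> differentiable f w /\ rnorm (f w) <= Mf.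
  by rewrite lt_min => /andP[/fd0].
have pd' w : rnorm w < rho -> differentiable p w /\ rnorm (p w) <= Mp.
  by rewrite lt_min => /andP[/pd0].
have [v [s [r1 [m gd]]]] := exists_good_direction rho_gt0 fd' fn0.
have [s0 r10 m0 gdP] := gd.
have [k [kd kinv]] : exists k : V -> C, (forall w, rnorm w < r1 -> differentiable k w) /\
    forall w (H : C -> C), rnorm w < r1 -> holomorphic_sq s H ->
      (forall t, snorm t <= s -> p (w + t *: v) = f (w + t *: v) * H t) -> p w = f w * k w.
  exists (quotient_mean f v s p (fun t => t^-1)); split => [w wr|w H].
    apply: (quotient_mean_differentiable gd fd' pd' _ wr) => t ts.
    apply: ccontV; last exact: ccont_id.
    by rewrite -rnorm_gt0; apply: lt_le_trans (snorm_le_rnorm t); rewrite ts.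
  exact: (quotient_mean_inv gd).
exists k; first by apply/near0P; exists r1; [exact: r10|exact: kd].
apply/near0P; exists r1; first exact: r10.
move=> w0 w0r; apply: contrapT => neq.
have w0rho : rnorm w0 < rho.
  by have := line_in_ball gd w0r (t := 0); rewrite scale0r addr0 snorm0; apply; exact: ltW.
have [e e0 He] : exists2 e : R, 0 < e & forall w, rnorm (w - w0) < e ->
    rnorm w < r1 /\ p w <> f w * k w.
  pose D w := p w - f w * k w.
  have Dd : differentiable D w0.
    apply: cdiffB; first exact: (pd' _ w0rho).1.
    by apply: cdiffM; [exact: (fd' _ w0rho).1|exact: kd].
  have D0 : 0 < rnorm (D w0).
    by rewrite rnorm_gt0 subr_eq0; apply/eqP.
  have [d d0 dP] := (continuous_rnormP _ _).1 (cdiff_cont Dd) _ D0.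
  exists (Num.min d (r1 - rnorm w0)); first by rewrite lt_min d0 subr_gt0.
  move=> w; rewrite lt_min => /andP[/dP wd wr]; split.
    by have := ler_rnormD (w - w0) w0; rewrite subrK; lra.
  move=> E; have Dw : D w = 0 by apply/eqP; rewrite subr_eq0; apply/eqP.
  by move: wd; rewrite Dw sub0r rnormN ltxx.
(* On this open set [p / f] is continuous. Cutting the integrand off outside it makes it measurable
   on the whole space, as the functions are arbitrary away from 0. *)
pose U0 : set V := [set z | rnorm z < rho /\ f z != 0].
have U0o : ropen U0.
  move=> z [zr fz].
  have fz0 : 0 < rnorm (f z) by rewrite rnorm_gt0.
  have [d d0 dP] := (continuous_rnormP _ _).1 (cdiff_cont (fd' _ zr).1) _ fz0.
  exists (Num.min d (rho - rnorm z)); first by rewrite lt_min d0 subr_gt0.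
  move=> w; rewrite lt_min => /andP[/dP wd wr]; split.
    by have := ler_rnormD (w - z) z; rewrite subrK; lra.
  by apply/eqP => E; move: wd; rewrite E sub0r rnormN ltxx.
pose Q x : R := rnorm (p (cc x) * (f (cc x))^-1 : C) ^+ 2.
pose E x : R := (Q \_ (cc @^-1` U0)) x.
have mU0 : measurable (cc @^-1` U0) by apply: measurable_tuple_open; exact: ropen_tuple_open.
have mE : measurable_fun setT E.
  apply/(measurable_restrictT Q mU0); apply: (@measurable_funX _ _ R).
  apply: (@continuous_measurable_coord R n U0 (fun z => p z * (f z)^-1) U0o) => z [zr fz].
  apply: ccontM; first exact: (cdiff_cont (pd' _ zr).1).
  by apply: ccontV; [exact: fz|exact: (cdiff_cont (fd' _ zr).1)].
have E0 x : 0 <= E x by rewrite /E /patch; case: ifP => // _; exact: sqr_ge0.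
pose I := (\int[mu]_x (E x)%:E)%E.
have Ifin : (I < +oo)%E.
  apply: le_lt_trans fin; rewrite [X in (_ <= X)%E]integral_mkcond.
  apply: ge0_le_integral_subset => //.
  - by move=> x _; rewrite lee_fin.
  - by move=> x _; rewrite /patch; case: ifP => // _; rewrite lee_fin sqr_ge0.
  - move=> x _; rewrite /E /patch; case: ifPn => xU; last first.
      by case: ifP => // _; rewrite lee_fin sqr_ge0.
    rewrite mem_set//; apply: in_ball.
    by move: xU; rewrite inE => -[+ _]; rewrite /rho lt_min => /andP[].
pose W : set ((n + n).-tuple T) := cc @^-1` [set w | rnorm (w - w0) < e].
have Wo : tuple_open W.
  apply: ropen_tuple_open => z /= ze; exists (e - rnorm (z - w0)); first by rewrite subr_gt0.
  move=> w wz; have := ler_rnormD (w - z) (z - w0).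
  by rewrite addrA subrK /=; lra.
have mW : measurable W by exact: measurable_tuple_open.
have W0 : (0 < mu W)%E.
  have Ww : W (real_coord w0) by rewrite /W /= complex_coordK subrr rnorm0.
  have [d d0 dW] := Wo _ Ww.
  apply: lt_le_trans (tuple_measure_box_gt0 (real_coord w0) d0) _.
  by apply: le_measure => //; rewrite inE//; exact: measurable_tuple_box.
pose S : set (T * T) := `[(- s), s]%classic `*` `[(- s), s]%classic.
have mS : measurable S by apply: measurableX; exact: measurable_itv.
(* Averages [|p / f|^2] over [w] in [W] and over the translates by [t v] with [t] in the square: slicewise it is [+oo], while translation invariance bounds it by [I * leb2 S]. *)
pose F (xu : (n + n).-tuple T * (T * T)) : \bar R :=
  (\1_W xu.1 * \1_S xu.2 * E (line_shift v xu))%:E.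
have mF : measurable_fun setT F.
  apply/measurable_EFinP; apply: measurable_funM; last first.
    exact: (measurableT_comp mE (measurable_line_shift v)).
  have mw : measurable_fun setT (\1_W : _ -> R) by exact: measurable_indic.
  have ms : measurable_fun setT (\1_S : _ -> R) by exact: measurable_indic.
  apply: measurable_funM; first exact: (measurableT_comp mw measurable_fst).
  exact: (measurableT_comp ms measurable_snd).
have F0 xu : (0 <= F xu)%E by rewrite lee_fin !mulr_ge0.
pose nu : {sigma_finite_measure set (T * T)%type -> \bar R} := @plane_measure R.
have fub := @fubini_tonelli _ _ _ _ R mu nu F mF F0.
have lower x : W x -> (\int[nu]_u F (x, u) = +oo)%E.
  move=> Wx; have [wr neqw] := He _ Wx.
  have [[H Hh HE]|[a [c [d [as_ c0 d0 bad]]]]] := quotient_slice gd fd' pd' wr.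
    by exfalso; apply: neqw; exact: (kinv _ _ wr Hh HE).
  pose d' := Num.min (d / 4) ((s - snorm a) / 2).
  have d'0 : 0 < d' by rewrite lt_min !divr_gt0 ?subr_gt0.
  have d'd : d' <= d / 4 by rewrite /d' ge_min lexx.
  have d's : d' <= (s - snorm a) / 2 by rewrite /d' ge_min lexx orbT.
  apply: (@integral_inv_square R (complex.Re a) (complex.Im a) (c ^+ 2) d').
  - have mp : measurable_fun setT (fun u : T * T => (x, u)).
      by apply: measurable_fun_pair; [exact: measurable_cst|exact: measurable_id].
    exact: (measurableT_comp mF mp).
  - by move=> u; exact: F0.
  - by rewrite exprn_gt0.
  - exact: d'0.
  move=> u1 u2 /andP[a1 a2] /andP[b1 b2]; pose t : C := Complex u1 u2.
  have ReE : complex.Re (t - a) = u1 - complex.Re a by case: (a).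
  have ImE : complex.Im (t - a) = u2 - complex.Im a by case: (a).
  have ta0 : 0 < rnorm (t - a).
    by apply: lt_le_trans (ler_Re_rnorm _); rewrite ReE normr_gt0 subr_eq0 gt_eqF.
  have snta : snorm (t - a) <= d'.
    rewrite /snorm ReE ImE ge_max !ger0_norm ?subr_ge0 ?(ltW a1) ?(ltW b1)//.
    by rewrite !lerBlDl a2 b2.
  have tad : rnorm (t - a) < d by apply: le_lt_trans (rnorm_le_snorm _) _; lra.
  have ts : snorm t <= s.
    have := ler_snormD a (t - a); rewrite [a + _]addrC subrK.
    by lra.
  have [fn le1] := bad t ltac:(by rewrite ta0).
  have f0 : 0 < rnorm (f (cc x + t *: v)) by rewrite rnorm_gt0.
  rewrite /F /=.
  have -> : \1_W x = 1 :> R by rewrite indicE mem_set.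
  have -> : \1_S (u1, u2) = 1 :> R.
    rewrite indicE mem_set//; move: ts; rewrite ge_max !ler_norml /= => /andP[h1 h2].
    by split; rewrite /= in_itv.
  have ccE : cc (line_shift v (x, (u1, u2))) = cc x + t *: v by exact: complex_coord_shift.
  have -> : E (line_shift v (x, (u1, u2))) = Q (line_shift v (x, (u1, u2))).
    rewrite /E /patch mem_set//=; split; rewrite ccE//.
    exact: (line_in_ball gd wr ts).
  rewrite !mul1r lee_fin /Q ccE -ReE -ImE -rnorm_sqr rnormM rnormV -expr_div_n.
  rewrite lerXn2r ?nnegrE ?divr_ge0 ?rnorm_ge0 ?(ltW c0)//.
  by rewrite ler_pdivrMr// mulrAC ler_pdivlMr.
have upper u : (\int[mu]_x F (x, u) <= ((cst I) \_ S) u)%E.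
  rewrite /patch; case: ifPn => uS.
    rewrite /= /I -(ge0_integral_tuple_shift (real_coord ((Complex u.1 u.2 : C) *: v)) (f := EFin \o E)).
    - have SE : \1_S u = 1 :> R by rewrite indicE uS.
      apply: ge0_le_integral_subset => // x _; first by rewrite lee_fin.
      rewrite /F lee_fin SE mulr1 -[leRHS]mul1r; apply: ler_wpM2r; first exact: E0.
      by rewrite indicE; case: (_ \in _).
    - exact/measurable_EFinP.
    - by move=> x; rewrite lee_fin.
  have SE : \1_S u = 0 :> R by rewrite indicE (negbTE uS).
  by rewrite integral0_eq// => x _; rewrite /F SE mulr0 mul0r.
have leb_s : leb `[(- s), s]%classic = (s + s)%:E.
  have ss : - s < s by rewrite gtrN.
  by rewrite lebesgue_measure_itv/= lte_fin ss -EFinB opprK.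
have I0 : (0 <= I)%E by rewrite /I; apply: integral_ge0 => x _; rewrite lee_fin; exact: E0.
have RHSfin : (\int[nu]_u \int[mu]_x F (x, u) < +oo)%E.
  apply: (@le_lt_trans _ _ (\int[nu]_u ((cst I) \_ S) u)%E).
    apply: ge0_le_integral_subset => //.
    - by move=> u _; apply: integral_ge0 => x _; exact: F0.
    - by move=> u _; rewrite /patch; case: ifP.
  rewrite -integral_mkcond (integral_cst _ mS) lte_mul_pinfty//.
    by rewrite ge0_fin_numE.
  rewrite [X in (X < _)%E](_ : _ = ((s + s) * (s + s))%:E) ?ltry//.
  transitivity (leb `[(- s)%R, s]%classic * leb `[(- s)%R, s]%classic)%E.
    by apply: product_measure1E; exact: measurable_itv.
  by rewrite EFinM; congr (_ * _)%E.
move: RHSfin; rewrite -fub; apply/negP; rewrite -leNgt.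
apply: (@le_trans _ _ (\int[mu]_(x in W) (cst +oo x))%E).
  by rewrite integral_cst// gt0_mulye.
apply: ge0_le_integral_subset => //.
- by move=> x _; exact: leey.
- by move=> x _; apply: integral_ge0 => u _; exact: F0.
- by move=> x Wx; rewrite lower.
Qed.

End L2_division.

(** * Germs *)

Section germ_representatives.
Context (R : realType) (n : nat).
Local Notation C := (R[i]^o).
Local Notation V := 'rV[C]_n.
Implicit Types (p q : germ R n) (k : V -> C).

Definition gfun p : V -> C := repr p : holo R n.

Lemma gfun_differentiable p : \forall z \near (0 : V), differentiable (gfun p) z.
Proof. by rewrite /gfun; case: (repr p) => h /= /asboolP. Qed.

Lemma pi_eqP (a b : holo R n) :
  ((\pi a : germ R n) = \pi b)%qT <-> \forall z \near (0 : V), a z = b z.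
Proof.
have -> : ((\pi a : germ R n) = \pi b)%qT <-> a - b \in @zero_at0 R n.
  by split=> [h|h]; [rewrite Quotient.idealrBE; apply/eqP|apply/eqP; rewrite -Quotient.idealrBE].
split=> [/asboolP h|h]; [|apply/asboolP]; apply: filterS h => z h.
  by apply/eqP; rewrite -subr_eq0; apply/eqP; exact: h.
by rewrite [LHS](_ : _ = a z - b z)// h subrr.
Qed.

Lemma germ_eqP p q : p = q <-> \forall z \near (0 : V), gfun p z = gfun q z.
Proof. by rewrite /gfun -pi_eqP !reprK. Qed.

Lemma germ_of k : (\forall z \near (0 : V), differentiable k z) ->
  exists p, \forall z \near (0 : V), gfun p z = k z.
Proof.
move=> /asboolP kd; pose h := @Holo R n k kd.
by exists (\pi h)%qT; rewrite /gfun; apply: (pi_eqP (repr _) h).1; rewrite reprK.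
Qed.

Lemma gfunM p q : \forall z \near (0 : V), gfun (p * q) z = gfun p z * gfun q z.
Proof.
apply: (pi_eqP (repr (p * q)) (repr p * repr q)).1.
by rewrite reprK rmorphM /= !reprK.
Qed.

Lemma gfun1 : \forall z \near (0 : V), gfun 1 z = 1.
Proof.
apply: (pi_eqP (repr 1) 1).1.
by rewrite reprK rmorph1.
Qed.

Lemma gfunX p l : \forall z \near (0 : V), gfun (p ^+ l) z = gfun p z ^+ l.
Proof.
elim: l => [|l ih]; first exact: gfun1.
by apply: filterS2 ih (gfunM p (p ^+ l)) => z ih; rewrite !exprS ih.
Qed.

Lemma germ_neq0P p : p <> 0 <-> ~ \forall z \near (0 : V), gfun p z = 0.
Proof.
have g0 : \forall z \near (0 : V), gfun 0 z = 0.
  by apply: (pi_eqP (repr 0) 0).1; rewrite reprK rmorph0.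
suff -> : p = 0 <-> \forall z \near (0 : V), gfun p z = 0 by [].
by rewrite germ_eqP; split => h; apply: filterS2 h g0 => z -> ->.
Qed.

End germ_representatives.

(** * Divisibility of germs *)

Section germ_domain.
Context (R : realType) (n : nat).
Local Notation C := (R[i]^o).
Local Notation V := 'rV[C]_n.
Implicit Types (f g h k p a b : germ R n).

(* Stated to hide the filter instances, which inference does not find through the [normedModType] structure of row vectors. *)
Lemma near_conj (P Q : V -> Prop) : (\forall z \near (0 : V), P z) ->
  (\forall z \near (0 : V), Q z) -> \forall z \near (0 : V), P z /\ Q z.
Proof. by move=> HP HQ; exact: filterI. Qed.

Lemma near_imply (P Q : V -> Prop) : (\forall z \near (0 : V), P z) ->
  (forall z, P z -> Q z) -> \forall z \near (0 : V), Q z.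
Proof. by move=> HP PQ; apply: filterS HP. Qed.

(** Cancellation is pointwise where [p] does not vanish, and these points are dense. *)
Lemma germ_mulfI p : p <> 0 -> forall a b, p * a = p * b -> a = b.
Proof.
move=> /germ_neq0P p0 a b /germ_eqP pab; apply/germ_eqP.
apply: (generic_eq (gfun_differentiable p) p0 (gfun_differentiable a) (gfun_differentiable b)).
have H := near_conj pab (near_conj (gfunM p a) (gfunM p b)).
by apply: near_imply H _ => z [E [Ea Eb]] pz; apply: (mulfI pz); rewrite -Ea -Eb.
Qed.

Lemma germ_expf_neq0 p l : p <> 0 -> p ^+ l <> 0.
Proof.
move=> p0; elim: l => [|l ih]; first by apply/eqP; exact: oner_neq0.
by rewrite exprS => E; apply: ih; apply: (germ_mulfI p0); rewrite E mulr0.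
Qed.

(** Euclid's lemma: the common factor [c] given by [common_denominator] is a unit by coprimality,
    and [c h] is a multiple of [f]. *)
Lemma coprime_dvd f g h k : f <> 0 -> coprime_germ f g -> f * k = g * h ->
  exists k', h = f * k'.
Proof.
move=> f0 cop /germ_eqP E.
have E' : \forall z \near (0 : V), gfun f z * gfun k z = gfun g z * gfun h z.
  have H := near_conj E (near_conj (gfunM f k) (gfunM g h)).
  by apply: near_imply H _ => z [e [<- <-]].
have [c' [A' [F' [G' [[cd Ad Fd Gd] E1 E2 E3]]]]] := common_denominator (gfun_differentiable f)
  (gfun_differentiable g) (gfun_differentiable h) (gfun_differentiable k) E' ((germ_neq0P f).1 f0).
have [c cE] := germ_of cd; have [A AE] := germ_of Ad.
have [F FE] := germ_of Fd; have [G GE] := germ_of Gd.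
have lift (p q s : germ R n) (p' q' : V -> C) : (\forall z \near (0 : V), gfun p z = p' z) ->
    (\forall z \near (0 : V), gfun q z = q' z) -> (\forall z \near (0 : V), gfun s z = p' z * q' z) ->
    s = p * q.
  move=> h1 h2 h3; apply/germ_eqP.
  have H := near_conj (gfunM p q) (near_conj h1 (near_conj h2 h3)).
  by apply: near_imply H _ => z [-> [-> [-> ->]]].
have fE : f = c * F by exact (lift c F f c' F' cE FE E2).
have gE : g = c * G by exact (lift c G g c' G' cE GE E3).
have [e ce] := cop c F G fE gE.
have ch : c * h = f * A.
  have hh : \forall z \near (0 : V), gfun h z = gfun h z by exact: near_imply E' _.
  apply/esym; apply: (lift _ _ _ _ _ cE hh).
  have H := near_conj (gfunM f A) (near_conj E1 AE).
  by apply: near_imply H _ => z [-> [-> ->]].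
exists (A * e); rewrite mulrA -ch -mulrA [h * e]mulrC mulrA ce mul1r.
by [].
Qed.

(** To extract one factor [f] from [h], the factors [g] are removed one by one; that factor is then
    cancelled on both sides, and [l] decreases. *)
Lemma coprime_dvdX f g m l h k : f <> 0 -> coprime_germ f g -> f ^+ l * k = h * g ^+ m ->
  exists k', h = f ^+ l * k'.
Proof.
move=> f0 cop.
have dvdX m' h' k' : f * k' = h' * g ^+ m' -> exists k2, h' = f * k2.
  elim: m' h' k' => [|m' ih] h' k' E; first by exists k'; rewrite E expr0 mulr1.
  have [k2 E2] : exists k2, h' * g ^+ m' = f * k2.
    by apply: (coprime_dvd f0 cop (k := k')); rewrite E exprS mulrCA.
  exact: ih (esym E2).
elim: l h k => [|l ih] h k E; first by exists h; rewrite expr0 mul1r.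
have [h' hE] : exists k2, h = f * k2.
  by apply: (dvdX m _ (f ^+ l * k)); rewrite mulrA -exprS.
have [k' E'] : exists k', h' = f ^+ l * k'.
  by apply: (ih _ k); apply: (germ_mulfI f0); rewrite !mulrA -exprS E hE.
by exists k'; rewrite hE E' mulrA exprS.
Qed.

End germ_domain.

(** * Local integrability *)

Section local_integrability.
Context (R : realType) (n : nat).
Local Notation C := (R[i]^o).
Local Notation V := 'rV[C]_n.
Local Notation T := (measurableTypeR R).
Local Notation leb := (@lebesgue_measure R).
Local Notation mu := (tuple_measure (@lebesgue_measure R) (n + n)).
Local Notation cc := (@complex_coord R n).
Implicit Types (F G : V -> R).

Lemma closed_ball0_lty (r : R) : 0 < r -> (mu (@Defs.closed_ball0 R n r) < +oo)%E.
Proof.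
move=> r0; pose a : (n + n).-tuple T := [tuple (0 : R) | i < n + n].
have r1 : 0 < r + 1 by rewrite addr_gt0.
apply: le_lt_trans (tuple_measure_box_lty a r1).
apply: le_measure; rewrite ?inE; [exact: measurable_closed_ball0|exact: measurable_tuple_box|].
move=> x xr i; rewrite tnth_mktuple subr0.
suff : `|tnth x i : R| <= r by move=> /le_lt_trans; apply; rewrite ltrDl.
rewrite -(ler_pXn2r (n := 2)) ?nnegrE ?(ltW r0)// real_normK ?num_real//.
apply: le_trans xr; rewrite (bigD1 i)//= lerDl.
by apply: sumr_ge0 => j _; exact: sqr_ge0.
Qed.

Definition integrable_at0 F : Prop := exists2 r : R, 0 < r &
  (\int[mu]_(x in @Defs.closed_ball0 R n r) (F (cc x))%:E < +oo)%E.

(** The term 1 absorbs bounded contributions, since balls have finite measure. Measurability is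
    asked of the majorant, for the additivity of its integral. *)
Lemma integrable_at0_le F G (B rho : R) : 0 < rho -> 0 <= B ->
  (forall z, 0 <= F z) -> (forall z, 0 <= G z) ->
  measurable_fun (cc @^-1` [set z | rnorm z < rho]) (G \o cc) ->
  (\forall z \near (0 : V), F z <= B * (1 + G z)) ->
  integrable_at0 G -> integrable_at0 F.
Proof.
move=> rho0 B0 F0 G0 mG /near0P[d d0 FG] [r0 r00 Gr0].
have [r1 r10 br1] := @closed_ball0_in_ball R n d d0.
have [r2 r20 br2] := @closed_ball0_in_ball R n rho rho0.
pose r := Num.min r0 (Num.min r1 r2).
have r_gt0 : 0 < r by rewrite !lt_min r00 r10.
have sub s : r <= s -> @Defs.closed_ball0 R n r `<=` @Defs.closed_ball0 R n s.
  move=> rs x /le_trans; apply; rewrite lerXn2r ?nnegrE ?(ltW r_gt0)//.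
  exact: le_trans (ltW r_gt0) rs.
have mB := @measurable_closed_ball0 R n r.
have mGB : measurable_fun (@Defs.closed_ball0 R n r) (fun x => (G (cc x))%:E).
  apply/measurable_EFinP; apply: (@measurable_funS _ _ _ _ (cc @^-1` [set z | rnorm z < rho])) mG.
    by apply: measurable_tuple_open; apply: ropen_tuple_open; exact: ropen_ball0.
  by move=> x /(sub r2 _)/br2; apply; rewrite /r !ge_min lexx !orbT.
have Gr : (\int[mu]_(x in @Defs.closed_ball0 R n r) (G (cc x))%:E < +oo)%E.
  apply: le_lt_trans Gr0; apply: ge0_le_integral_subset => //.
  - by apply: sub; rewrite /r ge_min lexx.
  - by move=> x _; rewrite lee_fin.
  - by move=> x _; rewrite lee_fin.
exists r; first exact: r_gt0.
apply: (@le_lt_trans _ _ (\int[mu]_(x in @Defs.closed_ball0 R n r) (B%:E * (1 + (G (cc x))%:E)))%E).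
  apply: ge0_le_integral_subset => //.
  - by move=> x _; rewrite lee_fin.
  - by move=> x _; rewrite -EFinD -EFinM lee_fin mulr_ge0// addr_ge0.
  - move=> x xr; rewrite -EFinD -EFinM lee_fin; apply: FG; apply: br1.
    by apply: sub xr; rewrite /r !ge_min lexx orbT.
rewrite ge0_integralZl//.
- rewrite ge0_integralD//.
  + rewrite lte_mul_pinfty// lte_add_pinfty// integral_cst// mul1e.
    exact: closed_ball0_lty.
  + by move=> x _; rewrite lee_fin.
- by apply: emeasurable_funD.
- by move=> x _; rewrite -EFinD lee_fin addr_ge0.
Qed.

Lemma bounded_integrable_at0 F (B : R) : (forall z, 0 <= F z) ->
  (\forall z \near (0 : V), F z <= B) -> integrable_at0 F.
Proof.
move=> F0 FB.
have B0 : 0 <= B by apply: le_trans (F0 0) _; exact: nbhs_singleton FB.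
apply: (@integrable_at0_le F (fun=> 0) B 1) => //.
- exact: measurable_cst.
- by apply: near_imply FB _ => z; rewrite addr0 mulr1.
- by exists 1 => //; rewrite integral0.
Qed.

End local_integrability.

(** * Multiplier ideals *)

Section power_inequalities.
Context (R : realType).
Implicit Types (H G F K lam : R).

Lemma powR_div (G F p : R) : 0 <= G -> 0 <= F -> G `^ p / F `^ p = (G / F) `^ p.
Proof.
by move=> G0 F0; rewrite powRM ?invr_ge0// -(powR_inv1 F0) -powRrM mulN1r powRN.
Qed.

(** By the conventions that 0 to a nonzero power is 0 and that the inverse of 0 is 0. Pointwise
    comparisons of integrands are thus trivial at the zeros of [f] and [g]. *)
Lemma powR_div_eq0 H G F lam : 0 < lam -> G = 0 \/ F = 0 ->
  H ^+ 2 * G `^ (2 * lam) / F `^ (2 * lam) = 0.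
Proof.
move=> lam0; have l2 : 2 * lam != 0 by rewrite mulf_neq0 ?gt_eqF.
by case=> ->; rewrite powR0// ?invr0 ?mulr0 ?mul0r.
Qed.

Lemma powR_div_shift H G F K lam l : 0 <= G -> 0 <= F -> F != 0 -> G != 0 ->
  H * G ^+ l = F ^+ l * K ->
  H ^+ 2 * G `^ (2 * (lam + l%:R)) / F `^ (2 * (lam + l%:R)) =
  K ^+ 2 * G `^ (2 * lam) / F `^ (2 * lam).
Proof.
move=> G0 F0 Fn Gn E.
have powS X : 0 <= X -> X != 0 -> X `^ (2 * (lam + l%:R)) = X `^ (2 * lam) * (X ^+ l) ^+ 2.
  move=> X0 Xn; rewrite mulrDr powRD ?Xn ?implybT// -natrM powR_mulrn//.
  by rewrite mulnC exprM.
rewrite !powS//; have Fl : F ^+ l != 0 by rewrite expf_neq0.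
have Fp : F `^ (2 * lam) != 0 by rewrite powR_eq0 (negbTE Fn).
have -> : H ^+ 2 * (G `^ (2 * lam) * (G ^+ l) ^+ 2) = (F ^+ l * K) ^+ 2 * G `^ (2 * lam).
  by rewrite -E; ring.
by field; rewrite Fl Fp.
Qed.

(** With [x = G / F], the power of [x] of exponent [2 l] is at most 1 if [x <= 1], and at most the
    power of exponent [2 (lam + l)] otherwise. *)
Lemma sqr_div_le_powR H G F lam l : 0 <= G -> 0 <= F -> 0 <= lam -> (0 < l)%N ->
  (H * G ^+ l / F ^+ l) ^+ 2 <=
  H ^+ 2 + H ^+ 2 * G `^ (2 * (lam + l%:R)) / F `^ (2 * (lam + l%:R)).
Proof.
move=> G0 F0 lam0 l0.
rewrite -mulrA -expr_div_n exprMn -[X in _ <= _ + X]mulrA powR_div// -[X in _ <= X + _]mulr1 -mulrDr.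
apply: ler_wpM2l; first exact: sqr_ge0.
have : 0 <= G / F by rewrite divr_ge0.
move: (G / F) => x x0.
have [x1|x1] := leP x 1.
  apply: (@le_trans _ _ 1); last by rewrite lerDl powR_ge0.
  by rewrite -exprM exprn_ile1.
rewrite -exprM -powR_mulrn// ler_wpDl// ler_powR//; first exact: ltW.
by rewrite natrM mulrC; lra.
Qed.

End power_inequalities.

Section multiplier.
Context (R : realType) (n : nat).
Local Notation C := (R[i]^o).
Local Notation V := 'rV[C]_n.
Local Notation cc := (@complex_coord R n).
Implicit Types (f g h k p : germ R n) (lam : R).

Definition integrand f g lam h (z : V) : R :=
  rnorm (gfun h z) ^+ 2 * rnorm (gfun g z) `^ (2 * lam) / rnorm (gfun f z) `^ (2 * lam).

Lemma integrand_ge0 f g lam h z : 0 <= integrand f g lam h z.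
Proof.
apply: divr_ge0; last exact: powR_ge0.
by apply: mulr_ge0; [exact: sqr_ge0|exact: powR_ge0].
Qed.

(** Holds by conversion, the [rnorm] of a complex number being its [Normc.normc]. *)
Lemma multiplier_idealE f g lam h :
  multiplier_ideal f g lam h <-> integrable_at0 (integrand f g lam h).
Proof. exact: iff_refl. Qed.

(** Stated for all smaller radii, so that several germs can share one. *)
Lemma measurable_gfun p : exists2 rho : R, 0 < rho & forall rho' : R, rho' <= rho ->
  measurable_fun (cc @^-1` [set z | rnorm z < rho']) (fun x => rnorm (gfun p (cc x))).
Proof.
have /near0P[rho rho0 pd] := gfun_differentiable p; exists rho => // rho' le.
apply: continuous_measurable_coord => [|z /= zr]; first exact: ropen_ball0.
by apply: cdiff_cont; apply: pd; exact: lt_le_trans zr le.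
Qed.

Lemma measurable_integrand f g lam h : exists2 rho : R, 0 < rho &
  measurable_fun (cc @^-1` [set z | rnorm z < rho]) (integrand f g lam h \o cc).
Proof.
have [r1 r10 mf] := measurable_gfun f; have [r2 r20 mg] := measurable_gfun g.
have [r3 r30 mh] := measurable_gfun h.
exists (Num.min r1 (Num.min r2 r3)); first by rewrite !lt_min r10 r20.
set rho := Num.min _ _.
have {}mf : measurable_fun (cc @^-1` [set z | rnorm z < rho]) (fun x => rnorm (gfun f (cc x))).
  by apply: mf; rewrite /rho ge_min lexx.
have {}mg : measurable_fun (cc @^-1` [set z | rnorm z < rho]) (fun x => rnorm (gfun g (cc x))).
  by apply: mg; rewrite /rho !ge_min lexx orbT.
have {}mh : measurable_fun (cc @^-1` [set z | rnorm z < rho]) (fun x => rnorm (gfun h (cc x))).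
  by apply: mh; rewrite /rho !ge_min lexx !orbT.
rewrite (_ : _ \o _ = fun x => rnorm (gfun h (cc x)) ^+ 2 *
    rnorm (gfun g (cc x)) `^ (2 * lam) * rnorm (gfun f (cc x)) `^ (- (2 * lam))); last first.
  by apply/funext => x; rewrite powRN.
apply: measurable_funM; first apply: measurable_funM.
- exact: (@measurable_funX _ _ R).
- exact: (measurableT_comp (measurable_powR _) mg).
- exact: (measurableT_comp (measurable_powR _) mf).
Qed.

Lemma gfun_bounded p : exists2 B : R, 0 <= B & \forall z \near (0 : V), rnorm (gfun p z) <= B.
Proof.
have [B BP] := near_bounded (cdiff_cont (nbhs_singleton (gfun_differentiable p))).
exists B; last exact: BP.
by apply: le_trans (rnorm_ge0 _) _; exact: nbhs_singleton BP.
Qed.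

Lemma multiplier_ideal_le f g lam h (F : V -> R) (B : R) : 0 <= B ->
  (forall z, 0 <= F z) ->
  (\forall z \near (0 : V), F z <= B * (1 + integrand f g lam h z)) ->
  multiplier_ideal f g lam h -> integrable_at0 F.
Proof.
move=> B0 F0 FB /multiplier_idealE.
have [rho rho0 mI] := measurable_integrand f g lam h.
exact: (integrable_at0_le rho0 B0 F0 (@integrand_ge0 f g lam h) mI FB).
Qed.

(** A power of exponent 0 is 1 even at 0, so the integrand is the bounded function [|h|^2]. *)
Lemma multiplier_ideal0 f g : multiplier_ideal f g 0 = setT.
Proof.
apply/seteqP; split => // h _; apply/multiplier_idealE.
have [B B0 BP] := gfun_bounded h.
apply: (@bounded_integrable_at0 _ _ _ (B ^+ 2)); first exact: integrand_ge0.
apply: near_imply BP _ => z hB.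
by rewrite /integrand mulr0 !powRr0 mulr1 divr1 lerXn2r ?nnegrE ?rnorm_ge0.
Qed.

Lemma multiplier_ideal_shift f g lam l : f <> 0 -> g <> 0 -> 0 <= lam ->
  multiplier_ideal f g (lam + l%:R) =
  quotient_mul_cap (f ^+ l) (g ^+ l) (multiplier_ideal f g lam).
Proof.
move=> f0 g0 lam0; case: (posnP l) => [->|l0].
  apply/seteqP; split => h; rewrite addr0.
    by move=> hJ; exists h => //; rewrite !expr0 mulr1 mul1r.
  by move=> [k kJ]; rewrite !expr0 mulr1 mul1r => ->.
have laml : 0 < lam + l%:R by rewrite ltr_wpDl// ltr0n.
have values h k : h * g ^+ l = f ^+ l * k -> \forall z \near (0 : V),
    rnorm (gfun h z) * rnorm (gfun g z) ^+ l = rnorm (gfun f z) ^+ l * rnorm (gfun k z).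
  move=> /germ_eqP E.
  have H := near_conj E (near_conj (near_conj (gfunM h (g ^+ l)) (gfunX g l))
    (near_conj (gfunM (f ^+ l) k) (gfunX f l))).
  apply: near_imply H _ => z [e [[e1 e2] [e3 e4]]].
  by rewrite -!rnormX -!rnormM -e2 -e4 -e1 -e3 e.
apply/seteqP; split => h.
- move=> hJ.
  have [B B0 hB] := gfun_bounded h.
  pose F z : R := rnorm (gfun (h * g ^+ l) z * (gfun (f ^+ l) z)^-1 : C) ^+ 2.
  have [r r0 Fint] : integrable_at0 F.
    (* [F] is at most [|h|^2] plus the integrand of [h], and [B ^+ 2] bounds the first term. *)
    apply: (multiplier_ideal_le (B := B ^+ 2 + 1) _ _ _ hJ).
    + by rewrite addr_ge0// sqr_ge0.
    + by move=> z; exact: sqr_ge0.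
    have H := near_conj hB (near_conj (near_conj (gfunM h (g ^+ l)) (gfunX g l)) (gfunX f l)).
    apply: near_imply H _ => z [zB [[e1 e2] e3]].
    rewrite /F e1 e2 e3 !rnormM rnormV !rnormX.
    apply: le_trans (sqr_div_le_powR _ (rnorm_ge0 _) (rnorm_ge0 _) lam0 l0) _.
    rewrite -/(integrand f g (lam + l%:R) h z).
    have := integrand_ge0 f g (lam + l%:R) h z; move: (integrand _ _ _ _ _) => I I0.
    have h2 : rnorm (gfun h z) ^+ 2 <= B ^+ 2 by rewrite lerXn2r ?nnegrE ?rnorm_ge0.
    have := sqr_ge0 B; move: h2 I0; move: (_ ^+ 2) (B ^+ 2) => a b h2 I0 b0.
    by nra.
  have [k' kd' kE'] := L2_divide (gfun_differentiable _) (gfun_differentiable _)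
    ((germ_neq0P _).1 (germ_expf_neq0 (l := l) f0)) r0 Fint.
  have [k kE] := germ_of kd'.
  have E : h * g ^+ l = f ^+ l * k.
    apply/germ_eqP; have H := near_conj kE' (near_conj kE (gfunM (f ^+ l) k)).
    by apply: near_imply H _ => z [-> [<- ->]].
  exists k; last exact: E.
  (* The exponent 0 is treated apart: its integrand does not vanish at the zeros of [f] and [g],
     where the comparison below uses that it does. *)
  move: lam0; rewrite le_eqVlt => /orP[/eqP <-|lam0]; first by rewrite multiplier_ideal0.
  apply/multiplier_idealE; apply: (multiplier_ideal_le (B := 1) _ _ _ hJ); first exact: ler01.
    exact: integrand_ge0.
  apply: near_imply (values _ _ E) _ => z Ez.
  apply: (@le_trans _ _ (integrand f g (lam + l%:R) h z)); last by rewrite mul1r lerDr.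
  have [G0|G0] := eqVneq (rnorm (gfun g z)) 0.
    by rewrite [leLHS]powR_div_eq0 ?integrand_ge0//; left.
  have [F0|F0] := eqVneq (rnorm (gfun f z)) 0.
    by rewrite [leLHS]powR_div_eq0 ?integrand_ge0//; right.
  by rewrite /integrand (powR_div_shift _ _ _ F0 G0 Ez) ?rnorm_ge0.
- move=> [k kJ E]; apply/multiplier_idealE.
  apply: (multiplier_ideal_le (B := 1) _ _ _ kJ); [exact: ler01|exact: integrand_ge0|].
  apply: near_imply (values _ _ E) _ => z Ez.
  apply: (@le_trans _ _ (integrand f g lam k z)); last by rewrite mul1r lerDr.
  have [G0|G0] := eqVneq (rnorm (gfun g z)) 0.
    by rewrite [leLHS]powR_div_eq0 ?integrand_ge0//; left.
  have [F0|F0] := eqVneq (rnorm (gfun f z)) 0.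
    by rewrite [leLHS]powR_div_eq0 ?integrand_ge0//; right.
  by rewrite /integrand (powR_div_shift _ _ _ F0 G0 Ez) ?rnorm_ge0.
Qed.

(** Near 0 the factor [|g|^(2 lam)] is bounded. *)
Lemma multiplier_ideal_sub f g lam : 0 < lam ->
  multiplier_ideal f 1 lam `<=` multiplier_ideal f g lam.
Proof.
move=> lam0 h hJ; have [B B0 gB] := gfun_bounded g.
apply/multiplier_idealE.
apply: (multiplier_ideal_le (B := B `^ (2 * lam)) _ _ _ hJ); first exact: powR_ge0.
  exact: integrand_ge0.
apply: near_imply (near_conj gB (@gfun1 R n)) _ => z [zB z1].
have I0 := integrand_ge0 f 1 lam h z.
apply: (@le_trans _ _ (B `^ (2 * lam) * integrand f 1 lam h z)); last first.
  by rewrite ler_wpM2l ?powR_ge0// lerDr.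
rewrite /integrand z1 rnorm1 powR1 mulr1 mulrAC [leLHS]mulrC.
apply: ler_wpM2r; first by apply: divr_ge0; [exact: sqr_ge0|exact: powR_ge0].
by apply: ge0_ler_powR; rewrite ?nnegrE ?rnorm_ge0 ?mulr_ge0 ?(ltW lam0).
Qed.

(** The shift from exponent 0, where the ideal is the whole ring: membership says that [f ^+ m]
    divides [h * g ^+ m], and coprimality removes the power of [g]. *)
Lemma multiplier_ideal_nat f g m : f <> 0 -> g <> 0 -> coprime_germ f g ->
  multiplier_ideal f g m%:R = principal_ideal (f ^+ m).
Proof.
move=> f0 g0 cop; rewrite -[m%:R]add0r multiplier_ideal_shift// multiplier_ideal0.
apply/seteqP; split => h; first by move=> [k _ /esym]; exact: coprime_dvdX.
by move=> [k ->]; exists (k * g ^+ m) => //; rewrite mulrA.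
Qed.

(** The ideals at [lam + 1] and [lam + 1 +- eps] are functions of those at [lam] and [lam +- eps],
    so an equality between the latter propagates. The bound [eps <= lam] keeps [lam - eps] in the
    range of the shift. *)
Lemma jumping_number_pred f g lam : f <> 0 -> g <> 0 -> 0 <= lam ->
  jumping_number f g (lam + 1) -> jumping_number f g lam.
Proof.
move=> f0 g0 lam0 [_ J]; split=> // eps eps0 epsl.
have shift mu : 0 <= mu -> multiplier_ideal f g (mu + 1) =
    quotient_mul_cap f g (multiplier_ideal f g mu).
  by move=> mu0; rewrite -[1]/(1%:R) multiplier_ideal_shift// !expr1.
have [|H|H] := J eps eps0; first by rewrite ler_wpDr.
- left=> E; apply: H; have le : 0 <= lam - eps by rewrite subr_ge0.
  have -> : lam + 1 - eps = lam - eps + 1 by rewrite addrAC.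
  exact: etrans (shift _ lam0) (etrans (congr1 (quotient_mul_cap f g) E) (esym (shift _ le))).
- right=> E; apply: H; have le : 0 <= lam + eps by rewrite addr_ge0// ltW.
  have -> : lam + 1 + eps = lam + eps + 1 by rewrite addrAC.
  exact: etrans (shift _ lam0) (etrans (congr1 (quotient_mul_cap f g) E) (esym (shift _ le))).
Qed.

End multiplier.

Theorem proposition5 (R : realType) (n : nat) (f g : germ R n)
    (f_neq0 : f <> 0) (g_neq0 : g <> 0) (fg_ncst : ~ constant_quotient f g) :
  ((forall (lambda : R) (l : nat), 0 <= lambda ->
      multiplier_ideal f g (lambda + l%:R) =
      quotient_mul_cap (f ^+ l) (g ^+ l) (multiplier_ideal f g lambda)) /\
   (forall lambda : R, 0 <= lambda ->
      jumping_number f g (lambda + 1) -> jumping_number f g lambda)) /\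
  ((forall lambda : R, 0 < lambda ->
      multiplier_ideal f 1 lambda `<=` multiplier_ideal f g lambda) /\
   (coprime_germ f g ->
    forall m : nat, (0 < m)%N ->
      multiplier_ideal f g m%:R = principal_ideal (f ^+ m))).
Proof.
split; split.
- by move=> lambda l lambda0; exact (multiplier_ideal_shift l f_neq0 g_neq0 lambda0).
- by move=> lambda lambda0; exact (jumping_number_pred f_neq0 g_neq0 lambda0).
- by move=> lambda lambda0; exact (@multiplier_ideal_sub R n f g lambda lambda0).
- by move=> cop m _; exact (multiplier_ideal_nat m f_neq0 g_neq0 cop).
Qed.
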